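(* Let $1<p<\infty$, $\frac1p+\frac1q=1$, let $(\mathbb{X},d)$ be a complete separable metric space and $\nu$ a nonnegative Radon measure on $\mathbb{X}$ which is finite on bounded sets. Let $T>0$ and $u_0\in L^2(\mathbb{X},\nu)$. The following conditions are equivalent: (a) $u$ is a weak solution in $[0,T]$ of the Cauchy problem $\partial_tu(t)\in\Delta_{p,\nu}(u(t))$, $u(0)=u_0$; (b) $u\in C([0,T];L^2(\mathbb{X},\nu))\cap W^{1,2}_{loc}(0,T;L^2(\mathbb{X},\nu))$, $u(0,\cdot)=u_0$, and for almost all $t\in[0,T]$: $u(t)\in W^{1,p}(\mathbb{X},d,\nu)$ and there exists a vector field $X(t)\in\mathcal{D}^{q,2}(\mathbb{X})$ with $|X(t)|^q\le|du(t)|_*^p$ $\nu$-a.e. such that $\mathrm{div}(X(t))=u_t(t,\cdot)$ in $\mathbb{X}$ and $$\int_{\mathbb{X}}u_t(u(t)-w)\,d\nu\le\int_{\mathbb{X}}dw(X(t))\,d\nu-\int_{\mathbb{X}}|du(t)|_*^p\,d\nu\qquad\forall\,w\in L^2(\mathbb{X},\nu)\cap W^{1,p}(\mathbb{X},d,\nu);$$ (c) $u\in C([0,T];L^2(\mathbb{X},\nu))\cap W^{1,2}_{loc}(0,T;L^2(\mathbb{X},\nu))$, $u(0,\cdot)=u_0$, and for almost all $t\in[0,T]$: $u(t)\in W^{1,p}(\mathbb{X},d,\nu)$ and there exists a vector field $X(t)\in\mathcal{D}^{q,2}(\mathbb{X})$ with $|X(t)|^q\le|du(t)|_*^p$ $\nu$-a.e.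 such that $\mathrm{div}(X(t))=u_t(t,\cdot)$ in $\mathbb{X}$ and $$\int_{\mathbb{X}}u_t(u(t)-w)\,d\nu=\int_{\mathbb{X}}dw(X(t))\,d\nu-\int_{\mathbb{X}}|du(t)|_*^p\,d\nu\qquad\forall\,w\in L^2(\mathbb{X},\nu)\cap W^{1,p}(\mathbb{X},d,\nu).$$
   Context: Sobolev functions: a Borel function $g:\mathbb{X}\to[0,\infty]$ is an upper gradient of a Borel function $u:\mathbb{X}\to\mathbb{R}$ if $|u(\gamma(l_\gamma))-u(\gamma(0))|\le\int_\gamma g$ for all (rectifiable) curves $\gamma:[0,l_\gamma]\to\mathbb{X}$; it is a $p$-weak upper gradient if this holds for all curves outside a family of zero $p$-modulus. $D^{1,p}(\mathbb{X})$ is the class of Borel functions having an upper gradient (equivalently a $p$-weak upper gradient) in $L^p(\mathbb{X},\nu)$, and $W^{1,p}(\mathbb{X},d,\nu)=D^{1,p}(\mathbb{X})\cap L^p(\mathbb{X},\nu)$ (an element of $L^p$ or $L^2$ belongs to $W^{1,p}$ if it has a representative with this property). $|Du|\in L^p(\mathbb{X},\nu)$ denotes the minimal $p$-weak upper gradient of $u$. Differential structure (Gigli): consider countable families $\{(f_i,A_i)\}_{i\in\mathbb{N}}$ where $(A_i)$ is a Borel partition of $\mathbb{X}$, $f_i\in D^{1,p}(\mathbb{X})$ and $\sum_i\int_{A_i}|Df_i|^p\,d\nu<\infty$; identify $\{(f_i,A_i)\}$ with $\{(g_j,B_j)\}$ if $|D(f_i-g_j)|=0$ $\nu$-a.e.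 on $A_i\cap B_j$ for all $i,j$. The pointwise norm of such a class is $|\{(f_i,A_i)\}|_*:=|Df_i|$ on $A_i$. The cotangent module $L^p(T^*\mathbb{X})$ is the completion of this space in the norm $\|\omega\|=(\int_{\mathbb{X}}|\omega|_*^p\,d\nu)^{1/p}$, with its natural $L^\infty(\mathbb{X},\nu)$-module structure. The differential of $f\in D^{1,p}(\mathbb{X})$ is $df:=(f,\mathbb{X})\in L^p(T^*\mathbb{X})$, so $|df|_*=|Df|$. The module $L^q(T\mathbb{X})$ of $q$-vector fields is the dual module $\mathrm{HOM}(L^p(T^*\mathbb{X}),L^1(\mathbb{X},\nu))$ of bounded $L^\infty$-linear maps; the action of $X$ on $\omega$ is written $\omega(X)\in L^1(\mathbb{X},\nu)$, and $|X|\in L^q(\mathbb{X},\nu)$ is the dual pointwise norm (essential supremum of $\omega(X)$ over $|\omega|_*\le1$). $\mathcal{D}^{q,2}(\mathbb{X})$ is the set of $X\in L^q(T\mathbb{X})$ for which there is $f\in L^2(\mathbb{X},\nu)$ with $\int_{\mathbb{X}}fg\,d\nu=-\int_{\mathbb{X}}dg(X)\,d\nu$ for all $g\in W^{1,p}(\mathbb{X},d,\nu)\cap L^2(\mathbb{X},\nu)$; then $\mathrm{div}(X):=f$. Operator: $\mathsf{Ch}_p(u)=\frac1p\int_{\mathbb{X}}|Du|^p\,d\nu$ if $u\in W^{1,p}(\mathbb{X},d,\nu)\cap L^2(\mathbb{X},\nu)$, and $+\infty$ otherwise in $L^2(\mathbb{X},\nu)$; $(u,v)\in\Delta_{p,\nu}$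 iff $-v\in\partial\mathsf{Ch}_p(u)$ (subdifferential in $L^2(\mathbb{X},\nu)$). Weak solution of the Cauchy problem in $[0,T]$: $u\in C([0,T];L^2(\mathbb{X},\nu))\cap W^{1,2}_{loc}(0,T;L^2(\mathbb{X},\nu))$, $u(0,\cdot)=u_0$, and for almost all $t\in(0,T)$, $u_t(t,\cdot)\in\Delta_{p,\nu}u(t,\cdot)$. *)

(* Defs.v *)
From HB Require Import structures.
From mathcomp Require Import all_boot all_order all_algebra.
From mathcomp Require Import all_classical all_reals all_analysis.
From mathcomp Require Import measurable_realfun.

Set Implicit Arguments.
Unset Strict Implicit.
Unset Printing Implicit Defensive.

Import Order.TTheory GRing.Theory Num.Theory.
Import numFieldNormedType.Exports.

Local Open Scope classical_set_scope.
Local Open Scope ring_scope.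

#[short(type="completeMetricType")]
HB.structure Definition CompleteMetric (K : numDomainType) :=
  {M of Metric K M & CompletePseudoMetric K M}.

Definition borel {R : realType} (X : completeMetricType R) :=
  g_sigma_algebraType (@open X).

Definition separable (T : topologicalType) :=
  exists2 S : set T, countable S & dense S.

(******************************************************************************)
(* Throughout, elements of L^r(X, nu) are represented by Borel functions      *)
(* X -> R of finite norm (the predicate Lfun of the library), and equality in *)
(* L^r(X, nu) is equality nu-a.e.                                             *)
(******************************************************************************)
Section metric_measure_space.
Context {R : realType} {X : completeMetricType R}.
Variable nu : {measure set (borel X) -> \bar R}.

Definition finite_on_bounded := forall B : set (borel X), measurable B ->
  (exists (x : X) (r : R), B `<=` ball x r) -> (nu B < +oo)%E.

Definition radon :=
  (forall K : set X, compact K -> (nu K < +oo)%E) /\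
  (forall B : set (borel X), measurable B ->
    nu B = ereal_sup [set nu K | K in [set K : set X | compact K /\ K `<=` B]]).

(* Curves. A rectifiable curve is given by its length l and its arc-length
   parametrization gamma : [0, l] -> X; the values of gamma outside [0, l] are
   irrelevant. The condition forces gamma to be 1-Lipschitz on [0, l]. *)

Definition polygonal_length (gamma : R -> X) (a b : R) (s : seq R) : R :=
  let F := gamma \o nth b (a :: s) in
  \sum_(0 <= n < size s) mdist (F n) (F n.+1).

Definition curve_length (gamma : R -> X) (a b : R) : \bar R :=
  ereal_sup [set (polygonal_length gamma a b s)%:E | s in itv_partition a b].

Definition curve : Type := (R * (R -> X))%type.

Definition is_curve (c : curve) :=
  0 <= c.1 /\
  forall t, t \in `[0, c.1] -> curve_length c.2 0 t = t%:E.

Definition curve_integral (c : curve) (g : borel X -> \bar R) : \bar R :=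
  \int[lebesgue_measure]_(t in `[0%R, c.1]%classic) g (c.2 t).

Definition borel_nonneg (g : borel X -> \bar R) :=
  measurable_fun [set: borel X] g /\ forall x, (0 <= g x)%E.

Definition gradient_inequality (u : borel X -> R) (g : borel X -> \bar R)
    (c : curve) :=
  (`|u (c.2 c.1) - u (c.2 0)|%:E <= curve_integral c g)%E.

Definition upper_gradient (u : borel X -> R) (g : borel X -> \bar R) :=
  borel_nonneg g /\ forall c, is_curve c -> gradient_inequality u g c.

Variable p : R.

Definition modulus (Gamma : set curve) : \bar R :=
  ereal_inf [set (\int[nu]_x (rho x `^ p))%E | rho in
    [set rho | borel_nonneg rho /\
      forall c, is_curve c -> Gamma c -> (1 <= curve_integral c rho)%E]].

Definition weak_upper_gradient (u : borel X -> R) (g : borel X -> \bar R) :=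
  borel_nonneg g /\
  exists2 Gamma : set curve, modulus Gamma = 0%E &
    forall c, is_curve c -> ~ Gamma c -> gradient_inequality u g c.

Definition p_integrable (g : borel X -> \bar R) :=
  (\int[nu]_x (g x `^ p) < +oo)%E.

Definition D1p (u : borel X -> R) :=
  measurable_fun [set: borel X] u /\
  exists2 g, upper_gradient u g & p_integrable g.

Definition W1p (u : borel X -> R) := D1p u /\ u \in Lfun nu p%:E.

Definition minimal_weak_upper_gradient (u : borel X -> R)
    (g : borel X -> \bar R) :=
  [/\ weak_upper_gradient u g, p_integrable g &
      forall h, weak_upper_gradient u h -> p_integrable h ->
        \forall x \ae nu, (g x <= h x)%E].

(* |Du|; being in L^p, it is finite nu-a.e., whence the use of fine. *)
Definition grad_norm (u : borel X -> R) : borel X -> R :=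
  fun x => fine (xget (cst 0%E) [set g | minimal_weak_upper_gradient u g] x).

(* Membership of an a.e.-class in W^{1,p}, and a representative in W^{1,p}. *)
Definition class_W1p (f : borel X -> R) :=
  exists2 g, g = f %[ae nu] & W1p g.

Definition W1p_repr (f : borel X -> R) : borel X -> R :=
  xget f [set g | g = f %[ae nu] /\ W1p g].

(* A family {(f_i, A_i)}. *)
Record precot := Precot {
  pc_fun : nat -> borel X -> R ;
  pc_set : nat -> set (borel X) }.

Definition is_precot (w : precot) :=
  [/\ forall i, D1p (pc_fun w i),
      forall i, measurable (pc_set w i),
      trivIset [set: nat] (pc_set w),
      \bigcup_i pc_set w i = [set: borel X] &
      (\sum_(0 <= i <oo)
         \int[nu]_(x in pc_set w i) (grad_norm (pc_fun w i) x `^ p)%:E < +oo)%E].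

Definition pc_index (w : precot) (x : borel X) : nat :=
  xget 0%N [set i | pc_set w i x].

(* The pointwise norm: |Df_i| on A_i. *)
Definition pc_ptnorm (w : precot) (x : borel X) : R :=
  grad_norm (pc_fun w (pc_index w x)) x.

Definition pc_norm (w : precot) : \bar R := ('N[nu]_p%:E[EFin \o pc_ptnorm w])%E.

(* {(op f_i g_j, A_i `&` B_j)}, the pairs (i, j) being numbered by pickle. *)
Definition pc_map2 (op : (borel X -> R) -> (borel X -> R) -> borel X -> R)
    (w z : precot) : precot :=
  Precot
    (fun n => if pickle_inv n is Some ij then op (pc_fun w ij.1) (pc_fun z ij.2)
              else cst 0)
    (fun n => if pickle_inv n is Some ij then pc_set w ij.1 `&` pc_set z ij.2
              else set0).

Definition pc_add := pc_map2 (fun f g => f \+ g).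
Definition pc_sub := pc_map2 (fun f g => f \- g).

(* Product of {(f_i, A_i)} with the function taking the value k / n.+1 on
   {x | k <= n.+1 * h x < k + 1}, k integer; it is within 1 / n.+1 of h. *)
Definition pc_mul (n : nat) (h : borel X -> R) (w : precot) : precot :=
  Precot
    (fun m => if pickle_inv m is Some ik
              then fun x => (ik.2 : int)%:~R / n.+1%:R * pc_fun w ik.1 x
              else cst 0)
    (fun m => if pickle_inv m is Some ik
              then pc_set w ik.1 `&` [set x | Num.floor (n.+1%:R * h x) = ik.2]
              else set0).

Definition pc_of (f : borel X -> R) : precot :=
  Precot (fun i => if i == 0%N then f else cst 0)
         (fun i => if i == 0%N then [set: borel X] else set0).

(* The cotangent module, as a completion: its elements are represented by the
   Cauchy sequences of families, up to cot_eq. *)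

Definition cot : Type := nat -> precot.

Definition is_cot (w : cot) :=
  (forall n, is_precot (w n)) /\
  forall e : R, 0 < e -> exists N : nat, forall m n, (N <= m)%N -> (N <= n)%N ->
    (pc_norm (pc_sub (w m) (w n)) < e%:E)%E.

Definition cot_eq (w z : cot) := pc_norm (pc_sub (w n) (z n)) @[n --> \oo] --> 0%E.

(* |w|_*, the limit in L^p of the pointwise norms. *)
Definition cot_ptnorm (w : cot) : borel X -> R :=
  xget (cst 0) [set N | N \in Lfun nu p%:E /\
    ('N[nu]_p%:E[EFin \o (pc_ptnorm (w n) \- N)%R])%E @[n --> \oo] --> 0%E].

Definition cot_norm (w : cot) : \bar R := ('N[nu]_p%:E[EFin \o cot_ptnorm w])%E.

Definition cot_add (w z : cot) : cot := fun n => pc_add (w n) (z n).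

(* The action of h in L^oo. *)
Definition cot_mul (h : borel X -> R) (w : cot) : cot :=
  fun n => pc_mul n h (w n).

Definition differential (f : borel X -> R) : cot := fun=> pc_of f.

(* Vector fields: bounded L^oo-linear maps from the cotangent module to L^1. *)
Definition vector_field (Y : cot -> borel X -> R) :=
  [/\ forall w, is_cot w -> Y w \in Lfun nu 1%E,
      forall w z, is_cot w -> is_cot z -> cot_eq w z -> Y w = Y z %[ae nu],
      forall w z, is_cot w -> is_cot z ->
        Y (cot_add w z) = (Y w \+ Y z) %[ae nu],
      forall h w, h \in Lfun nu +oo%E -> is_cot w ->
        Y (cot_mul h w) = (h \* Y w) %[ae nu] &
      exists C : R, forall w, is_cot w ->
        ('N[nu]_1[EFin \o Y w] <= C%:E * cot_norm w)%E].

(* Essential supremum of a family of functions (the least measurable function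
   that dominates a.e. each of them). *)
Definition is_ess_sup (F : set (borel X -> R)) (N : borel X -> \bar R) :=
  let dominates M := measurable_fun [set: borel X] M /\
    forall f, F f -> \forall x \ae nu, ((f x)%:E <= M x)%E in
  dominates N /\ forall M, dominates M -> \forall x \ae nu, (N x <= M x)%E.

(* |Y|, the essential supremum of Y w over |w|_* <= 1. *)
Definition vf_ptnorm (Y : cot -> borel X -> R) : borel X -> \bar R :=
  xget (cst 0%E) [set N | is_ess_sup
    [set Y w | w in [set w | is_cot w /\ \forall x \ae nu, cot_ptnorm w x <= 1]]
    N].

Definition is_divergence (Y : cot -> borel X -> R) (f : borel X -> R) :=
  f \in Lfun nu 2%:E /\
  forall g, W1p g -> g \in Lfun nu 2%:E ->
    \int[nu]_x (f x * g x) = - \int[nu]_x (Y (differential g) x).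

Definition D_q2 (Y : cot -> borel X -> R) :=
  vector_field Y /\ exists f, is_divergence Y f.

(* cheeger and subdifferential are meant for u, v in L^2(X, nu). *)
Definition cheeger (u : borel X -> R) : \bar R :=
  if `[< class_W1p u >]
  then (p^-1%:E * \int[nu]_x (grad_norm (W1p_repr u) x `^ p)%:E)%E
  else +oo%E.

Definition subdifferential (F : (borel X -> R) -> \bar R)
    (u v : borel X -> R) :=
  [/\ u \in Lfun nu 2%:E, v \in Lfun nu 2%:E, (F u < +oo)%E &
      forall w, w \in Lfun nu 2%:E ->
        (F u + (\int[nu]_x (v x * (w x - u x)))%R%:E <= F w)%E].

(* p_laplacian u v: v belongs to Delta_p u. *)
Definition p_laplacian (u v : borel X -> R) := subdifferential cheeger u (\- v).

End metric_measure_space.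

Section time_dependent.
Context {R : realType} {X : completeMetricType R}.
Variable nu : {measure set (borel X) -> \bar R}.
Implicit Types (D : set R) (F s u v : R -> borel X -> R) (J : borel X -> R).

Local Notation leb := (@lebesgue_measure R).

Definition L2norm (f : borel X -> R) : \bar R := ('N[nu]_2%:E[EFin \o f])%E.

(* s is a simple function D -> L^2(X, nu) and J is its integral. *)
Definition simple_integral D s J :=
  exists n (E : 'I_n -> set R) (e : 'I_n -> borel X -> R),
    [/\ forall i, measurable (E i) /\ E i `<=` D,
        forall i, (leb (E i) < +oo)%E,
        forall i, e i \in Lfun nu 2%:E,
        s = (fun t x => \sum_(i < n) \1_(E i) t * e i x) &
        J = (fun x => \sum_(i < n) fine (leb (E i)) * e i x)].

Definition strongly_measurable D F :=
  (forall t, D t -> F t \in Lfun nu 2%:E) /\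
  exists2 s : nat -> R -> borel X -> R,
    forall n, exists J, simple_integral D (s n) J &
    \forall t \ae leb, D t -> L2norm (F t \- s n t) @[n --> \oo] --> 0%E.

(* J is the Bochner integral of F : D -> L^2(X, nu). *)
Definition bochner_integral D F J :=
  [/\ J \in Lfun nu 2%:E, strongly_measurable D F &
      exists (s : nat -> R -> borel X -> R) (I_ : nat -> borel X -> R),
        [/\ forall n, simple_integral D (s n) (I_ n),
            (\int[leb]_(t in D) L2norm (F t \- s n t)%R)%E @[n --> \oo] --> 0%E &
            L2norm (J \- I_ n) @[n --> \oo] --> 0%E]].

(* L^2_loc(0, T; L^2(X, nu)) *)
Definition L2loc (T : R) F :=
  strongly_measurable `]0, T[ F /\
  forall a b, 0 < a -> a < b -> b < T ->
    (\int[leb]_(t in `[a, b]%classic) (L2norm (F t) `^ 2) < +oo)%E.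

(* C_c^oo(0, T) *)
Definition test_function (T : R) (phi : R -> R) :=
  (forall n t, derivable (derive1n n phi) t 1) /\
  exists a b, [/\ 0 < a, a < b, b < T & forall t, t \notin `[a, b] -> phi t = 0].

(* u is in W^{1,2}_loc(0, T; L^2(X, nu)) and v is its weak derivative u_t. *)
Definition W12loc_derivative (T : R) u v :=
  [/\ L2loc T u, L2loc T v &
      forall phi, test_function T phi -> exists J,
        bochner_integral `]0, T[ (fun t x => derive1 phi t * u t x) J /\
        bochner_integral `]0, T[ (fun t x => phi t * v t x) (\- J)].

(* C([0, T]; L^2(X, nu)) *)
Definition C_L2 (T : R) u :=
  (forall t, t \in `[0, T] -> u t \in Lfun nu 2%:E) /\
  forall t, t \in `[0, T] ->
    L2norm (u s \- u t) @[s --> within `[0, T]%classic (nbhs t)] --> 0%E.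

End time_dependent.

Section cauchy_problem.
Context {R : realType} {X : completeMetricType R}.
Variables (nu : {measure set (borel X) -> \bar R}) (p q T : R).
Variable u0 : borel X -> R.
Implicit Types (u v : R -> borel X -> R).

(* v is the time derivative u_t. *)
Definition cauchy_regularity u v :=
  [/\ C_L2 nu T u, W12loc_derivative nu T u v & u 0 = u0 %[ae nu]].

Definition weak_solution u :=
  exists2 v, cauchy_regularity u v &
    \forall t \ae (@lebesgue_measure R), t \in `]0, T[ ->
      p_laplacian nu p (u t) (v t).

(* |df|_*, for f in L^2(X, nu) of class W^{1,p}. *)
Definition d_ptnorm (f : borel X -> R) : borel X -> R :=
  cot_ptnorm nu p (differential (W1p_repr nu p f)).

(* Since two representatives in W^{1,p} of the same class have the same
   differential, w below ranges over the W^{1,p} representatives. *)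
Definition variational_solution (rel : R -> R -> Prop) u :=
  exists2 v, cauchy_regularity u v &
    \forall t \ae (@lebesgue_measure R), t \in `[0, T] ->
      class_W1p nu p (u t) /\
      exists Y : cot -> borel X -> R,
        [/\ D_q2 nu p Y,
            \forall x \ae nu,
              (vf_ptnorm nu p Y x `^ q <= (d_ptnorm (u t) x `^ p)%:E)%E,
            is_divergence nu p Y (v t) &
            forall w, w \in Lfun nu 2%:E -> W1p nu p w ->
              rel (\int[nu]_x (v t x * (u t x - w x)))
                  (\int[nu]_x (Y (differential w) x)
                   - \int[nu]_x (d_ptnorm (u t) x `^ p))].

End cauchy_problem.

(* Main.v *)
Require Import Defs.
From HB Require Import structures.
From mathcomp Require Import all_boot all_order all_algebra.
From mathcomp Require Import all_classical all_reals all_analysis.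
From mathcomp Require Import measurable_realfun.
From mathcomp Require Import ring lra.

(** The three conditions share the regularity of u, and are otherwise conditions on
    u(t) and u_t(t) for almost every t, which are equivalent at each single t. Fix t,
    write u and v for u(t) and u_t(t), and f for a representative of u in W^{1,p}.

    From the inclusion to the vector field. Since -v is a subgradient of the Cheeger
    energy at u, comparison with u + e w, for e decreasing to 0, bounds the linear
    functional w |-> - int v w by int |Df|^(p-1) |Dw|, and comparison with multiples
    of f yields - int v f = int |Df|^p. The functional lives on functions, seen as
    the constant ones among the families {(f_i, A_i)}, on which
    N(omega) = int |Df|^(p-1) |omega| is sublinear. It is extended by the
    Hahn-Banach theorem to a functional L below N. For fixed omega,
    A |-> L(1_A omega) is a signed measure with a density Y(omega), and
    |Y(omega)| <= |Df|^(p-1) |omega|; locality makes Y compatible with products by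
    step functions, and by continuity Y extends to the cotangent module
    (vector_field_of_functional). Its divergence is v, and |Y|^q <= |Df|^p because
    (p-1) q = p. Since - int v f = int |Df|^p, the vector field satisfies the third
    condition, hence also the second.

    From the inequality to the equality. Taking w = 0 gives int Y(du) >= int |du|^p.
    The opposite inequality follows from Y(du) <= |Y| |du| and |Y| <= |du|^(p-1). The
    bound Y(dg) <= |Y| |dg| (vector_field_le) comes from the definition of |Y| as an
    essential supremum, tested with the bounded multiples of dg which have norm at
    most 1. The divergence then transfers the equality to all w.

    From the equality to the inclusion. The same bound gives, for each competitor w,
    - int v (w - u) <= int |du|^(p-1) |dw| - int |du|^p, and Young's inequality
    bounds the right-hand side by the difference of the energies of w and u.

    All this rests on properties of the minimal weak upper gradient: it exists, is
    subadditive, homogeneous and depends only on the a.e. class of the function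
    among those with a p-integrable upper gradient. The main points are that the
    minimum of two weak upper gradients is one (increment_min, along a curve), and
    that a function which vanishes a.e. vanishes along almost every curve
    (weak_upper_gradient_null). *)

Set Implicit Arguments.
Unset Strict Implicit.
Unset Printing Implicit Defensive.

Import Order.TTheory GRing.Theory Num.Theory.
Import numFieldNormedType.Exports.

Local Open Scope classical_set_scope.
Local Open Scope ring_scope.

(** * Convergence, null sets and comparison of integrals *)

Section nonneg_sequences.
Context {R : realType}.

Lemma cvge0P (a : (\bar R)^nat) : (forall n, 0 <= a n)%E ->
  (a @ \oo --> 0%E) <->
  (forall e : R, 0 < e -> exists N, forall n, (N <= n)%N -> (a n < e%:E)%E).
Proof.
move=> a0; split => [/fine_cvgP [[N0 _ afin] ha] e e0|h].
  have /cvgrPdist_lt /(_ _ e0) [N1 _ h1] := ha.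
  exists (maxn N0 N1) => n; rewrite geq_max => /andP[n0 n1].
  have := h1 _ n1; rewrite /= sub0r normrN ger0_norm ?fine_ge0// => h2.
  by rewrite -(@fineK _ (a n)) ?lte_fin//; exact: afin.
apply/fine_cvgP; split.
  have [N hN] := h 1 ltr01; exists N => // n /= Nn.
  by rewrite ge0_fin_numE// (lt_trans (hN _ Nn))// ltry.
apply/cvgrPdist_lt => e e0; have [N hN] := h e e0; exists N => // n /= Nn.
rewrite sub0r normrN ger0_norm ?fine_ge0//.
by rewrite -lte_fin fineK ?hN// ge0_fin_numE// (lt_trans (hN _ Nn))// ltry.
Qed.

Lemma squeeze_cvge0 (a b : (\bar R)^nat) : (forall n, 0 <= a n <= b n)%E ->
  b @ \oo --> 0%E -> a @ \oo --> 0%E.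
Proof.
move=> ab b0; apply: (squeeze_cvge _ (cvg_cst _) b0).
by apply: nearW => n; exact: ab.
Qed.

Lemma cvge0D (a b : (\bar R)^nat) : a @ \oo --> 0%E -> b @ \oo --> 0%E ->
  (fun n => a n + b n)%E @ \oo --> 0%E.
Proof. by move=> a0 b0; rewrite -[X in _ --> X]adde0; apply: cvgeD. Qed.

Lemma cvge0_scale (k : R) (a : (\bar R)^nat) : a @ \oo --> 0%E ->
  (fun n => k%:E * a n)%E @ \oo --> 0%E.
Proof. by move=> a0; rewrite -[X in _ --> X](mule0 k%:E); apply: cvgeZl. Qed.

Lemma le_eps0 (a : \bar R) : (forall e : R, 0 < e -> (a <= e%:E)%E) ->
  (a <= 0)%E.
Proof. by move=> h; apply/lee_addgt0Pr => e e0; rewrite add0e h. Qed.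

End nonneg_sequences.

Section ae_tools.
Context d (T : measurableType d) (R : realType).
Variable mu : {measure set T -> \bar R}.

Lemma ae_eqW (U : Type) (f g : T -> U) :
  (f = g %[ae mu]) <-> (\forall x \ae mu, f x = g x).
Proof. by split; apply: filterS => x; [move=> /(_ I)|move=> + _]. Qed.

Lemma ae_false_null (P : T -> Prop) : (\forall x \ae mu, P x) ->
  exists N, [/\ measurable N, mu N = 0 & forall x, ~ N x -> P x].
Proof.
move=> [N [mN N0 PN]]; exists N; split => // x Nx.
by apply: contrapT => nP; apply: Nx; apply: PN.
Qed.

Lemma null_ae (N : set T) : measurable N -> mu N = 0 ->
  \forall x \ae mu, ~ N x.
Proof. by move=> mN N0; exists N; split => // x /= /contrapT. Qed.

Lemma measurable_lte_set (f g : T -> \bar R) : measurable_fun setT f ->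
  measurable_fun setT g -> measurable [set x | (f x < g x)%E].
Proof. by move=> mf mg; rewrite -[X in measurable X]setTI; exact: measurable_lte. Qed.

Lemma measurable_ltr_set (f g : T -> R) : measurable_fun setT f ->
  measurable_fun setT g -> measurable [set x | f x < g x].
Proof.
by move=> mf mg; apply: (@measurable_lte_set (EFin \o f) (EFin \o g));
  apply/measurable_EFinP.
Qed.

(** A comparison of the integrals over every measurable set is a comparison of
    the integrands: test it on the set where the comparison fails. *)
Lemma le_integral_ae (f g : T -> R) :
  mu.-integrable setT (EFin \o f) -> mu.-integrable setT (EFin \o g) ->
  (forall A, measurable A ->
    (\int[mu]_(x in A) (f x)%:E <= \int[mu]_(x in A) (g x)%:E)%E) ->
  \forall x \ae mu, f x <= g x.
Proof.
move=> fi gi h.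
have mf : measurable_fun setT f by apply/measurable_EFinP; exact: measurable_int fi.
have mg : measurable_fun setT g by apply/measurable_EFinP; exact: measurable_int gi.
pose A := [set x | g x < f x].
have mA : measurable A by exact: measurable_ltr_set.
have fiA := integrableS measurableT mA (@subsetT _ A) fi.
have giA := integrableS measurableT mA (@subsetT _ A) gi.
have : (\int[mu]_(x in A) `| (f x - g x)%:E | = 0)%E.
  apply/eqP; rewrite eq_le integral_ge0 ?andbT//.
  rewrite (eq_integral (fun x => (f x)%:E - (g x)%:E)%E); last first.
    move=> x /[!inE] Ax; rewrite gee0_abs ?EFinB// lee_fin subr_ge0.
    exact: ltW.
  rewrite integralB_EFin//= sube_le0; exact: h.
move/(ae_eq_integral_abs mu mA); move=> /(_ _)/wrap[].
  by apply: measurable_funTS; apply/measurable_EFinP; exact: measurable_funB.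
apply: filterS => x hx; rewrite leNgt; apply/negP => gf.
by have /eqP := hx gf; rewrite eqe subr_eq0 => /eqP fg; rewrite fg ltxx in gf.
Qed.

(** For the uniqueness of energy minimizers: g - k is nonnegative and has integral
    zero. *)
Lemma ge0_le_integral_ae_eq (k g : T -> \bar R) :
  measurable_fun setT k -> measurable_fun setT g ->
  (forall x, 0 <= k x)%E -> (forall x, k x <= g x)%E ->
  (\int[mu]_x g x < +oo)%E -> (\int[mu]_x g x <= \int[mu]_x k x)%E ->
  \forall x \ae mu, k x = g x.
Proof.
move=> mk mg k0 kg gfin gk.
have g0 x : (0 <= g x)%E by apply: le_trans (kg x).
have gi : mu.-integrable setT g.
  apply/integrableP; split => //.
  by under eq_integral do rewrite gee0_abs//.
have ki : mu.-integrable setT k.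
  apply: (le_integrable measurableT mk _ gi) => x _.
  by rewrite !gee0_abs.
have : (\int[mu]_x `|g x - k x| = 0)%E.
  apply/eqP; rewrite eq_le integral_ge0 ?andbT//.
  have kfin := integrable_ae measurableT ki.
  rewrite (ae_eq_integral (fun x => (g x - k x)%E))//.
  - by rewrite integralB// sube_le0.
  - by apply: measurableT_comp => //; exact: emeasurable_funB.
  - exact: emeasurable_funB.
  - apply: filterS kfin => x /(_ I) kx _; rewrite gee0_abs//.
    by rewrite sube_ge0// kx.
move/(ae_eq_integral_abs mu measurableT (emeasurable_funB mg mk)).
have gfn := integrable_ae measurableT gi.
apply: filterS2 gfn => x /(_ I) gx /(_ I) /eqP.
have kx : k x \is a fin_num.
  by rewrite ge0_fin_numE// (le_lt_trans (kg x))// -ge0_fin_numE.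
by rewrite sube_eq ?add0e ?fin_num_adde_defl//; move=> /eqP.
Qed.

End ae_tools.

(** * Powers and completeness of L^p *)

Section power_tools.
Context {R : realType}.
Implicit Types (a b p : R).

Lemma ler_pow p a b : 0 <= p -> 0 <= a -> a <= b -> a `^ p <= b `^ p.
Proof.
move=> p0 a0 ab; apply: ge0_ler_powR => //; rewrite nnegrE//.
exact: le_trans ab.
Qed.

Lemma powRK p a : p != 0 -> 0 <= a -> (a `^ p) `^ p^-1 = a.
Proof. by move=> p0 a0; rewrite -powRrM divff// powRr1. Qed.

Lemma powRKV p a : p != 0 -> 0 <= a -> (a `^ p^-1) `^ p = a.
Proof. by move=> p0 a0; rewrite -powRrM mulVf// powRr1. Qed.

Lemma ler_powK p a b : 0 < p -> 0 <= a -> 0 <= b -> a `^ p <= b `^ p -> a <= b.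
Proof.
move=> p0 a0 b0 h; have pn0 : p != 0 by rewrite gt_eqF.
have pV0 : 0 <= p^-1 by rewrite invr_ge0 ltW.
by have := ler_pow pV0 (powR_ge0 _ _) h; rewrite (powRK pn0 a0) (powRK pn0 b0).
Qed.

Lemma lee_pow p (x y : \bar R) : 0 <= p -> (0 <= x)%E -> (x <= y)%E ->
  (x `^ p <= y `^ p)%E.
Proof.
move=> p0 x0 xy; apply: gt0_ler_poweR => //; rewrite in_itv/= andbC leey//=.
exact: le_trans xy.
Qed.

Lemma poweRK p (x : \bar R) : p != 0 -> (0 <= x)%E -> ((x `^ p) `^ p^-1 = x)%E.
Proof. by move=> p0 x0; rewrite -poweRrM divff// poweRe1. Qed.

Lemma poweRKV p (x : \bar R) : p != 0 -> (0 <= x)%E -> ((x `^ p^-1) `^ p = x)%E.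
Proof. by move=> p0 x0; rewrite -poweRrM mulVf// poweRe1. Qed.

Lemma lee_powK p (x y : \bar R) : 0 < p -> (0 <= x)%E -> (0 <= y)%E ->
  (x `^ p <= y `^ p)%E -> (x <= y)%E.
Proof.
move=> p0 x0 y0 h; have pn0 : p != 0 by rewrite gt_eqF.
have pV0 : 0 <= p^-1 by rewrite invr_ge0 ltW.
by have := lee_pow pV0 (poweR_ge0 _ _) h; rewrite (poweRK pn0 x0) (poweRK pn0 y0).
Qed.

Lemma lte_pow p (x y : \bar R) : 0 < p -> (0 <= x)%E -> (x < y)%E ->
  (x `^ p < y `^ p)%E.
Proof.
move=> p0 x0 xy; rewrite ltNge; apply/negP => /(lee_powK p0 (ltW (le_lt_trans x0 xy)) x0).
by rewrite leNgt xy.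
Qed.

Lemma cvg_powR p (v : R^nat) (l : R) : 0 < p -> (forall k, 0 <= v k) ->
  v @ \oo --> l -> (v k) `^ p @[k --> \oo] --> l `^ p.
Proof.
move=> p0 v0 vl.
have : 0 <= l.
  have <- := cvg_lim (@Rhausdorff R) vl.
  by apply: limr_ge; [apply/cvg_ex; exists l|exact: nearW].
rewrite le_eqVlt => /predU1P[l0|l0].
  rewrite -l0 powR0 ?gt_eqF//; apply/cvgrPdist_lt => e e0.
  have e0' : 0 < e `^ p^-1 by rewrite powR_gt0.
  move/cvgrPdist_lt : vl => /(_ _ e0'); rewrite -l0; apply: filterS => k.
  rewrite !sub0r !normrN !ger0_norm ?powR_ge0// => h.
  rewrite ltNge; apply/negP => h1.
  have := @ler_pow p^-1 _ _ _ (ltW e0) h1.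
  by rewrite invr_ge0 (ltW p0) powRK ?gt_eqF// leNgt h => /(_ isT).
apply: (@cvg_comp _ _ _ _ (fun y : R => y `^ p) _ _ _ vl).
have := @is_derive1_powR R p l l0 => -[+ _].
by move/derivable1_diffP => /differentiable_continuous.
Qed.

Lemma limn_einf_le (a : (\bar R)^nat) (l : \bar R) (N : nat) :
  (forall n, (N <= n)%N -> (a n <= l)%E) -> (limn_einf a <= l)%E.
Proof.
move=> h; rewrite limn_einf_lim (cvg_lim _ (@cvg_einfs_sup _ a))//.
apply: ge_ereal_sup => _ [n _ <-]; apply: le_trans (h _ (leq_maxl N n)).
by apply: ereal_inf_lbound; exists (maxn N n) => //=; exact: leq_maxr.
Qed.

Lemma limn_einf_ge0 (a : (\bar R)^nat) : (forall n, 0 <= a n)%E ->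
  (0 <= limn_einf a)%E.
Proof.
move=> h; rewrite limn_einf_lim (cvg_lim _ (@cvg_einfs_sup _ a))//.
apply: le_trans (ereal_sup_ubound _); last by exists 0%N.
by apply: le_ereal_inf_tmp => _ [n _ <-].
Qed.

(** The distance from v k to all later terms is bounded by a geometric tail. *)
Lemma geometric_steps_cvg (v : R^nat) (K : R) :
  (forall k, `|v k.+1 - v k| <= K / 2 ^+ k) -> cvg (v @ \oo).
Proof.
move=> h; have K0 : 0 <= K.
  by have := le_trans (normr_ge0 _) (h 0%N); rewrite expr0 divr1.
have step k m : `|v (k + m)%N - v k| <= 2 * K / 2 ^+ k - 2 * K / 2 ^+ (k + m).
  elim: m => [|m IH]; first by rewrite addn0 !subrr normr0.
  rewrite addnS.
  have -> : v (k + m).+1 - v k = v (k + m).+1 - v (k + m)%N + (v (k + m)%N - v k).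
    by rewrite addrA subrK.
  apply: (le_trans (ler_normD _ _)); apply: (le_trans (lerD (h _) IH)).
  rewrite exprS invfM; have : (2:R) != 0 by [].
  move: (2 ^+ (k + m))^-1 => z _.
  rewrite (_ : 2 * K * (2^-1 * z) = K * z); first by lra.
  by rewrite mulrACA divff// mul1r.
apply/cauchy_cvgP/cauchy_ballP => e e0.
have [k hk] : exists k, 2 * (2 * K) / 2 ^+ k < e.
  have : (fun k => 2 * (2 * K) * (2^-1 ^+ k)) @ \oo --> (0 : R).
    by rewrite -[X in _ --> X](mulr0 (2 * (2 * K))); apply: cvgMr;
      apply: cvg_expr; rewrite ger0_norm ?invf_lt1 ?ltr1n.
  move/cvgrPdist_lt => /(_ e e0) [k _ /(_ k (leqnn k))] /=.
  rewrite sub0r normrN ger0_norm; last by rewrite !mulr_ge0// exprn_ge0.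
  by rewrite exprVn => ?; exists k.
exists (v @` [set n | (k <= n)%N], v @` [set n | (k <= n)%N]).
  by split; exists k => // n /= kn; exists n.
move=> [_ _] [[m km <-] [n kn <-]]; rewrite /ball/=.
apply: le_lt_trans hk; rewrite -(subnKC km) -(subnKC kn).
have -> : v (k + (m - k))%N - v (k + (n - k))%N =
  (v (k + (m - k))%N - v k) - (v (k + (n - k))%N - v k) by lra.
apply: (le_trans (ler_normB _ _)); apply: (le_trans (lerD (step _ _) (step _ _))).
have h2 j : 0 <= 2 * K / 2 ^+ (k + j).
  by rewrite !mulr_ge0// invr_ge0 exprn_ge0.
have := h2 (m - k)%N; have := h2 (n - k)%N; lra.
Qed.

End power_tools.

Section integral_of_power.
Context d (T : measurableType d) (R : realType).
Variable mu : {measure set T -> \bar R}.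
Implicit Types (f g : T -> R) (p : R).

Definition power_integral p f := (\int[mu]_x (`|f x| `^ p)%:E)%E.

Local Notation Ip := power_integral.

Lemma measurable_pow p f : measurable_fun setT f ->
  measurable_fun setT (fun x => (`|f x| `^ p)%:E).
Proof.
move=> mf; apply/measurable_EFinP.
apply: (@measurableT_comp _ _ _ _ _ _ (fun x : R => x `^ p)) => //.
exact: measurableT_comp.
Qed.

Lemma power_integral_ge0 p f : (0 <= Ip p f)%E.
Proof. by apply: integral_ge0 => x _; rewrite lee_fin powR_ge0. Qed.

Lemma le_power_integral p f g : 0 <= p -> measurable_fun setT f ->
  measurable_fun setT g -> (\forall x \ae mu, `|f x| <= `|g x|) ->
  (Ip p f <= Ip p g)%E.
Proof.
move=> p0 mf mg fg; apply: ae_ge0_le_integral => //.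
- exact: measurable_pow.
- exact: measurable_pow.
- by apply: filterS fg => x fg _; rewrite lee_fin ler_pow.
Qed.

Lemma measurable_limn_einf (h : nat -> T -> \bar R) :
  (forall n, measurable_fun setT (h n)) ->
  measurable_fun setT (fun x => limn_einf (h ^~ x)).
Proof.
move=> mh; have -> : (fun x => limn_einf (h ^~ x)) =
    (fun x => - limn_esup (fun n => - h n x))%E.
  by apply/funext => x; rewrite -limn_einfN; congr limn_einf; apply/funext => n /=;
    rewrite oppeK.
apply: measurableT_comp => //; apply: measurable_fun_limn_esup => n.
exact: measurableT_comp.
Qed.

(** Completeness of L^p: along a subsequence with summable steps the sequence
    converges a.e., and Fatou turns the Cauchy estimate into convergence. *)
Lemma power_integral_complete p (u : nat -> T -> R) : 0 < p ->
  (forall n, measurable_fun setT (u n)) ->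
  (forall e : R, 0 < e -> exists N, forall m n, (N <= m)%N -> (N <= n)%N ->
     (Ip p (u m \- u n)%R < e%:E)%E) ->
  exists2 f, measurable_fun setT f &
    forall e : R, 0 < e -> exists N, forall n, (N <= n)%N ->
      (Ip p (u n \- f)%R <= e%:E)%E.
Proof.
move=> p0 mu_ hC.
(* with this tolerance the integrals of (2 ^ k |u (s k.+1) - u (s k)|) ^ p are summable *)
pose c k : R := (1 / (2 ^ k.+1)%:R) / (2 ^+ k) `^ p.
have q0 k : 0 < ((2 : R) ^+ k) `^ p by rewrite powR_gt0// exprn_gt0.
have c0 k : 0 < c k by rewrite !divr_gt0// ltr0n expn_gt0.
have /choice[g hg] : forall k, exists N, forall m n, (N <= m)%N -> (N <= n)%N ->
    (Ip p (u m \- u n)%R < (c k)%:E)%E by move=> k; exact: hC.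
pose s k := (\sum_(i < k.+1) (g i).+1)%N.
have sS k : s k.+1 = (s k + (g k.+1).+1)%N by rewrite /s big_ord_recr.
have gs k : (g k <= s k)%N.
  by case: k => [|k]; [rewrite /s big_ord1|rewrite sS; apply: leq_trans (leq_addl _ _)].
have ks k : (k <= s k)%N.
  elim: k => // k IH; rewrite sS addnS ltnS; exact: leq_trans (leq_addr _ _).
pose v k := u (s k).
pose dk k x := v k.+1 x - v k x.
have mdk k : measurable_fun setT (dk k) by exact: (measurable_funB (mu_ _) (mu_ _)).
have hd k : (Ip p (dk k) < (c k)%:E)%E.
  by apply: hg; [rewrite sS; apply: leq_trans (leq_addr _ _)|]; exact: gs.
pose F k x := (((2 ^+ k) `^ p)%:E * (`|dk k x| `^ p)%:E)%E.
have F0 k x : (0 <= F k x)%E by rewrite mule_ge0// lee_fin powR_ge0.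
have mF k : measurable_fun setT (F k).
  by apply: measurable_funeM; exact: measurable_pow.
have Dfin : (\int[mu]_x (\sum_(0 <= k <oo) F k x) < +oo)%E.
  rewrite integral_nneseries//.
  apply: (@le_lt_trans _ _ (\sum_(0 <= k <oo) (1 / (2 ^ k.+1)%:R)%:E)%E); last first.
    by apply: (le_lt_trans (epsilon_trick0 xpredT _)); rewrite ?ltry.
  apply: lee_nneseries => [k _ _|k _]; first exact: integral_ge0.
  rewrite ge0_integralZl//; last exact: measurable_pow.
  apply: (@le_trans _ _ (((2 ^+ k) `^ p)%:E * (c k)%:E)%E).
    by rewrite lee_pmul2l ?lte_fin//; exact/ltW/hd.
  by rewrite -EFinM lee_fin /c mulrCA divff ?mulr1// gt_eqF.
have mD : measurable_fun setT (fun x => \sum_(0 <= k <oo) F k x)%E.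
  exact: ge0_emeasurable_sum.
have aeD : \forall x \ae mu, (\sum_(0 <= k <oo) F k x \is a fin_num)%E.
  have : mu.-integrable setT (fun x => \sum_(0 <= k <oo) F k x)%E.
    apply/integrableP; split => //; under eq_integral do rewrite gee0_abs ?nneseries_ge0//.
    by [].
  by move/(integrable_ae measurableT); apply: filterS => x /(_ I).
have aecv : \forall x \ae mu, cvg ((v ^~ x) @ \oo).
  apply: filterS aeD => x Dx.
  pose M := fine (\sum_(0 <= k <oo) F k x)%E.
  have MF k : (2 ^+ k * `|dk k x|) `^ p <= M.
    rewrite -lee_fin fineK// powRM ?exprn_ge0// EFinM.
    have := @nneseries_lim_ge R (F ^~ x) xpredT 0%N k.+1 (fun n _ _ => F0 n x).
    apply: le_trans; rewrite big_nat_recr//= leeDr// sume_ge0//.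
  apply: (@geometric_steps_cvg _ _ (M `^ p^-1)) => k.
  rewrite ler_pdivlMr ?exprn_gt0// mulrC.
  have M0 : 0 <= M by apply: le_trans (MF 0%N); rewrite powR_ge0.
  apply: (@ler_powK _ p); rewrite ?mulr_ge0 ?powR_ge0 ?exprn_ge0//.
  by rewrite powRKV// gt_eqF.
pose f x := fine (limn_esup (fun k => (v k x)%:E)).
have mf : measurable_fun setT f.
  apply: measurableT_comp => //; apply: measurable_fun_limn_esup => k.
  by apply/measurable_EFinP; exact: mu_.
have aef : \forall x \ae mu, v k x @[k --> \oo] --> f x.
  apply: filterS aecv => x hx; rewrite /f.
  have h : ((v k x)%:E @[k --> \oo] --> (lim (v k x @[k --> \oo]))%:E)%E.
    by apply: cvg_EFin => //; exact: nearW.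
  by rewrite (cvg_limn_einf_sup h).
exists f => // e e0; have [N hN] := hC e e0; exists N => n Nn.
have mw k : measurable_fun setT (fun x => (`|u n x - v k x| `^ p)%:E).
  exact: (measurable_pow p (measurable_funB (mu_ n) (mu_ (s k)))).
apply: (@le_trans _ _ (\int[mu]_x limn_einf (fun k => (`|u n x - v k x| `^ p)%:E))%E).
  apply: ae_ge0_le_integral => //.
  - exact: (measurable_pow p (measurable_funB (mu_ n) mf)).
  - by move=> x _; apply: limn_einf_ge0 => k; rewrite lee_fin powR_ge0.
  - exact: measurable_limn_einf.
  - apply: filterS aef => x hx _.
    have h : ((`|u n x - v k x| `^ p)%:E @[k --> \oo] --> (`|u n x - f x| `^ p)%:E)%E.
      apply: cvg_EFin; first exact: nearW.
      apply: cvg_powR => //.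
      by apply: cvg_norm; apply: cvgB => //; exact: cvg_cst.
    by rewrite (cvg_limn_einf_sup h).
apply: (le_trans (fatou mu measurableT mw _)).
  by move=> k x _; rewrite lee_fin powR_ge0.
apply: (@limn_einf_le _ _ _ N) => k Nk; apply/ltW/hN => //.
exact: leq_trans (ks k).
Qed.

End integral_of_power.

(** * Limits in L^p *)

Lemma le_cvge0_eq0 {R : realType} (a : \bar R) (r : (\bar R)^nat) :
  (0 <= a)%E -> (forall n, a <= r n)%E -> r @ \oo --> 0%E -> a = 0%E.
Proof.
move=> a0 ar r0.
have h : (fun=> a) @ \oo --> 0%E.
  by apply: squeeze_cvge0 r0 => n; rewrite a0 ar.
exact: (cvg_unique _ (cvg_cst a) h).
Qed.

Section Lp_limits.
Context d (T : measurableType d) (R : realType).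
Variable mu : {measure set T -> \bar R}.
Implicit Types (f g h : T -> R) (u v : nat -> T -> R) (p : R).

Local Notation "'N_ p [ f ]" := (Lnorm mu p%:E (EFin \o f%R)).
Local Notation Ip := (power_integral mu).

Lemma LnormE p f : 'N_p[f] = (Ip p f `^ p^-1)%E.
Proof. by rewrite unlock. Qed.

Lemma Lnorm_pow p f : 0 < p -> ('N_p[f] `^ p)%E = Ip p f.
Proof. by move=> p0; rewrite poweR_Lnorm ?gt_eqF. Qed.

Lemma Lfun_powerP p f : 0 < p ->
  f \in Lfun mu p%:E <-> measurable_fun setT f /\ (Ip p f < +oo)%E.
Proof.
move=> p0; split=> [/andP[]|[mf hf]].
  rewrite !inE/= /finite_norm => mf hf; split => //.
  rewrite -Lnorm_pow//; move: hf (Lnorm_ge0 mu p%:E (EFin \o f)).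
  by case: ('N_p[f]) => // r _ _; rewrite poweR_EFin ltry.
apply/andP; rewrite !inE/= /finite_norm; split => //; rewrite LnormE.
move: hf (power_integral_ge0 mu p f); case: (Ip p f) => // r _ _.
by rewrite poweR_EFin ltry.
Qed.

Lemma Lfun_measurable (r : \bar R) f : f \in Lfun mu r -> measurable_fun setT f.
Proof. by move/andP => []; rewrite inE. Qed.

Lemma Lfun_lty (r : \bar R) f : f \in Lfun mu r ->
  (Lnorm mu r (EFin \o f) < +oo)%E.
Proof. by move/andP => [_]; rewrite inE. Qed.

Lemma le_Lnorm p f g : 0 < p -> measurable_fun setT f -> measurable_fun setT g ->
  (\forall x \ae mu, `|f x| <= `|g x|) -> ('N_p[f] <= 'N_p[g])%E.
Proof.
move=> p0 mf mg fg; rewrite !LnormE; apply: lee_pow.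
- by rewrite invr_ge0 ltW.
- exact: power_integral_ge0.
- by apply: le_power_integral => //; exact: ltW.
Qed.

Lemma eq_ae_Lnorm p f g : 0 < p -> measurable_fun setT f ->
  measurable_fun setT g -> (\forall x \ae mu, f x = g x) -> 'N_p[f] = 'N_p[g].
Proof.
move=> p0 mf mg fg; apply/eqP; rewrite eq_le !le_Lnorm//;
  by apply: filterS fg => x ->.
Qed.

Lemma Lfun_le p f g : 0 < p -> measurable_fun setT f -> g \in Lfun mu p%:E ->
  (\forall x \ae mu, `|f x| <= `|g x|) -> f \in Lfun mu p%:E.
Proof.
move=> p0 mf /(Lfun_powerP _ p0)[mg hg] fg; apply/(Lfun_powerP _ p0); split; first exact: mf.
by apply: le_lt_trans hg; apply: le_power_integral => //; exact: ltW.
Qed.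

Lemma LfunD p f g : 1 <= p -> f \in Lfun mu p%:E -> g \in Lfun mu p%:E ->
  (f \+ g)%R \in Lfun mu p%:E.
Proof.
move=> p1; have p1' : (1 <= p%:E)%E by rewrite lee_fin.
exact: (Lfun_addr_closed mu p1').2.
Qed.

Lemma LfunZ p (c : R) f : 1 <= p -> f \in Lfun mu p%:E -> (fun x => c * f x) \in Lfun mu p%:E.
Proof.
move=> p1 hf; have -> : (fun x => c * f x) = (c \o* f) by apply/funext => x /=; rewrite mulrC.
exact: Lfun_scale.
Qed.

Lemma Lfun0 p : 1 <= p -> (fun=> 0 : R) \in Lfun mu p%:E.
Proof.
move=> p1; have p1' : (1 <= p%:E)%E by rewrite lee_fin.
exact: (Lfun_addr_closed mu p1').1.
Qed.

Lemma LfunN p f : f \in Lfun mu p%:E -> (\- f)%R \in Lfun mu p%:E.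
Proof. exact: Lfun_oppr_closed. Qed.

Lemma LfunB p f g : 1 <= p -> f \in Lfun mu p%:E -> g \in Lfun mu p%:E ->
  (f \- g)%R \in Lfun mu p%:E.
Proof. by move=> p1 hf hg; apply: LfunD => //; exact: LfunN. Qed.

Lemma Lnorm_triangle p f g h : 1 <= p -> measurable_fun setT f ->
  measurable_fun setT g -> measurable_fun setT h ->
  (\forall x \ae mu, `|f x| <= `|g x| + `|h x|) ->
  ('N_p[f] <= 'N_p[g] + 'N_p[h])%E.
Proof.
move=> p1 mf mg mh fgh; have p0 : 0 < p by apply: lt_le_trans p1.
have mag : measurable_fun setT (fun x => `|g x|) by exact: (measurableT_comp _ mg).
have mah : measurable_fun setT (fun x => `|h x|) by exact: (measurableT_comp _ mh).
apply: (@le_trans _ _ ('N_p[(fun x => `|g x|) \+ (fun x => `|h x|)])).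
  apply: le_Lnorm => //; first exact: measurable_funD.
  by apply: filterS fgh => x /= fx; rewrite [leRHS]ger0_norm ?addr_ge0.
apply: (le_trans (minkowski_EFin mu mag mah p1)); apply: leeD; apply: le_Lnorm => //;
  by apply: aeW => x; rewrite normr_id.
Qed.

Definition Lp_cvg p u f := f \in Lfun mu p%:E /\
  ('N_p[u n \- f] @[n --> \oo] --> 0)%E.

Lemma Lnorm_lt p f (e : R) : 0 < p -> 0 < e ->
  ('N_p[f] < e%:E)%E <-> (Ip p f < (e `^ p)%:E)%E.
Proof.
move=> p0 e0; rewrite -(Lnorm_pow _ p0) -poweR_EFin; split.
  exact: (lte_pow p0 (Lnorm_ge0 _ _ _)).
rewrite !ltNge; apply: contra => h; apply: lee_pow => //; first exact: ltW.
by rewrite lee_fin ltW.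
Qed.

Lemma Lp_complete p u : 1 <= p -> (forall n, u n \in Lfun mu p%:E) ->
  (forall e : R, 0 < e -> exists N, forall m n, (N <= m)%N -> (N <= n)%N ->
    ('N_p[u m \- u n] < e%:E)%E) ->
  exists f, Lp_cvg p u f.
Proof.
move=> p1 hu hC; have p0 : 0 < p by apply: lt_le_trans p1.
have mu_ n : measurable_fun setT (u n) := Lfun_measurable (hu n).
have hC' (e : R) : 0 < e -> exists N, forall m n, (N <= m)%N -> (N <= n)%N ->
    (Ip p (u m \- u n)%R < e%:E)%E.
  move=> e0; have e0' : 0 < e `^ p^-1 by rewrite powR_gt0.
  have [N hN] := hC _ e0'; exists N => m n Nm Nn.
  have /(Lnorm_lt _ p0 e0') := hN _ _ Nm Nn.
  by rewrite powRKV ?gt_eqF// ltW.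
have [f mf hf] := power_integral_complete p0 mu_ hC'.
have hcv (e : R) : 0 < e -> exists N, forall n, (N <= n)%N ->
    ('N_p[u n \- f] < e%:E)%E.
  move=> e0; have e0' : 0 < (e / 2) `^ p by rewrite powR_gt0// divr_gt0.
  have [N hN] := hf _ e0'; exists N => n Nn.
  apply/(Lnorm_lt _ p0 e0); apply: (le_lt_trans (hN _ Nn)); rewrite lte_fin.
  rewrite -lte_fin -!poweR_EFin; apply: lte_pow => //.
    by rewrite lee_fin divr_ge0// ltW.
  by rewrite lte_fin ltr_pdivrMr// ltr_pMr// ltr1n.
exists f; split; last by apply/(cvge0P (fun n => Lnorm_ge0 _ _ _)); exact: hcv.
have [N hN] := hcv 1 ltr01.
have hNf : (u N \- f)%R \in Lfun mu p%:E.
  apply/andP; rewrite !inE/= /finite_norm; split; first exact: measurable_funB.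
  by apply: lt_trans (hN N (leqnn N)) _; rewrite ltry.
have -> : f = (u N \- (u N \- f))%R by apply/funext => x /=; lra.
exact: LfunB.
Qed.

Lemma Lp_cvg_le p u v f g : 1 <= p -> (forall n, measurable_fun setT (u n)) ->
  (forall n, measurable_fun setT (v n)) ->
  (forall n, \forall x \ae mu, u n x <= v n x) ->
  Lp_cvg p u f -> Lp_cvg p v g -> \forall x \ae mu, f x <= g x.
Proof.
move=> p1 mu_ mv uv [hf uf] [hg vg]; have p0 : 0 < p by apply: lt_le_trans p1.
have [mf mg] := (Lfun_measurable hf, Lfun_measurable hg).
pose k x := Num.max (f x - g x) 0.
have mk : measurable_fun setT k.
  by apply: measurable_maxr => //; exact: measurable_funB.
have : ('N_p[k] = 0)%E.
  apply: le_cvge0_eq0 (cvge0D uf vg) => [|n]; first exact: Lnorm_ge0.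
  apply: Lnorm_triangle => //; try exact: measurable_funB.
  apply: filterS (uv n) => x hx; rewrite /k /=.
  case: (leP 0 (f x - g x)) => hfg.
    rewrite ger0_norm//.
    have -> : f x - g x = - (u n x - f x) + (v n x - g x) + (u n x - v n x) by lra.
    have := ler_norm (- (u n x - f x)); have := ler_norm (v n x - g x).
    by rewrite normrN; lra.
  by rewrite normr0 addr_ge0.
move/(Lnorm_eq0_eq0 _ _) => /(_ _)/wrap[].
  exact/measurable_EFinP.
rewrite lte_fin => /(_ p0); apply: filterS => x /(_ I) /=.
rewrite /k => -[] /eqP; case: (leP 0 (f x - g x)) => hfg.
  by rewrite subr_eq0 => /eqP ->.
by move=> _; rewrite -subr_le0 ltW.
Qed.

Lemma Lp_cvg_unique p u f g : 1 <= p -> (forall n, measurable_fun setT (u n)) ->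
  Lp_cvg p u f -> Lp_cvg p u g -> \forall x \ae mu, f x = g x.
Proof.
move=> p1 mu_ uf ug.
have fg := Lp_cvg_le p1 mu_ mu_ (fun n => aeW mu (fun x => lexx (u n x))) uf ug.
have gf := Lp_cvg_le p1 mu_ mu_ (fun n => aeW mu (fun x => lexx (u n x))) ug uf.
by apply: filterS2 fg gf => x h1 h2; apply: le_anti; rewrite h1 h2.
Qed.

Lemma Lp_cvg_cst p f : 0 < p -> f \in Lfun mu p%:E -> Lp_cvg p (fun=> f) f.
Proof.
move=> p0 hf; split => //.
have -> : (f \- f)%R = cst 0 by apply/funext => x /=; rewrite subrr.
have -> : EFin \o cst (0:R) = cst 0%E :> (T -> _) by [].
by rewrite Lnorm0 ?gt_eqF//; exact: cvg_cst.
Qed.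

Lemma Lp_cvg_ae p u v f : 1 <= p -> (forall n, measurable_fun setT (u n)) ->
  (forall n, measurable_fun setT (v n)) ->
  (forall n, \forall x \ae mu, u n x = v n x) -> Lp_cvg p u f -> Lp_cvg p v f.
Proof.
move=> p1 mu_ mv uv [hf uf]; split => //.
suff : (fun n => 'N_p[v n \- f]) = (fun n => 'N_p[u n \- f]) by move=> ->.
apply/funext => n; have mf := Lfun_measurable hf.
apply: eq_ae_Lnorm; [exact: lt_le_trans p1|exact: measurable_funB..|].
by apply: filterS (uv n) => x /= ->.
Qed.

Lemma Lp_cvgD p u v f g : 1 <= p -> (forall n, measurable_fun setT (u n)) ->
  (forall n, measurable_fun setT (v n)) ->
  Lp_cvg p u f -> Lp_cvg p v g -> Lp_cvg p (fun n => u n \+ v n)%R (f \+ g)%R.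
Proof.
move=> p1 mu_ mv [hf uf] [hg vg]; split; first exact: LfunD.
apply: squeeze_cvge0 (cvge0D uf vg) => n; rewrite Lnorm_ge0/=.
have [mf mg] := (Lfun_measurable hf, Lfun_measurable hg).
apply: Lnorm_triangle => //; try exact: measurable_funB.
  by apply: measurable_funB; exact: measurable_funD.
apply: aeW => x /=; apply: le_trans (ler_normD _ _); rewrite le_eqVlt.
by apply/orP; left; apply/eqP; congr (`|_|); lra.
Qed.

Lemma Lfun_mul p q f g : 0 < p -> 0 < q -> p^-1 + q^-1 = 1 ->
  f \in Lfun mu p%:E -> g \in Lfun mu q%:E -> (f \* g)%R \in Lfun mu 1.
Proof.
move=> p0 q0 pq hf hg; have [mf mg] := (Lfun_measurable hf, Lfun_measurable hg).
apply/andP; rewrite !inE/= /finite_norm; split; first exact: measurable_funM.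
apply: (le_lt_trans (hoelder mu mf mg p0 q0 pq)); apply: lte_mul_pinfty.
- exact: Lnorm_ge0.
- by rewrite ge0_fin_numE ?Lnorm_ge0// (Lfun_lty hf).
- exact: Lfun_lty.
Qed.

Lemma Lp_cvg_mul p q u f g : 1 <= p -> 0 < q -> p^-1 + q^-1 = 1 ->
  (forall n, measurable_fun setT (u n)) -> g \in Lfun mu q%:E ->
  Lp_cvg p u f -> Lp_cvg 1 (fun n => u n \* g)%R (f \* g)%R.
Proof.
move=> p1 q0 pq mu_ hg [hf uf]; have p0 : 0 < p by apply: lt_le_trans p1.
split; first exact: (Lfun_mul p0 q0 pq).
have [mf mg] := (Lfun_measurable hf, Lfun_measurable hg).
have gfin : 'N_q[g] \is a fin_num.
  by rewrite ge0_fin_numE ?Lnorm_ge0// (Lfun_lty hg).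
apply: squeeze_cvge0 (cvge0_scale (fine 'N_q[g]) uf) => n; rewrite Lnorm_ge0/=.
rewrite fineK// muleC.
have -> : ((u n \* g) \- (f \* g))%R = ((u n \- f) \* g)%R.
  by apply/funext => x /=; rewrite mulrBl.
by apply: hoelder => //; exact: measurable_funB.
Qed.

End Lp_limits.

(** * The Hahn-Banach theorem *)

Section Hahn_Banach.
Context {R : realType} {V : lmodType R}.

Definition is_subspace (S : set V) :=
  S 0 /\ forall (a : R) x y, S x -> S y -> S (a *: x + y).

Definition sublinear_on (S : set V) (N : V -> R) :=
  (forall x y, S x -> S y -> N (x + y) <= N x + N y) /\
  (forall (a : R) x, 0 <= a -> S x -> N (a *: x) = a * N x).

Definition linear_on (S : set V) (L : V -> R) :=
  forall (a : R) x y, S x -> S y -> L (a *: x + y) = a * L x + L y.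

(** Partial functionals below N are represented by their graphs; a graph of
    this kind is single-valued because it meets {0} * R in a bounded line. *)
Definition graph_below (S : set V) (N : V -> R) (G : set (V * R)) :=
  [/\ G (0, 0), forall (a : R) x y, G x -> G y -> G (a *: x.1 + y.1, a * x.2 + y.2),
      forall x, G x -> S x.1 & forall x, G x -> x.2 <= N x.1].

Lemma graph_below_fun S N G x r s : sublinear_on S N -> is_subspace S ->
  graph_below S N G -> G (x, r) -> G (x, s) -> r = s.
Proof.
move=> [_ NZ] [S0 _] [G0 Gl GS GN] xr xs.
have N0 : N 0 = 0 by rewrite -(scale0r (0 : V)) NZ// mul0r.
have h r' s' : G (x, r') -> G (x, s') -> r' - s' <= 0.
  move=> gr gs; have := GN _ (Gl (-1) _ _ gs gr); rewrite /= scaleN1r addNr N0.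
  by rewrite mulN1r addrC.
by apply: le_anti; rewrite -subr_le0 h//= -subr_le0 h.
Qed.

(** One-dimensional extension: the value c at x0 has to lie between the
    supremum of r - N (x - x0) and the infimum of N (y + x0) - s. *)
Lemma graph_below_extend S N G x0 : sublinear_on S N -> is_subspace S ->
  graph_below S N G -> S x0 ->
  exists2 G', graph_below S N G' & G `<=` G' /\ exists r, G' (x0, r).
Proof.
move=> [ND NZ] [S0 Sl] [G0 Gl GS GN] Sx0.
have SD x y : S x -> S y -> S (x + y).
  by move=> Sx Sy; rewrite -[x]scale1r; exact: Sl.
have SZ (a : R) x : S x -> S (a *: x).
  by move=> Sx; rewrite -[_ *: _]addr0; exact: Sl.
have SN x : S x -> S (- x) by move=> Sx; rewrite -scaleN1r; exact: SZ.
have GD x y : G x -> G y -> G (x.1 + y.1, x.2 + y.2).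
  by move=> gx gy; have := Gl 1 _ _ gx gy; rewrite scale1r mul1r.
have GZ (a : R) x : G x -> G (a *: x.1, a * x.2).
  by move=> gx; have := Gl a _ _ gx G0; rewrite /= !addr0.
pose A := [set y.2 - N (y.1 - x0) | y in G].
pose B z := N (z.1 + x0) - z.2.
have AB y z : G y -> G z -> y.2 - N (y.1 - x0) <= B z.
  move=> gy gz; rewrite /B.
  have h1 := GN _ (GD _ _ gy gz).
  have := ND (y.1 - x0) (z.1 + x0) (SD _ _ (GS _ gy) (SN _ Sx0)) (SD _ _ (GS _ gz) Sx0).
  by rewrite addrACA addNr addr0 => h2; move: h1 => /=; lra.
pose c := sup A.
have supA : has_sup A.
  split; first by exists ((0 : R) - N (0 - x0)); exists (0, 0).
  by exists (B (0, 0)) => _ [y gy <-]; exact: AB.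
have cl y : G y -> y.2 - N (y.1 - x0) <= c.
  by move=> gy; apply: ub_le_sup; [case: supA|exists y].
have cu z : G z -> c <= B z.
  by move=> gz; apply: ge_sup; [case: supA|move=> _ [y gy <-]; exact: AB].
pose G' := [set w : V * R | exists y (t : R), G y /\ w = (y.1 + t *: x0, y.2 + t * c)].
exists G'.
  split.
  - by exists (0, 0), 0; split => //; rewrite scale0r mul0r !addr0.
  - move=> a _ _ [y [t [gy ->]]] [z [s [gz ->]]] /=.
    exists (a *: y.1 + z.1, a * y.2 + z.2), (a * t + s); split; first exact: Gl.
    rewrite /= scalerDr scalerDl scalerA; congr (_, _); first by rewrite addrACA.
    by ring.
  - by move=> _ [y [t [gy ->]]] /=; apply: SD; [exact: GS|exact: SZ].
  move=> _ [y [t [gy ->]]] /=.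
  have Sy := GS _ gy.
  have [t0|t0|->] := ltgtP t 0; last by rewrite mul0r scale0r !addr0; exact: GN.
    (* t < 0: use the lower bound at - t^-1 y *)
    have nt0 : 0 < - t by rewrite oppr_gt0.
    have := cl _ (GZ (- t)^-1 _ gy); rewrite /= => h.
    have -> : y.1 + t *: x0 = (- t) *: ((- t)^-1 *: y.1 - x0).
      by rewrite scalerBr scalerA divff ?gt_eqF// scale1r scaleNr opprK.
    rewrite NZ; [|exact: ltW|by apply: SD; [exact: SZ|exact: SN]].
    move: h; move: (N _) => n h.
    rewrite -(@ler_pM2l _ (- t)) // mulrBr mulrA divff ?gt_eqF// mul1r in h.
    by lra.
  have := cu _ (GZ t^-1 _ gy); rewrite /B /= => h.
  have -> : y.1 + t *: x0 = t *: (t^-1 *: y.1 + x0).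
    by rewrite scalerDr scalerA divff ?gt_eqF// scale1r.
  rewrite NZ; [|exact: ltW|by apply: SD => //; exact: SZ].
  move: h; move: (N _) => n h.
  rewrite -(@ler_pM2l _ t)// mulrBr mulrA divff ?gt_eqF// mul1r in h.
  by lra.
split.
  move=> [y r] gy; exists (y, r), 0; split => //=.
  by rewrite scale0r mul0r !addr0.
by exists c, (0, 0), 1; split => //=; rewrite scale1r mul1r !add0r.
Qed.

Theorem Hahn_Banach (M S : set V) (N : V -> R) (l : V -> R) :
  is_subspace M -> is_subspace S -> M `<=` S -> sublinear_on S N ->
  linear_on M l -> (forall x, M x -> l x <= N x) ->
  exists L : V -> R, [/\ linear_on S L, forall x, M x -> L x = l x &
    forall x, S x -> L x <= N x].
Proof.
move=> subM subS MS Nsub lM lN.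
pose G0 := [set w : V * R | M w.1 /\ w.2 = l w.1].
have l0 : l 0 = 0.
  have := lM 1 0 0 subM.1 subM.1; rewrite scale1r mul1r addr0 => h.
  by apply: (addrI (l 0)); rewrite addr0 -h.
have G0P : graph_below S N G0.
  split.
  - by split => /=; [exact: subM.1|rewrite l0].
  - move=> a x y [Mx ->] [My ->]; split => /=; last by rewrite lM.
    exact: subM.2.
  - by move=> x [/MS].
  - by move=> x [Mx ->]; exact: lN.
pose P := [set G : set (V * R) | G = set0 \/ (graph_below S N G /\ G0 `<=` G)].
have [|G [PG Gmax]] := @Zorn_bigcup _ P.
  move=> F FP Ftot.
  have [nF|/existsNP[G1 /not_implyP[FG1 G10]]] :=
      pselect (forall G, F G -> G = set0).
    by left; apply/seteqP; split => // x [G /nF ->].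
  have FP' G w : F G -> G w -> graph_below S N G /\ G0 `<=` G.
    by move=> FG Gw; case: (FP _ FG) => // G00; rewrite G00 in Gw.
  have [w1 G1w1] : exists w, G1 w.
    by apply/set0P/eqP.
  have [G1b G01] := FP' _ _ FG1 G1w1.
  right; split; last by move=> w /G01 G1w; exists G1.
  split.
  - by exists G1 => //; case: G1b.
  - move=> a x y [G FG Gx] [G' FG' Gy].
    have [[_ Gl _ _] _] := FP' _ _ FG Gx; have [[_ Gl' _ _] _] := FP' _ _ FG' Gy.
    have [GG'|G'G] := Ftot _ _ FG FG'.
      by exists G' => //; apply: Gl' => //; exact: GG'.
    by exists G => //; apply: Gl => //; exact: G'G.
  - by move=> x [G FG Gx]; have [[_ _ + _] _] := FP' _ _ FG Gx; exact.
  - by move=> x [G FG Gx]; have [[_ _ _ +] _] := FP' _ _ FG Gx; exact.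
have [Gb G0G] : graph_below S N G /\ G0 `<=` G.
  case: PG => // G00; exfalso; apply: (Gmax G0); last by right; split.
  rewrite G00; split; first exact: sub0set.
  by move=> h; case: G0P => G000 _ _ _; exact: (h _ G000).
have tot x : S x -> exists r, G (x, r).
  move=> Sx; apply: contrapT => nx.
  have [G' G'b [GG' [r G'r]]] := graph_below_extend Nsub subS Gb Sx.
  apply: (Gmax G'); last by right; split => //; exact: subset_trans GG'.
  by split => // G'G; apply: nx; exists r; exact: G'G.
pose L x := xget 0 [set r | G (x, r)].
have GL x : S x -> G (x, L x).
  by move=> /tot[r Gr]; rewrite /L; case: xgetP => [y _ //|/(_ r)].
have Lfun x r : G (x, r) -> S x -> L x = r.
  by move=> Gr Sx; apply: (graph_below_fun Nsub subS Gb (GL _ Sx)).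
exists L; split.
- move=> a x y Sx Sy; apply: Lfun; last exact: subS.2.
  by case: Gb => _ Gl _ _; exact: (Gl a (x, L x) (y, L y) (GL _ Sx) (GL _ Sy)).
- by move=> x Mx; apply: Lfun; [apply: G0G|exact: MS].
- by move=> x Sx; case: Gb => _ _ _ /(_ _ (GL _ Sx)).
Qed.

End Hahn_Banach.

(** * Densities and essential suprema *)

Lemma natSinv_lt {R : realType} (e : R) : 0 < e -> exists n : nat, n.+1%:R^-1 < e.
Proof.
move=> e0; exists (Num.truncn e^-1).
by rewrite invf_plt ?posrE// truncnS_gt.
Qed.

Section density.
Context d (T : measurableType d) (R : realType).
Variable mu : {sigma_finite_measure set T -> \bar R}.
Variables (b : T -> R) (m : set T -> R).
Hypothesis bint : mu.-integrable setT (EFin \o b).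
Hypothesis b0 : forall x, 0 <= b x.
Hypothesis mD : forall A B, measurable A -> measurable B -> A `&` B = set0 ->
  m (A `|` B) = m A + m B.
Hypothesis mb : forall A, measurable A -> (`|m A|%:E <= \int[mu]_(x in A) (b x)%:E)%E.

Let nu (A : set T) : \bar R := (m A)%:E.

Let nu0 : nu set0 = 0%E.
Proof.
have := mb measurable0; rewrite integral_set0 lee_fin normr_le0 => /eqP.
by rewrite /nu => ->.
Qed.

Let nu_fin A : measurable A -> nu A \is a fin_num. Proof. by []. Qed.

Let nu_bigsetU (F : nat -> set T) n : (forall i, measurable (F i)) ->
  trivIset setT F -> nu (\big[setU/set0]_(i < n) F i) = (\sum_(i < n) nu (F i))%E.
Proof.
move=> mF tF; elim: n => [|n IH]; first by rewrite !big_ord0.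
rewrite !big_ord_recr/= -IH /nu mD ?EFinD//; first exact: bigsetU_measurable.
by rewrite -bigcup_mkord; apply/eqP; rewrite setIC setI_bigcupr;
  apply/eqP; apply: bigcup0 => i /= iN; move/trivIsetP : tF; apply => //;
  rewrite gtn_eqF.
Qed.

Let nu_sigma_additive : semi_sigma_additive nu.
Proof.
move=> F mF tF mUF.
under eq_fun do rewrite big_mkord -nu_bigsetU//.
set U := \bigcup_n F n.
pose W n := \big[setU/set0]_(i < n) F i.
have mW n : measurable (W n) by exact: bigsetU_measurable.
have WU n : W n `<=` U by rewrite /W -bigcup_mkord => x [i _ Fi]; exists i.
have bU A : measurable A -> mu.-integrable A (EFin \o b).
  by move=> mA; apply: integrableS bint.
have Wcv : (\int[mu]_(x in W n) (b x)%:E)%E @[n --> \oo] -->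
    (\int[mu]_(x in U) (b x)%:E)%E.
  rewrite ge0_integral_bigcup//; last 2 first.
  - by case/integrableP : (bU _ mUF).
  - by move=> x _; rewrite lee_fin.
  have -> : (fun n => \int[mu]_(x in W n) (b x)%:E)%E =
      (fun n => \sum_(0 <= i < n) \int[mu]_(x in F i) (b x)%:E)%E.
    apply/funext => n; rewrite /W big_mkord -(big_mkord xpredT F) ge0_integral_bigsetU//=.
    - by rewrite big_mkord.
    - exact: iota_uniq.
    - by apply: sub_trivIset tF.
    - rewrite big_mkord; case/integrableP : (bU _ (mW n)) => + _; exact.
    - by move=> x _; rewrite lee_fin.
  apply: is_cvg_nneseries => i _ _; apply: integral_ge0 => x _.
  by rewrite lee_fin.
have Ufin : (\int[mu]_(x in U) (b x)%:E)%E \is a fin_num.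
  exact: integrable_fin_num (bU _ mUF).
have Wfin n : (\int[mu]_(x in W n) (b x)%:E)%E \is a fin_num.
  exact: integrable_fin_num (bU _ (mW n)).
apply: cvg_EFin; first exact: nearW.
apply/cvgrPdist_le => e e0.
rewrite -(fineK Ufin) in Wcv; move/fine_cvgP : Wcv => [_] /cvgrPdist_le /(_ e e0).
apply: filterS => n; rewrite /= => h; apply: le_trans h.
rewrite -[X in m X](setDUK (WU n)) mD//; last 2 first.
- exact: measurableD.
- by apply/seteqP; split => // x [h1 [_ h2]].
rewrite -/(W n) addrC addKr; apply: le_trans (ler_norm _).
rewrite -lee_fin EFinB !fineK//.
have -> : (\int[mu]_(x in U) (b x)%:E = \int[mu]_(x in W n) (b x)%:E +
    \int[mu]_(x in U `\` W n) (b x)%:E)%E.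
  rewrite -[in LHS](setDUK (WU n)) ge0_integral_setU//.
  - exact: measurableD.
  - by rewrite setDUK//; case/integrableP : (bU _ mUF).
  - by move=> x _; rewrite lee_fin.
  - by apply/disj_setPS => x [h1 [_ h2]]; exact: h2.
rewrite [X in (_ <= X - _)%E]addeC addeK//; apply: mb; exact: measurableD.
Qed.

HB.instance Definition _ := isCharge.Build _ _ _ nu nu0 nu_fin nu_sigma_additive.

(** The domination makes m countably additive, hence a charge which is absolutely
    continuous; the density is its Radon-Nikodym derivative. *)
Lemma density_exists : exists2 f : T -> R, mu.-integrable setT (EFin \o f) &
  forall A, measurable A -> ((m A)%:E = \int[mu]_(x in A) (f x)%:E)%E.
Proof.
have numu : (nu : {charge set T -> \bar R}) `<< mu.
  move=> A A0 E mE EA; have muE := A0 E mE EA.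
  have := mb mE; rewrite null_set_integral//; last first.
    by apply: measurable_funTS; case/integrableP : bint.
  by rewrite lee_fin normr_le0 => /eqP mE0; exact: (congr1 EFin mE0).
pose g := Radon_Nikodym (nu : {charge set T -> \bar R}) mu.
have gfin x : g x \is a fin_num by exact: Radon_Nikodym_fin_num.
have gE : EFin \o (fine \o g) = g by apply/funext => x /=; rewrite fineK.
exists (fine \o g); first by rewrite gE; exact: Radon_Nikodym_integrable.
move=> A mA; rewrite -/(nu A) (Radon_Nikodym_integral numu mA).
by apply: eq_integral => x _; rewrite /= fineK.
Qed.

End density.

Section essential_supremum.
Context d (T : measurableType d) (R : realType).
Variable mu : {measure set T -> \bar R}.

(** The subfamily maximizes, among countable ones, the measure of the part of E
    which is covered; no further set can add to it. *)
Lemma countable_essential_union (I : Type) (i0 : I) (E : set T) (A : I -> set T) :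
  measurable E -> (mu E < +oo)%E -> (forall i, measurable (A i)) ->
  exists s : nat -> I, forall i, mu (E `&` (A i `\` \bigcup_k A (s k))) = 0%E.
Proof.
move=> mE Efin mA.
pose G (s : nat -> I) := E `&` \bigcup_k A (s k).
have mG s : measurable (G s) by apply: measurableI => //; exact: bigcupT_measurable.
have mGE s : (mu (G s) <= mu E)%E by apply: le_measure; rewrite ?inE//; exact: subIsetl.
pose B := [set mu (G s) | s in [set: nat -> I]].
pose beta := ereal_sup B.
have Bb s : (mu (G s) <= beta)%E by apply: ereal_sup_ubound; exists s.
have bfin : beta \is a fin_num.
  rewrite ge0_fin_numE; last by apply: le_trans (Bb (fun=> i0)).
  by apply: le_lt_trans Efin; apply: ge_ereal_sup => _ [s _ <-].
have /choice[sm hsm] : forall n : nat, exists s, (beta - (n.+1%:R^-1)%:E < mu (G s))%E.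
  move=> n; have n0 : (0 : R) < n.+1%:R^-1 by [].
  by have [_ [s _ <-] hs] := @ub_ereal_sup_adherent _ _ _ n0 bfin; exists s.
pose s j := let: (n, k) := odflt (0, 0)%N (unpickle j) in sm n k.
have sP n k : A (sm n k) `<=` \bigcup_j A (s j).
  by move=> x Ax; exists (pickle (n, k)) => //; rewrite /s pickleK.
have Gs : (mu (G s) = beta)%E.
  apply/eqP; rewrite eq_le Bb/=; apply/lee_addgt0Pr => e e0.
  have [n hn] := natSinv_lt e0.
  rewrite -leeBlDr//; apply: (@le_trans _ _ (beta - (n.+1%:R^-1)%:E)%E).
    by apply: leeB => //; rewrite lee_fin ltW.
  apply: (le_trans (ltW (hsm n))); apply: le_measure; rewrite ?inE//.
  by apply: setIS => x [k _ Ax]; exact: (sP _ _ _ Ax).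
exists s => i; pose s' k := if k is k'.+1 then s k' else i.
have Gs' : G s' = G s `|` E `&` (A i `\` \bigcup_k A (s k)).
  apply/seteqP; split => [x [Ex [[|k] _ /= Ax]]|x].
  - have [h|h] := pselect ((\bigcup_k A (s k)) x); [by left|by right].
  - by left; split => //; exists k.
  - move=> [[Ex [k _ Ax]]|[Ex [Ax _]]]; split => //.
      by exists k.+1.
    by exists 0%N.
have mD : measurable (E `&` (A i `\` \bigcup_k A (s k))).
  by apply: measurableI => //; apply: measurableD => //; exact: bigcupT_measurable.
have hU : (mu (G s') = mu (G s) + mu (E `&` (A i `\` \bigcup_k A (s k))))%E.
  rewrite Gs'; apply: measureU => //.
  by apply/seteqP; split => // x [[_ h1] [_ [_ h2]]].
have := Bb s'; rewrite hU Gs -[leRHS]adde0 leeD2lE// => h.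
by apply/eqP; rewrite eq_le h measure_ge0.
Qed.

(** For each rational r, countably many of the sets {r < f} contain the other ones
    up to null sets; the functions f in question have the essential supremum of the
    whole family as their supremum. *)
Lemma ae_sup_countable (F : set (T -> R)) : sigma_finite setT mu -> F !=set0 ->
  (forall f, F f -> measurable_fun setT f) ->
  exists s : nat -> T -> R, (forall k, F (s k)) /\
    forall f, F f -> \forall x \ae mu,
      ((f x)%:E <= ereal_sup (range (fun k => (s k x)%:E)))%E.
Proof.
move=> [E UE Efin] [f0 Ff0] mF.
pose I := {f | F f}; pose i0 : I := exist _ f0 Ff0.
have mI (q : R) (i : I) : measurable [set x | q < sval i x].
  by apply: measurable_ltr_set => //; exact: mF (svalP i).
have /choice[S hS] : forall nq : nat * rat, exists s : nat -> I, forall i : I,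
    mu (E nq.1 `&` ([set x | ratr nq.2 < sval i x] `\`
      \bigcup_k [set x | ratr nq.2 < sval (s k) x])) = 0%E.
  move=> [n q];
  exact: (@countable_essential_union I i0 (E n) (fun i => [set x | ratr q < sval i x])
    (Efin n).1 (Efin n).2 (fun i => mI _ i)).
pose s j := let: (nq, k) := odflt ((0%N, 0), 0%N) (unpickle j) in sval (S nq k).
exists s; split; first by move=> k; rewrite /s; case: (odflt _ _) => nq k'; exact: svalP.
move=> f Ff; pose i : I := exist _ f Ff.
have : \forall x \ae mu, forall j, let nq := odflt (0%N, 0 : rat) (unpickle j) in
    ~ (E nq.1 `&` ([set x | ratr nq.2 < f x] `\`
      \bigcup_k [set x | ratr nq.2 < sval (S nq k) x])) x.
  apply/ae_foralln => j; case: (odflt _ _) => n q.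
  apply: null_ae (hS (n, q) i); apply: measurableI; first exact: (Efin n).1.
  by apply: measurableD; [exact: (mI _ i)|exact: bigcupT_measurable].
apply: filterS => x hx; rewrite leNgt; apply/negP => lt.
have sN k : ((s k x)%:E <= ereal_sup (range (fun k => (s k x)%:E)))%E.
  by apply: ereal_sup_ubound; exists k.
move: lt sN; case: (ereal_sup _) => [r| |]//; last first.
  by move=> _ /(_ 0%N).
rewrite lte_fin => rf sN.
have [q /[!in_itv]/= /andP[rq qf]] := rat_in_itvoo rf.
have [n _ En] : (\bigcup_n E n) x by rewrite -UE.
have := hx (pickle (n, q)); rewrite pickleK /= => h; apply: h; split => //.
split => // -[k _ /= qk].
have := sN (pickle ((n, q), k)); rewrite /s pickleK /= lee_fin leNgt.
by rewrite (lt_trans rq qk).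
Qed.

End essential_supremum.

(** * Curves and curve integrals *)

Section curve_lengths.
Context {R : realType} {X : completeMetricType R}.
Implicit Types (gamma : R -> X) (a b c : R) (s : seq R).

(** A recursive form of polygonal_length. *)
Fixpoint chain_length gamma a s : R :=
  if s is x :: s' then mdist (gamma a) (gamma x) + chain_length gamma x s' else 0.

Lemma polygonal_lengthE gamma a b s : polygonal_length gamma a b s = chain_length gamma a s.
Proof.
elim: s a => [|x s IH] a; first by rewrite /polygonal_length big_nil.
rewrite /= -IH /polygonal_length /= big_nat_recl//=; congr (_ + _).
Qed.

Lemma curve_length_ge gamma a b s : itv_partition a b s ->
  ((chain_length gamma a s)%:E <= curve_length gamma a b)%E.
Proof.
by move=> abs; apply: ereal_sup_ubound; exists s => //; rewrite polygonal_lengthE.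
Qed.

Lemma curve_length_le gamma a b (l : \bar R) :
  (forall s, itv_partition a b s -> ((chain_length gamma a s)%:E <= l)%E) ->
  (curve_length gamma a b <= l)%E.
Proof.
move=> h; apply: ge_ereal_sup => _ [s abs <-]; rewrite polygonal_lengthE.
exact: h.
Qed.

Lemma chain_length_cat gamma a s1 s2 : chain_length gamma a (s1 ++ s2) =
  chain_length gamma a s1 + chain_length gamma (last a s1) s2.
Proof. by elim: s1 a => [|x s1 IH] a /=; rewrite ?add0r// IH addrA. Qed.

(** The segment of the polygon which jumps over c is replaced by the two segments
    through c; by the triangle inequality the length does not decrease. *)
Lemma chain_length_split gamma a b c s : a <= c -> c <= b -> itv_partition a b s ->
  exists s1 s2, [/\ itv_partition a c s1, itv_partition c b s2 &
    chain_length gamma a s <= chain_length gamma a s1 + chain_length gamma c s2].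
Proof.
elim: s a => [|x s IH] a ac cb [/= ps /eqP ls].
  have <- : a = c by apply: le_anti; rewrite ac ls cb.
  by exists [::], [::]; split; rewrite /= ?addr0//; split => //=; apply/eqP.
move: ps => /andP[ax ps].
have [xc|cx] := leP x c.
  have [|s1 [s2 [[p1 l1] h2 h3]]] := IH x xc cb; first by split => //; apply/eqP.
  exists (x :: s1), s2; split => //=; first by split => //=; rewrite ax.
  by rewrite -addrA lerD2l.
have [ac'|ca] := ltP a c; last first.
  have <- : a = c by apply: le_anti; rewrite ac ca.
  exists [::], (x :: s); split => //=; last by rewrite add0r.
  by split => /=; [rewrite ax|apply/eqP].
exists [:: c], (x :: s); split => /=.
- by split => //=; rewrite ac'.
- by split => /=; [rewrite cx|apply/eqP].
- by rewrite addr0 addrA lerD2r metric_triangle.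
Qed.

Lemma curve_length_shift gamma a b : curve_length (fun t => gamma (a + t)) 0 b =
  curve_length gamma a (a + b).
Proof.
have shift x s : chain_length (fun t => gamma (a + t)) x s =
    chain_length gamma (a + x) [seq a + y | y <- s].
  by elim: s x => //= y s IH x; rewrite IH.
have unshift s : [seq a + y | y <- [seq - a + y | y <- s]] = s.
  by elim: s => //= y s ->; rewrite addNKr.
have pth (y x : R) s : path <%R (y + x) [seq y + z | z <- s] = path <%R x s.
  by elim: s x => //= z s IH x; rewrite IH ltrD2l.
have lst (y x : R) s : last (y + x) [seq y + z | z <- s] = y + last x s.
  by elim: s x => //= z s IH x; rewrite IH.
apply/le_anti/andP; split; apply: curve_length_le => s [ps /eqP ls].
  rewrite shift addr0; apply: curve_length_ge; rewrite -{1}(addr0 a); split.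
    by rewrite pth.
  by rewrite lst ls.
have -> : chain_length gamma a s =
    chain_length (fun t => gamma (a + t)) 0 [seq - a + y | y <- s].
  by rewrite shift addr0 unshift.
apply: curve_length_ge; rewrite -{1}(addNr a); split; first by rewrite pth.
by rewrite lst ls addKr.
Qed.

Definition subcurve (c : @curve R X) (a b : R) : @curve R X :=
  (b - a, fun t => c.2 (a + t)).

Variable c : @curve R X.
Hypothesis hc : is_curve c.

(** The length is additive, so a curve with arc-length parametrization has it on
    each subinterval. *)
Lemma curve_length_sub a b : 0 <= a -> a <= b -> b <= c.1 ->
  curve_length c.2 a b = (b - a)%:E.
Proof.
move=> a0 ab bl; case: hc => l0 len.
have lena : curve_length c.2 0 a = a%:E.
  by apply: len; rewrite in_itv/= a0 (le_trans ab).
have lenb : curve_length c.2 0 b = b%:E.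
  by apply: len; rewrite in_itv/= bl (le_trans a0).
have le1 : (curve_length c.2 a b <= (b - a)%:E)%E.
  apply: curve_length_le => s abs.
  rewrite lee_fin lerBrDr addrC -lerBrDr -lee_fin -lena.
  apply: curve_length_le => s1 h1; rewrite lee_fin lerBrDr.
  rewrite -lee_fin -lenb.
  apply: le_trans (curve_length_ge _ (itv_partition_cat h1 abs)).
  by rewrite chain_length_cat lee_fin; case: h1 => _ /eqP ->.
apply/le_anti; rewrite le1/= EFinB leeBlDr// addeC -lena -lenb.
apply: curve_length_le => s h.
have [s1 [s2 [h1 h2 h3]]] := chain_length_split c.2 a0 ab h.
apply: (@le_trans _ _ (chain_length c.2 0 s1 + chain_length c.2 a s2)%:E).
  by rewrite lee_fin.
by rewrite EFinD; apply: leeD; exact: curve_length_ge.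
Qed.

Lemma is_curve_sub a b : 0 <= a -> a <= b -> b <= c.1 -> is_curve (subcurve c a b).
Proof.
move=> a0 ab bl; split => /=; first by rewrite subr_ge0.
move=> t; rewrite in_itv/= => /andP[t0 tb].
rewrite curve_length_shift curve_length_sub//.
- by congr EFin; ring.
- by rewrite lerDl.
- by apply: le_trans bl; rewrite addrC -lerBrDr.
Qed.

Lemma curve_lipschitz a b : 0 <= a -> a <= b -> b <= c.1 ->
  mdist (c.2 a) (c.2 b) <= b - a.
Proof.
move=> a0; rewrite le_eqVlt => /predU1P[<-|ab] bl; first by rewrite mdistxx subrr.
rewrite -lee_fin -curve_length_sub ?(ltW ab)//.
have h : itv_partition a b [:: b] by split => //=; rewrite ab.
by apply: le_trans (curve_length_ge _ h); rewrite /= addr0.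
Qed.

(** The curve extended to R by constants, so that continuity and measurability
    can be stated on the whole line. *)
Definition extended_curve (t : R) : X := c.2 (Num.max 0 (Num.min t c.1)).

Lemma extended_curveE t : t \in `[0, c.1] -> extended_curve t = c.2 t.
Proof.
by rewrite in_itv/= /extended_curve => /andP[t0 tl]; rewrite (min_l tl) (max_r t0).
Qed.

Lemma extended_curve_lipschitz (s t : R) : s <= t ->
  mdist (extended_curve s) (extended_curve t) <= t - s.
Proof.
case: hc => l0 _ st; rewrite /extended_curve.
set a := Num.max 0 _; set b := Num.max 0 _.
have clamp (r : R) : [\/ r < 0 /\ Num.max 0 (Num.min r c.1) = 0,
    c.1 < r /\ Num.max 0 (Num.min r c.1) = c.1 |
    [/\ 0 <= r, r <= c.1 & Num.max 0 (Num.min r c.1) = r]].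
  have [r0|r0] := ltP r 0.
    apply: Or31; split => //; rewrite (min_l (le_trans (ltW r0) l0)).
    by rewrite (max_l (ltW r0)).
  have [rl|lr] := leP r c.1; first by apply: Or33; split => //; rewrite max_r.
  by apply: Or32; split => //; rewrite max_r.
have [a0 ab bl ba] : [/\ 0 <= a, a <= b, b <= c.1 & b - a <= t - s].
  rewrite /a /b; case: (clamp s) => -[]; move=> h1; [move=> ->|move=> ->|move=> h2 ->];
  case: (clamp t) => -[]; move=> h3; [move=> ->|move=> ->|move=> h4 ->|move=> ->|
    move=> ->|move=> h4 ->|move=> ->|move=> ->|move=> h4 ->]; split; lra.
exact: le_trans (curve_lipschitz a0 ab bl) ba.
Qed.

Lemma extended_curve_continuous : continuous extended_curve.
Proof.
move=> t; apply/cvg_ballP => e e0; near=> s.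
rewrite ballEmdist /=.
have st : `|t - s| < e by near: s; exists e.
apply: le_lt_trans st.
have [ts|st] := leP t s.
  by apply: (le_trans (extended_curve_lipschitz ts)); rewrite distrC ler_norm.
rewrite metric_sym; apply: (le_trans (extended_curve_lipschitz (ltW st))).
exact: ler_norm.
Unshelve. all: by end_near. Qed.

Lemma extended_curve_measurable :
  measurable_fun [set: measurableTypeR R] (extended_curve : _ -> borel X).
Proof.
have := @measurability _ _ (measurableTypeR R) (borel X) setT extended_curve (@open X) erefl.
apply => _ [U oU <-]; rewrite setTI.
apply: open_measurable.
by move/continuousP : extended_curve_continuous; exact.
Qed.

Lemma curve_integralE (g : borel X -> \bar R) : curve_integral c g =
  (\int[lebesgue_measure]_(t in `[0%R, c.1]%classic) g (extended_curve t))%E.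
Proof.
by apply: eq_integral => t; rewrite inE /= => ht; rewrite extended_curveE.
Qed.

Lemma measurable_along (g : borel X -> \bar R) D : measurable_fun setT g ->
  measurable_fun (D : set (measurableTypeR R)) (fun t => g (extended_curve t)).
Proof.
move=> mg; apply: measurable_funTS.
exact: (measurableT_comp mg extended_curve_measurable).
Qed.

End curve_lengths.

Lemma ge0_integral_translate {R : realType} (F : R -> \bar R) (a b : R) :
  measurable_fun [set: measurableTypeR R] F -> (forall t, 0 <= F t)%E ->
  (\int[lebesgue_measure]_(t in `[0%R, (b - a)%R]%classic) F (a + t)%R =
   \int[lebesgue_measure]_(t in `[a, b]%classic) F t)%E.
Proof.
move=> mF F0; pose phi : measurableTypeR R -> measurableTypeR R := fun t => a + t.
have mphi : measurable_fun setT phi by apply: measurable_funD.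
have pre (x y : R) (b0 b1 : bool) : phi @^-1` [set` Interval (BSide b0 x) (BSide b1 y)] =
    [set` Interval (BSide b0 (x - a)) (BSide b1 (y - a))].
  apply/seteqP; split => t; rewrite /= /phi !in_itv/= !lteifBlDl !lteifBrDl//;
  by rewrite ![t + a]addrC.
have -> : `[0%R, b - a]%classic = phi @^-1` `[a, b]%classic.
  by rewrite pre subrr.
rewrite -[LHS](@ge0_integral_pushforward _ _ _ _ R phi mphi lebesgue_measure `[a, b]%classic F)//.
  apply: eq_measure_integral => A mA _.
  apply/esym/(@lebesgue_measure_unique R (pushforward lebesgue_measure phi)) => //.
  move=> _ [[x y]] _ <-.
  have preE : phi @^-1` `]x, y]%classic = `]x - a, y - a]%classic by exact: pre.
  transitivity (lebesgue_measure `]x - a, y - a]%classic); last by rewrite -preE.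
  rewrite /= !lebesgue_measure_itv/= !lte_fin ltrD2r -!EFinB.
  by rewrite opprB addrA subrK.
exact: measurable_funTS.
Qed.

Section curve_integrals.
Context {R : realType} {X : completeMetricType R}.
Variable c : @curve R X.
Hypothesis hc : is_curve c.

Lemma curve_integral_sub (g : borel X -> \bar R) a b : measurable_fun setT g ->
  (forall x, 0 <= g x)%E -> 0 <= a -> a <= b -> b <= c.1 ->
  curve_integral (subcurve c a b) g =
  (\int[lebesgue_measure]_(t in `[a, b]%classic) g (extended_curve c t))%E.
Proof.
move=> mg g0 a0 ab bl.
rewrite -(@ge0_integral_translate _ (fun t => g (extended_curve c t)))//; last first.
  exact: measurable_along.
apply: eq_integral => t; rewrite inE/= in_itv/= => /andP[t0 tb].
rewrite extended_curveE// in_itv/= addr_ge0//=.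
by apply: le_trans bl; rewrite addrC -lerBrDr.
Qed.

Lemma curve_integral_ge0 (g : borel X -> \bar R) : (forall x, 0 <= g x)%E ->
  (0 <= curve_integral c g)%E.
Proof. by move=> g0; exact: integral_ge0. Qed.

Lemma le_curve_integral (g h : borel X -> \bar R) : measurable_fun setT g ->
  measurable_fun setT h -> (forall x, 0 <= g x)%E -> (forall x, g x <= h x)%E ->
  (curve_integral c g <= curve_integral c h)%E.
Proof.
move=> mg mh g0 gh; rewrite !curve_integralE; apply: ge0_le_integral => //;
  exact: measurable_along.
Qed.

Lemma curve_integralD (g h : borel X -> \bar R) : measurable_fun setT g ->
  measurable_fun setT h -> (forall x, 0 <= g x)%E -> (forall x, 0 <= h x)%E ->
  (curve_integral c (fun x => g x + h x) = curve_integral c g + curve_integral c h)%E.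
Proof.
move=> mg mh g0 h0; rewrite !curve_integralE ge0_integralD//;
  exact: measurable_along.
Qed.

Lemma curve_integralZ (k : R) (g : borel X -> \bar R) : 0 <= k -> measurable_fun setT g ->
  (forall x, 0 <= g x)%E ->
  (curve_integral c (fun x => k%:E * g x) = k%:E * curve_integral c g)%E.
Proof.
move=> k0 mg g0; rewrite !curve_integralE ge0_integralZl//.
exact: measurable_along.
Qed.

End curve_integrals.

(** * Increments along an interval *)

Section increments.
Context {R : realType}.
Local Notation leb := (@lebesgue_measure R).
Implicit Types (G H P : measurableTypeR R -> \bar R).

Lemma ge0_integral_itvD P (a b c : R) : measurable_fun setT P ->
  (forall t, 0 <= P t)%E -> a <= b -> b <= c ->
  (\int[leb]_(t in `[a, c]%classic) P t =
   \int[leb]_(t in `[a, b]%classic) P t + \int[leb]_(t in `[b, c]%classic) P t)%E.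
Proof.
move=> mP P0 ab bc.
have -> : `[a, c]%classic = `[a, b]%classic `|` `]b, c]%classic.
  by apply: itv_bndbnd_setU; rewrite bnd_simp.
rewrite ge0_integral_setU//.
- by congr (_ + _)%E; apply: integral_itv_obnd_cbnd; exact: measurable_funTS.
- exact: measurable_funTS.
- apply/disj_setPS => t [] /=; rewrite !in_itv/= => /andP[_ tb] /andP[bt _].
  by move: (lt_le_trans bt tb); rewrite ltxx.
Qed.

(** Absolute continuity of the integral; G may take the value +oo on a null set and
    is first replaced by its finite part. *)
Lemma integral_small_sets G (l e : R) : measurable_fun setT G ->
  (forall t, 0 <= G t)%E -> (\int[leb]_(t in `[0%R, l]%classic) G t < +oo)%E ->
  0 < e -> exists2 r : R, 0 < r & forall A, measurable A -> (leb A < r%:E)%E ->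
    (\int[leb]_(t in `[0%R, l]%classic `&` A) G t <= e%:E)%E.
Proof.
move=> mG G0 Gfin e0; pose D := `[0%R, l]%classic : set (measurableTypeR R).
have mD : measurable D by exact: measurable_itv.
pose GD := G \_ D.
have mGD : measurable_fun setT GD.
  by apply/(measurable_restrictT _ mD); exact: measurable_funTS.
have GD0 t : (0 <= GD t)%E by rewrite /GD patchE; case: ifP.
have GDi : leb.-integrable setT GD.
  apply/integrableP; split => //; under eq_integral do rewrite gee0_abs//.
  by rewrite /GD -integral_mkcond.
pose f := fine \o GD.
have mf : measurable_fun setT f by apply: measurableT_comp.
have fE : \forall t \ae leb, (f t)%:E = GD t.
  by apply: filterS (integrable_ae measurableT GDi) => t /(_ I) h; rewrite fineK.
have fi : leb.-integrable setT (EFin \o f).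
  apply/integrableP; split; first exact/measurable_EFinP.
  rewrite (ge0_ae_eq_integral (g := GD))//.
  - by rewrite /GD -integral_mkcond.
  - by apply: measurableT_comp => //; exact/measurable_EFinP.
  - by apply: filterS fE => t h _; rewrite [(EFin \o f) t]h gee0_abs.
have [r [r0 hr]] := integral_normr_continuous fi e0.
exists r => // A mA Ar; rewrite setIC integral_mkcondr.
rewrite -/GD -(ge0_ae_eq_integral (f := fun t => (`|f t|)%:E))//.
- rewrite -(@fineK _ (\int[leb]_(x in A) `|f x|%:E)%E) ?lee_fin; first exact/ltW/hr.
  apply: integrable_fin_num => //; apply: (integrableS measurableT) => //.
  exact: integrable_norm.
- by apply: measurable_funTS; apply/measurable_EFinP; exact: measurableT_comp.
- exact: measurable_funTS.
- apply: filterS fE => t h _; rewrite ger0_norm//.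
  by rewrite fine_ge0.
Qed.

(** The supremum of the times up to which the bound holds has a neighbourhood where
    the local bound extends it further, unless it is the right endpoint. *)
Lemma increment_local_to_global (F : R -> R) P (l : R) : 0 <= l ->
  measurable_fun setT P -> (forall t, 0 <= P t)%E ->
  (forall t, 0 <= t <= l -> exists2 r : R, 0 < r & forall a b, 0 <= a -> a <= b ->
     b <= l -> t - r < a -> b < t + r ->
     (`|F b - F a|%:E <= \int[leb]_(s in `[a, b]%classic) P s)%E) ->
  (`|F l - F 0|%:E <= \int[leb]_(s in `[0%R, l]%classic) P s)%E.
Proof.
move=> l0 mP P0 loc.
pose A := [set t | 0 <= t <= l /\
  (`|F t - F 0|%:E <= \int[leb]_(s in `[0%R, t]%classic) P s)%E].
have A0 : A 0.
  by split; [rewrite lexx|rewrite subrr normr0; exact: integral_ge0].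
have supA : has_sup A by split; [exists 0|exists l => t [/andP[_]]].
pose s := sup A.
have As t : A t -> t <= s by move=> At; apply: ub_le_sup => //; case: supA.
have s0l : 0 <= s <= l.
  by rewrite As//=; apply: ge_sup; [case: supA|move=> t [/andP[]]].
have [r r0 hr] := loc s s0l.
have [t At st] := sup_adherent r0 supA.
pose t' := Num.min (s + r / 2) l.
have r20 : 0 < r / 2 by rewrite divr_gt0.
have ts := As t At; case: At => /andP[t0 tl] ht.
have tt' : t <= t' by rewrite le_min tl andbT (le_trans ts)// lerDl ltW.
have t'l : t' <= l by rewrite ge_min lexx orbT.
have At' : A t'.
  split; first by rewrite t'l (le_trans t0).
  rewrite (@ge0_integral_itvD _ 0 t)//.
  have -> : F t' - F 0 = (F t - F 0) + (F t' - F t) by ring.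
  apply: (@le_trans _ _ (`|F t - F 0|%:E + `|F t' - F t|%:E)%E).
    by rewrite -EFinD lee_fin ler_normD.
  apply: leeD => //; apply: hr => //.
  by rewrite /t' gt_min; apply/orP; left; lra.
have t's := As _ At'.
suff <- : t' = l by case: At'.
rewrite /t'; case: (leP (s + r / 2) l) => // h; move: t's; rewrite /t' min_l//.
by lra.
Qed.

Lemma ge0_measurable_patch G (U : set (measurableTypeR R)) : measurable U ->
  measurable_fun setT G -> (forall t, 0 <= G t)%E ->
  measurable_fun setT (G \_ U) /\ (forall t, 0 <= (G \_ U) t)%E.
Proof.
move=> mU mG G0; split; last by move=> t; rewrite patchE; case: ifP.
by apply/(measurable_restrictT _ mU); exact: measurable_funTS.
Qed.

(** The sets where G <= H and where H < G are covered by open sets U and U' which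
    are slightly larger; short intervals lie in one of the two, so the increments
    of F are locally dominated by the integral of 1_U G + 1_U' H. *)
Lemma increment_min (F : R -> R) G H (l : R) : 0 <= l ->
  measurable_fun setT G -> (forall t, 0 <= G t)%E ->
  measurable_fun setT H -> (forall t, 0 <= H t)%E ->
  (\int[leb]_(t in `[0%R, l]%classic) G t < +oo)%E ->
  (\int[leb]_(t in `[0%R, l]%classic) H t < +oo)%E ->
  (forall a b, 0 <= a -> a <= b -> b <= l ->
    (`|F b - F a|%:E <= \int[leb]_(t in `[a, b]%classic) G t)%E) ->
  (forall a b, 0 <= a -> a <= b -> b <= l ->
    (`|F b - F a|%:E <= \int[leb]_(t in `[a, b]%classic) H t)%E) ->
  (`|F l - F 0|%:E <= \int[leb]_(t in `[0%R, l]%classic) Order.min (G t) (H t))%E.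
Proof.
move=> l0 mG G0 mH H0 Gfin Hfin FG FH.
pose D := `[0%R, l]%classic : set (measurableTypeR R).
have mD : measurable D by exact: measurable_itv.
pose E := D `&` [set t | (G t <= H t)%E]; pose E' := D `&` [set t | (H t < G t)%E].
have mE : measurable E by apply: measurable_lee => //; exact: measurable_funTS.
have mE' : measurable E' by apply: measurable_lte => //; exact: measurable_funTS.
have Dfin : (leb D < +oo)%E by rewrite /D lebesgue_measure_itv/=; case: ifP; rewrite ltry.
have Efin : (leb E < +oo)%E.
  by apply: le_lt_trans Dfin; apply: le_measure; rewrite ?inE//; exact: subIsetl.
have E'fin : (leb E' < +oo)%E.
  by apply: le_lt_trans Dfin; apply: le_measure; rewrite ?inE//; exact: subIsetl.
have DEE' : D = E `|` E'.
  rewrite -setIUr; apply/esym/setIidl => t _ /=.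
  by case: (leP (G t) (H t)); [left|right].
have EE' : [disjoint E & E'].
  apply/disj_setPS => t [[_ /= h1] [_ /= h2]].
  by move: (lt_le_trans h2 h1); rewrite ltxx.
have mmin : measurable_fun setT (fun t => Order.min (G t) (H t)).
  exact: measurable_mine.
have min0 t : (0 <= Order.min (G t) (H t))%E by rewrite le_min G0 H0.
have minE : (\int[leb]_(t in D) Order.min (G t) (H t) =
    \int[leb]_(t in E) G t + \int[leb]_(t in E') H t)%E.
  rewrite DEE' ge0_integral_setU//; last exact: measurable_funTS.
  congr (_ + _)%E; apply: eq_integral => t /[!inE] -[_ /= h].
    by rewrite min_l.
  by rewrite min_r// ltW.
apply/lee_addgt0Pr => e e0; have e20 : 0 < e / 2 by rewrite divr_gt0.
have [r r0 hr] := integral_small_sets mG G0 Gfin e20.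
have [r' r'0 hr'] := integral_small_sets mH H0 Hfin e20.
have [U [oU EU Ur]] := lebesgue_regularity_outer mE Efin r0.
have [U' [oU' EU' Ur']] := lebesgue_regularity_outer mE' E'fin r'0.
have mU : measurable (U : set (measurableTypeR R)) by exact: open_measurable.
have mU' : measurable (U' : set (measurableTypeR R)) by exact: open_measurable.
pose P t := ((G \_ U) t + (H \_ U') t)%E.
have [mGU GU0] := ge0_measurable_patch mU mG G0.
have [mHU HU0] := ge0_measurable_patch mU' mH H0.
have mP : measurable_fun setT P by exact: emeasurable_funD.
have P0 t : (0 <= P t)%E by rewrite adde_ge0.
have PG (a b : R) : `[a, b]%classic `<=` U ->
    (\int[leb]_(t in `[a, b]%classic) G t <= \int[leb]_(t in `[a, b]%classic) P t)%E.
  move=> abU; apply: ge0_le_integral => //; try exact: measurable_funTS.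
  by move=> t /abU Ut; rewrite /P [(G \_ U) t]patchE mem_set// leeDl.
have PH (a b : R) : `[a, b]%classic `<=` U' ->
    (\int[leb]_(t in `[a, b]%classic) H t <= \int[leb]_(t in `[a, b]%classic) P t)%E.
  move=> abU; apply: ge0_le_integral => //; try exact: measurable_funTS.
  by move=> t /abU Ut; rewrite /P [(H \_ U') t]patchE mem_set// leeDr.
have le1 : (`|F l - F 0|%:E <= \int[leb]_(t in D) P t)%E.
  apply: increment_local_to_global => // t t0l.
  have nearby (V : set R) : open V -> V t -> exists2 r : R, 0 < r &
      forall a b, t - r < a -> b < t + r -> `[a, b]%classic `<=` V.
    rewrite openE => /[apply] /nbhs_ballP[d d0 hd]; exists d => // a b ta bt s.
    rewrite /= in_itv/= => /andP[as_ sb]; apply: hd.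
    by rewrite /ball/= ltr_distl; apply/andP; split; lra.
  have : (E `|` E') t by rewrite -DEE' /D/= in_itv.
  case => [/EU Ut|/EU' U't].
    have [d d0 hd] := nearby _ oU Ut; exists d => // a b a0 ab bl ta bt.
    by apply: le_trans (PG _ _ (hd _ _ ta bt)); exact: FG.
  have [d d0 hd] := nearby _ oU' U't; exists d => // a b a0 ab bl ta bt.
  by apply: le_trans (PH _ _ (hd _ _ ta bt)); exact: FH.
apply: (le_trans le1); rewrite minE /P ge0_integralD//; [|exact: measurable_funTS..].
have over (K : measurableTypeR R -> \bar R) (A B : set (measurableTypeR R)) (d : R) :
    measurable_fun setT K -> (forall t, 0 <= K t)%E ->
    measurable A -> measurable B -> A `<=` D -> A `<=` B -> (leb (B `\` A) < d%:E)%E ->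
    (forall C, measurable C -> (leb C < d%:E)%E ->
      (\int[leb]_(t in D `&` C) K t <= (e / 2)%:E)%E) ->
    (\int[leb]_(t in D) (K \_ B) t <= \int[leb]_(t in A) K t + (e / 2)%:E)%E.
  move=> mK K0 mA mB AD AB Bd hd; rewrite -integral_mkcondr.
  have -> : D `&` B = A `|` (D `&` (B `\` A)).
    apply/seteqP; split => [t [Dt Bt]|t [At|[Dt [Bt _]]]].
    - by have [At|At] := pselect (A t); [left|right].
    - by split; [exact: AD|exact: AB].
    - by split.
  rewrite ge0_integral_setU//.
  - by apply: leeD => //; apply: hd => //; exact: measurableD.
  - by apply: measurableI => //; exact: measurableD.
  - exact: measurable_funTS.
  - by apply/disj_setPS => t [h1 [_ [_ h2]]].
have h1 := over G E U r mG G0 mE mU (@subIsetl _ _ _) EU Ur hr.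
have h2 := over H E' U' r' mH H0 mE' mU' (@subIsetl _ _ _) EU' Ur' hr'.
apply: (le_trans (leeD h1 h2)); rewrite addeACA -EFinD.
by have -> : e / 2 + e / 2 = e by lra.
Qed.

End increments.

(** * Families of curves of zero modulus *)

Section modulus_zero.
Context {R : realType} {X : completeMetricType R}.
Variable nu : {measure set (borel X) -> \bar R}.
Variable p : R.
Hypothesis p0 : 0 < p.
Implicit Types (g h rho : borel X -> \bar R) (c : @curve R X).

Lemma borel_nonneg_scale (k : R) g : 0 <= k -> borel_nonneg g ->
  borel_nonneg (fun x => k%:E * g x)%E.
Proof.
move=> k0 [mg g0]; split; first exact: measurable_funeM.
by move=> x; rewrite mule_ge0.
Qed.

Lemma borel_nonnegD g h : borel_nonneg g -> borel_nonneg h ->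
  borel_nonneg (fun x => g x + h x)%E.
Proof.
by move=> [mg g0] [mh h0]; split; [exact: emeasurable_funD|move=> x; rewrite adde_ge0].
Qed.

Lemma borel_nonneg_min g h : borel_nonneg g -> borel_nonneg h ->
  borel_nonneg (fun x => Order.min (g x) (h x)).
Proof.
move=> [mg g0] [mh h0]; split; first exact: measurable_mine.
by move=> x; rewrite le_min g0 h0.
Qed.

Lemma borel_nonneg0 : borel_nonneg (cst 0%E : borel X -> \bar R).
Proof. by split => //; exact: measurable_cst. Qed.

Lemma measurable_epow g : measurable_fun setT g ->
  measurable_fun setT (fun x => g x `^ p)%E.
Proof. by move=> mg; apply: (measurableT_comp (measurable_poweR p) mg). Qed.

Lemma le_p_integrable g h : borel_nonneg g -> borel_nonneg h ->
  (forall x, g x <= h x)%E -> p_integrable nu p h -> p_integrable nu p g.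
Proof.
move=> [mg g0] [mh h0] gh; apply: le_lt_trans; apply: ge0_le_integral => //.
- by move=> x _; exact: poweR_ge0.
- exact: measurable_epow.
- exact: measurable_epow.
- by move=> x _; apply: lee_pow => //; exact: ltW.
Qed.

Lemma integral_scale_pow (k : R) g : 0 <= k -> borel_nonneg g ->
  (\int[nu]_x (k%:E * g x) `^ p = (k `^ p)%:E * \int[nu]_x (g x `^ p))%E.
Proof.
move=> k0 [mg g0]; under eq_integral do rewrite poweRM ?lee_fin// poweR_EFin.
rewrite ge0_integralZl//.
- exact: measurable_epow.
- by move=> x _; exact: poweR_ge0.
- by rewrite lee_fin powR_ge0.
Qed.

Lemma p_integrable_scale (k : R) g : 0 <= k -> borel_nonneg g ->
  p_integrable nu p g -> p_integrable nu p (fun x => k%:E * g x)%E.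
Proof.
move=> k0 bg hg; rewrite /p_integrable integral_scale_pow//.
apply: lte_mul_pinfty => //; first by rewrite lee_fin powR_ge0.
Qed.

Lemma p_integrableD g h : borel_nonneg g -> borel_nonneg h ->
  p_integrable nu p g -> p_integrable nu p h ->
  p_integrable nu p (fun x => g x + h x)%E.
Proof.
move=> bg bh hg hh; have [[mg g0] [mh h0]] := (bg, bh).
have ig : (\int[nu]_x ((2%:E * g x) `^ p) < +oo)%E.
  by apply: p_integrable_scale.
have ih : (\int[nu]_x ((2%:E * h x) `^ p) < +oo)%E.
  by apply: p_integrable_scale.
apply: (@le_lt_trans _ _ (\int[nu]_x ((2%:E * g x) `^ p + (2%:E * h x) `^ p))%E).
  apply: ge0_le_integral => //.
  - by move=> x _; exact: poweR_ge0.
  - by apply: measurable_epow; exact: emeasurable_funD.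
  - by apply: emeasurable_funD; apply: measurable_epow; exact: measurable_funeM.
  move=> x _; have [gh|hg'] := leP (g x) (h x).
    apply: (@le_trans _ _ ((2%:E * h x) `^ p)%E); last by rewrite leeDr// poweR_ge0.
    apply: lee_pow; [exact: ltW|by rewrite adde_ge0|].
    by rewrite mule_natl mule2n leeD.
  apply: (@le_trans _ _ ((2%:E * g x) `^ p)%E); last by rewrite leeDl// poweR_ge0.
  apply: lee_pow; [exact: ltW|by rewrite adde_ge0|].
  by rewrite mule_natl mule2n leeD// ltW.
rewrite ge0_integralD//; first exact: lte_add_pinfty.
- by move=> x _; exact: poweR_ge0.
- by apply: measurable_epow; exact: measurable_funeM.
- by move=> x _; exact: poweR_ge0.
- by apply: measurable_epow; exact: measurable_funeM.
Qed.

Lemma p_integrable0 : p_integrable nu p (cst 0%E).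
Proof.
rewrite /p_integrable; under eq_integral do rewrite /= powR0 ?gt_eqF//.
by rewrite integral0.
Qed.

(** The majorant is (sum_n rho_n ^ p) ^ (1 / p). *)
Lemma p_integrable_majorant (rho : nat -> borel X -> \bar R) :
  (forall n, borel_nonneg (rho n)) ->
  (forall n, \int[nu]_x (rho n x `^ p) <= (1 / (2 ^ n.+1)%:R)%:E)%E ->
  exists sigma, [/\ borel_nonneg sigma, p_integrable nu p sigma &
    forall n x, (rho n x <= sigma x)%E].
Proof.
move=> brho hrho.
have mrho n : measurable_fun setT (fun x => rho n x `^ p)%E.
  by apply: measurable_epow; case: (brho n).
pose S x := (\sum_(0 <= n <oo) (rho n x `^ p))%E.
have S0 x : (0 <= S x)%E by apply: nneseries_ge0 => n _ _; exact: poweR_ge0.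
have mS : measurable_fun setT S by apply: ge0_emeasurable_sum => // n x _ _; exact: poweR_ge0.
exists (fun x => S x `^ p^-1)%E; split.
- split; last by move=> x; exact: poweR_ge0.
  exact: (measurableT_comp (measurable_poweR p^-1) mS).
- rewrite /p_integrable; under eq_integral do rewrite (poweRKV _ (S0 _)) ?gt_eqF//.
  rewrite integral_nneseries//; last by move=> n x _; exact: poweR_ge0.
  apply: (@le_lt_trans _ _ (\sum_(0 <= k <oo) (1 / (2 ^ k.+1)%:R)%:E)%E).
    apply: lee_nneseries => // k _ _; apply: integral_ge0 => x _; exact: poweR_ge0.
  by apply: (le_lt_trans (epsilon_trick0 xpredT _)); rewrite ?ltry.
- move=> n x; have [_ r0] := brho n.
  apply: (lee_powK p0); rewrite ?poweR_ge0// (poweRKV _ (S0 _)) ?gt_eqF//.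
  apply: le_trans (@nneseries_lim_ge R _ xpredT 0%N n.+1 _); last first.
    by move=> k _ _; exact: poweR_ge0.
  rewrite big_nat_recr//= leeDr// sume_ge0// => i _; exact: poweR_ge0.
Qed.

Lemma small_multiple rho (e : R) : borel_nonneg rho -> p_integrable nu p rho ->
  0 < e -> exists2 k : R, 0 < k & (\int[nu]_x ((k%:E * rho x) `^ p) <= e%:E)%E.
Proof.
move=> brho irho e0; pose I := (\int[nu]_x (rho x `^ p))%E.
have I0 : (0 <= I)%E by apply: integral_ge0 => x _; exact: poweR_ge0.
have If : I \is a fin_num by rewrite ge0_fin_numE.
have [f IE] : exists f, I = f%:E by exists (fine I); rewrite fineK.
have f0 : 0 <= f by rewrite -lee_fin -IE.
have f1 : 0 < f + 1 by rewrite ltr_wpDl.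
exists ((e / (f + 1)) `^ p^-1); first by rewrite powR_gt0// divr_gt0.
rewrite integral_scale_pow ?powR_ge0// -/I IE.
have -> : ((e / (f + 1)) `^ p^-1) `^ p = e / (f + 1).
  by apply: powRKV; [rewrite gt_eqF|rewrite divr_ge0 ?ltW].
rewrite -EFinM lee_fin.
by rewrite mulrAC ler_pdivrMr// ler_pM2l// lerDl.
Qed.

(** Lets countably many gradient inequalities, each valid off its own exceptional
    family, hold simultaneously off a single one: suitable multiples of the rho n
    have summable energies. *)
Lemma countable_majorant (rho : nat -> borel X -> \bar R) :
  (forall n, borel_nonneg (rho n)) -> (forall n, p_integrable nu p (rho n)) ->
  exists sigma, [/\ borel_nonneg sigma, p_integrable nu p sigma &
    forall n, exists2 k : R, 0 < k & forall x, (k%:E * rho n x <= sigma x)%E].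
Proof.
move=> brho irho.
have /choice[k hk] : forall n, exists k : R, 0 < k /\
    (\int[nu]_x ((k%:E * rho n x) `^ p) <= (1 / (2 ^ n.+1)%:R)%:E)%E.
  move=> n; have e0 : (0 : R) < 1 / (2 ^ n.+1)%:R by rewrite divr_gt0// ltr0n expn_gt0.
  by have [k k0 hk] := small_multiple (brho n) (irho n) e0; exists k.
have [|n|sigma [bs is_ hs]] := @p_integrable_majorant (fun n x => (k n)%:E * rho n x)%E.
- by move=> n; apply: borel_nonneg_scale => //; apply: ltW; case: (hk n).
- by case: (hk n).
by exists sigma; split => // n; exists (k n); [case: (hk n)|exact: hs].
Qed.

Lemma finite_along (rho sigma : borel X -> \bar R) (k : R) c : is_curve c ->
  borel_nonneg rho -> borel_nonneg sigma -> 0 < k ->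
  (forall x, k%:E * rho x <= sigma x)%E ->
  (curve_integral c sigma < +oo)%E -> (curve_integral c rho < +oo)%E.
Proof.
move=> hc [mr r0] [ms s0] k0 rs hs.
have : (k%:E * curve_integral c rho < +oo)%E.
  rewrite -(curve_integralZ hc (ltW k0) mr r0); apply: le_lt_trans hs.
  apply: le_curve_integral => //; first exact: measurable_funeM.
  by move=> x; rewrite mule_ge0// lee_fin ltW.
have := curve_integral_ge0 c r0; case: (curve_integral c rho) => [r _ _||//].
  by rewrite ltry.
by move=> _; rewrite gt0_muley ?lte_fin.
Qed.

(** Admissible functions of energy so small that their multiples by n + 1 still have
    summable energies: the common majorant has integral at least n + 1, for all n,
    along each curve of the family. *)
Lemma modulus0_exceptional (Gamma : set curve) : modulus nu p Gamma = 0%E ->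
  exists rho, [/\ borel_nonneg rho, p_integrable nu p rho &
    forall c, is_curve c -> Gamma c -> curve_integral c rho = +oo%E].
Proof.
move=> m0.
have /choice[rho hrho] : forall n : nat, exists rho : borel X -> \bar R,
    [/\ borel_nonneg rho,
       forall c, is_curve c -> Gamma c -> (1 <= curve_integral c rho)%E &
       (\int[nu]_x ((n.+1%:R%:E * rho x) `^ p) <= (1 / (2 ^ n.+1)%:R)%:E)%E].
  move=> n; have n0 : (0 : R) < n.+1%:R `^ p by rewrite powR_gt0.
  have e0 : (0 : R) < 1 / (2 ^ n.+1)%:R / n.+1%:R `^ p.
    by rewrite !divr_gt0// ltr0n expn_gt0.
  have mfin : modulus nu p Gamma \is a fin_num by rewrite m0.
  have [_ [rho [brho hrho] <-]] := lb_ereal_inf_adherent e0 mfin.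
  rewrite -/(modulus nu p Gamma) m0 add0e => h; exists rho; split => //.
  rewrite integral_scale_pow//; apply: (@le_trans _ _ ((n.+1%:R `^ p)%:E *
    (1 / (2 ^ n.+1)%:R / n.+1%:R `^ p)%:E)%E).
    by rewrite lee_pmul2l ?lte_fin// ltW.
  by rewrite -EFinM lee_fin mulrC divfK// gt_eqF.
have [|n|sigma [bs is_ hs]] := @p_integrable_majorant (fun n x => n.+1%:R%:E * rho n x)%E.
- by move=> n; apply: borel_nonneg_scale => //; case: (hrho n).
- by case: (hrho n).
exists sigma; split => // c hc Gc.
have big n : (n.+1%:R%:E <= curve_integral c sigma)%E.
  have [[mr r0] adm _] := hrho n.
  apply: (@le_trans _ _ (n.+1%:R%:E * curve_integral c (rho n))%E).
    by rewrite -[leLHS]mule1 lee_pmul2l ?lte_fin// adm.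
  rewrite -curve_integralZ//; apply: le_curve_integral => //.
  - exact: measurable_funeM.
  - by case: bs.
  - by move=> x; rewrite mule_ge0.
have := big; case: (curve_integral c sigma) => [r|//|/(_ 0%N)//] hr.
exfalso; have := hr (Num.truncn `|r|); rewrite lee_fin leNgt => /negP; apply.
by apply: (le_lt_trans (ler_norm r)); rewrite truncnS_gt.
Qed.

(** All positive multiples of rho are admissible, and their energies are arbitrarily
    small. *)
Lemma exceptional_modulus0 rho : borel_nonneg rho -> p_integrable nu p rho ->
  modulus nu p [set c | curve_integral c rho = +oo%E] = 0%E.
Proof.
move=> brho irho; apply/eqP; rewrite eq_le; apply/andP; split; last first.
  apply: le_ereal_inf_tmp => _ [sigma _ <-].
  by apply: integral_ge0 => x _; exact: poweR_ge0.
apply: le_eps0 => e e0; have [k k0 hk] := small_multiple brho irho e0.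
apply: le_trans hk; apply: ereal_inf_lbound.
exists (fun x => k%:E * rho x)%E => //; split.
  by apply: borel_nonneg_scale => //; exact: ltW.
move=> c hc /= coo; case: brho => mr r0.
by rewrite (curve_integralZ hc (ltW k0) mr r0) coo gt0_muley ?lte_fin// leey.
Qed.

(** The form in which weak upper gradients are used: exceptional families are
    absorbed in a p-integrable function whose curve integral is finite off
    them, so that unions and subcurves need no separate treatment. *)
Lemma weak_upper_gradientP (u : borel X -> R) g :
  weak_upper_gradient nu p u g <-> borel_nonneg g /\
  exists rho, [/\ borel_nonneg rho, p_integrable nu p rho &
    forall c, is_curve c -> (curve_integral c rho < +oo)%E ->
      gradient_inequality u g c].
Proof.
split=> -[bg]; last first.
  move=> [rho [brho irho h]]; split => //.
  exists [set c | curve_integral c rho = +oo%E]; first exact: exceptional_modulus0.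
  by move=> c hc /= nc; apply: h => //; rewrite ltey; apply/eqP.
move=> [Gamma /modulus0_exceptional[rho [brho irho hrho]] h]; split => //.
exists rho; split => // c hc cfin; apply: h => // Gc.
by move: cfin; rewrite hrho.
Qed.

End modulus_zero.

(** * Weak upper gradients *)

Lemma ae_lebesgue_imply {R : realType} (P Q : R -> Prop) : (forall t, P t -> Q t) ->
  (\forall t \ae (@lebesgue_measure R), P t) ->
  \forall t \ae (@lebesgue_measure R), Q t.
Proof.
move=> PQ [M [mM M0 hM]]; exists M; split => // t /= nQ; apply: hM => /= Pt.
exact/nQ/PQ.
Qed.

(** The half-width r / 2 makes the length strictly less than r; near l the interval is
    taken to the left of t. *)
Lemma short_interval {R : realType} (l t r : R) : 0 < l -> 0 <= t -> t <= l -> 0 < r ->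
  exists a b : R, [/\ 0 <= a, a <= t, t <= b, b <= l & b - a < r /\ a < b].
Proof.
move=> l0 t0 tl r0; have [tl'|lt] := ltP t l.
  have [h|h] := leP (t + r / 2) l; [exists t, (t + r / 2)|exists t, l];
  by repeat split; lra.
have [h|h] := leP (t - r / 2) 0; [exists 0, t|exists (t - r / 2), t];
by repeat split; lra.
Qed.

Section weak_upper_gradients.
Context {R : realType} {X : completeMetricType R}.
Variable nu : {measure set (borel X) -> \bar R}.
Variable p : R.
Hypothesis p0 : 0 < p.
Implicit Types (u v : borel X -> R) (g h rho : borel X -> \bar R) (c : @curve R X).
Local Notation leb := (@lebesgue_measure R).
Local Notation wug := (weak_upper_gradient nu p).

Lemma upper_gradient_weak u g : upper_gradient u g -> wug u g.
Proof.
move=> [bg h]; apply/(weak_upper_gradientP _ p0); split => //.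
exists (cst 0%E); split; [exact: borel_nonneg0|exact: p_integrable0|].
by move=> c hc _; exact: h.
Qed.

Lemma curve_integral_sub_lty rho c a b : is_curve c -> borel_nonneg rho ->
  0 <= a -> a <= b -> b <= c.1 -> (curve_integral c rho < +oo)%E ->
  (curve_integral (subcurve c a b) rho < +oo)%E.
Proof.
move=> hc [mr r0] a0 ab bl; apply: le_lt_trans.
rewrite curve_integral_sub// curve_integralE//.
apply: ge0_subset_integral => //; first exact: measurable_along.
by move=> t /=; rewrite !in_itv/= => /andP[at_ tb]; rewrite (le_trans a0)//= (le_trans tb).
Qed.

Lemma gradient_inequality_sub u g rho c a b : is_curve c -> borel_nonneg g ->
  borel_nonneg rho ->
  (forall c, is_curve c -> (curve_integral c rho < +oo)%E -> gradient_inequality u g c) ->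
  (curve_integral c rho < +oo)%E -> 0 <= a -> a <= b -> b <= c.1 ->
  (`|u (extended_curve c b) - u (extended_curve c a)|%:E <=
   \int[leb]_(t in `[a, b]%classic) g (extended_curve c t))%E.
Proof.
move=> hc [mg g0] brho h cfin a0 ab bl.
have := h _ (is_curve_sub hc a0 ab bl) (curve_integral_sub_lty hc brho a0 ab bl cfin).
rewrite /gradient_inequality /= curve_integral_sub//.
rewrite addr0 (_ : a + (b - a) = b); last by ring.
rewrite !extended_curveE// in_itv/= ?a0 ?(le_trans ab)//.
by rewrite (le_trans a0 ab).
Qed.

Lemma gradient_inequality_extended u g c : is_curve c ->
  gradient_inequality u g c <-> (`|u (extended_curve c c.1) - u (extended_curve c 0)|%:E <=
   \int[leb]_(t in `[0%R, c.1]%classic) g (extended_curve c t))%E.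
Proof.
move=> hc; have l0 := hc.1.
by rewrite /gradient_inequality curve_integralE// !extended_curveE// in_itv/= ?lexx ?l0.
Qed.

(** Restricting a curve to subintervals gives increment bounds for u along the
    curve by the integrals of g and of h, which increment_min combines. *)
Lemma weak_upper_gradient_min u g h : p_integrable nu p g -> p_integrable nu p h ->
  wug u g -> wug u h -> wug u (fun x => Order.min (g x) (h x)).
Proof.
move=> ig ih /(weak_upper_gradientP _ p0)[bg [rg [brg irg hg]]].
move=> /(weak_upper_gradientP _ p0)[bh [rh [brh irh hh]]].
apply/(weak_upper_gradientP _ p0); split; first exact: borel_nonneg_min.
exists (fun x => (rg x + rh x) + (g x + h x))%E; split.
- by do !apply: borel_nonnegD.
- by do !(apply: p_integrableD => //); do ?apply: borel_nonnegD.
move=> c hc cfin.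
have part r : borel_nonneg r -> (forall x, r x <= (rg x + rh x) + (g x + h x))%E ->
    (curve_integral c r < +oo)%E.
  move=> br hr; apply: (finite_along hc br _ ltr01 _ cfin).
    by do !apply: borel_nonnegD.
  by move=> x; rewrite mul1e.
have [[[mg g0] [mh h0]] [[_ rg0] [_ rh0]]] := ((bg, bh), (brg, brh)).
apply/gradient_inequality_extended => //.
apply: (@increment_min R (fun t => u (extended_curve c t))
  (fun t => g (extended_curve c t)) (fun t => h (extended_curve c t))) => //.
- exact: hc.1.
- exact: measurable_along.
- exact: measurable_along.
- rewrite -curve_integralE//; apply: part => // x.
  by rewrite -[leLHS]add0e leeD ?adde_ge0// leeDl.
- rewrite -curve_integralE//; apply: part => // x.
  by rewrite -[leLHS]add0e leeD ?adde_ge0// leeDr.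
- move=> a b; apply: (gradient_inequality_sub hc bg brg hg); apply: part => // x.
  by rewrite -[leLHS]adde0 leeD ?adde_ge0// leeDl.
- move=> a b; apply: (gradient_inequality_sub hc bh brh hh); apply: part => // x.
  by rewrite -[leLHS]adde0 leeD ?adde_ge0// leeDr.
Qed.

Lemma gradient_inequalityD u v g h c : is_curve c -> borel_nonneg g -> borel_nonneg h ->
  gradient_inequality u g c -> gradient_inequality v h c ->
  gradient_inequality (u \+ v) (fun x => g x + h x)%E c.
Proof.
move=> hc [mg g0] [mh h0] hg hh; rewrite /gradient_inequality curve_integralD//.
apply: le_trans (leeD hg hh); rewrite -EFinD lee_fin /=.
by apply: le_trans (ler_normD _ _); rewrite opprD addrACA.
Qed.

Lemma gradient_inequalityZ (k : R) u g c : is_curve c -> borel_nonneg g ->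
  gradient_inequality u g c ->
  gradient_inequality (fun x => k * u x) (fun x => `|k|%:E * g x)%E c.
Proof.
move=> hc [mg g0] hg; rewrite /gradient_inequality curve_integralZ//.
by rewrite -mulrBr normrM EFinM; apply: lee_wpmul2l.
Qed.

Lemma weak_upper_gradientD u v g h : wug u g -> wug v h ->
  wug (u \+ v) (fun x => g x + h x)%E.
Proof.
move=> /(weak_upper_gradientP _ p0)[bg [rg [brg irg hg]]].
move=> /(weak_upper_gradientP _ p0)[bh [rh [brh irh hh]]].
apply/(weak_upper_gradientP _ p0); split; first exact: borel_nonnegD.
exists (fun x => (rg x + rh x))%E; split.
- exact: borel_nonnegD.
- exact: p_integrableD.
move=> c hc cfin; have [[_ rg0] [_ rh0]] := (brg, brh).
apply: gradient_inequalityD => //.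
  apply: hg => //; apply: (finite_along hc brg _ ltr01 _ cfin).
    exact: borel_nonnegD.
  by move=> x; rewrite mul1e leeDl.
apply: hh => //; apply: (finite_along hc brh _ ltr01 _ cfin).
  exact: borel_nonnegD.
by move=> x; rewrite mul1e leeDr.
Qed.

Lemma weak_upper_gradientZ (k : R) u g : wug u g ->
  wug (fun x => k * u x) (fun x => `|k|%:E * g x)%E.
Proof.
move=> /(weak_upper_gradientP _ p0)[bg [rg [brg irg hg]]].
apply/(weak_upper_gradientP _ p0); split; first exact: borel_nonneg_scale.
exists rg; split => // c hc cfin.
by apply: gradient_inequalityZ => //; exact: hg.
Qed.

(** The function equal to +oo on N and to 0 elsewhere is p-integrable; its integral
    along a curve is finite only if the curve is in N for a null set of times. *)
Lemma null_set_along (N : set (borel X)) : measurable N -> nu N = 0%E ->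
  exists rho, [/\ borel_nonneg rho, p_integrable nu p rho &
    forall c, is_curve c -> (curve_integral c rho < +oo)%E ->
      \forall t \ae leb, t \in `[0, c.1] -> ~ N (extended_curve c t)].
Proof.
move=> mN N0; pose rho : borel X -> \bar R := (cst +oo%E) \_ N.
have mrho : measurable_fun setT rho.
  by apply/(measurable_restrictT _ mN); exact: measurable_cst.
have rho0 x : (0 <= rho x)%E by rewrite /rho patchE; case: ifP => _ //=; rewrite leey.
have brho : borel_nonneg rho by [].
exists rho; split => //.
  rewrite /p_integrable (_ : (\int[nu]_x (rho x `^ p))%E = 0%E) ?ltry//.
  have -> : (fun x => rho x `^ p)%E = (cst +oo%E) \_ N.
    apply/funext => x; rewrite /rho !patchE; case: ifP => _ /=.
      by rewrite gt_eqF.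
    by rewrite powR0 ?gt_eqF.
  by rewrite -integral_mkcond null_set_integral.
move=> c hc; rewrite curve_integralE// => cfin.
pose D := `[0%R, c.1]%classic : set (measurableTypeR R).
have mrc : measurable_fun D (fun t => rho (extended_curve c t)).
  exact: measurable_along.
have : leb.-integrable D (fun t => rho (extended_curve c t)).
  by apply/integrableP; split => //; under eq_integral do rewrite gee0_abs//.
have mD : measurable D by exact: measurable_itv.
move/(integrable_ae mD); apply: filterS => t h tD Nt.
by have := h tD; rewrite /rho patchE mem_set.
Qed.

(** Along almost every curve, g <= h at almost every time, by null_set_along. *)
Lemma weak_upper_gradient_ae u g h : borel_nonneg h ->
  (\forall x \ae nu, (g x <= h x)%E) -> wug u g -> wug u h.
Proof.
move=> bh /ae_false_null[N [mN N0 gh]] /(weak_upper_gradientP _ p0)[bg [rg [brg irg hg]]].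
have [rN [brN irN hN]] := null_set_along mN N0.
apply/(weak_upper_gradientP _ p0); split => //.
exists (fun x => (rg x + rN x))%E; split.
- exact: borel_nonnegD.
- exact: p_integrableD.
move=> c hc cfin; have [[_ rg0] [_ rN0]] := (brg, brN).
have c1 : (curve_integral c rg < +oo)%E.
  apply: (finite_along hc brg _ ltr01 _ cfin); first exact: borel_nonnegD.
  by move=> x; rewrite mul1e leeDl.
have c2 : (curve_integral c rN < +oo)%E.
  apply: (finite_along hc brN _ ltr01 _ cfin); first exact: borel_nonnegD.
  by move=> x; rewrite mul1e leeDr.
apply: (le_trans (hg c hc c1)); rewrite !curve_integralE//.
have [[mg g0] [mh h0]] := (bg, bh).
apply: ae_ge0_le_integral => //.
- exact: measurable_along.
- exact: measurable_along.
- by apply: ae_lebesgue_imply (hN c hc c2) => t ht tl; apply: gh; exact: ht.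
Qed.

(** Along almost every curve, u vanishes at almost every time, by null_set_along, and
    is continuous, by the gradient inequality on subcurves. *)
Lemma weak_upper_gradient_null u g : p_integrable nu p g -> wug u g ->
  (\forall x \ae nu, u x = 0) -> wug u (cst 0%E).
Proof.
move=> ig /(weak_upper_gradientP _ p0)[bg [rg [brg irg hg]]].
move=> /ae_false_null[N [mN N0 uN]].
have [rN [brN irN hN]] := null_set_along mN N0.
apply/(weak_upper_gradientP _ p0); split; first exact: borel_nonneg0.
exists (fun x => (rg x + (g x + rN x)))%E; split.
- by do !apply: borel_nonnegD.
- by do !(apply: p_integrableD => //); do ?apply: borel_nonnegD.
move=> c hc cfin; have [[_ rg0] [_ rN0] [mg g0]] := And3 brg brN bg.
have part r : borel_nonneg r -> (forall x, r x <= rg x + (g x + rN x))%E ->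
    (curve_integral c r < +oo)%E.
  move=> br hr; apply: (finite_along hc br _ ltr01 _ cfin).
    by do !apply: borel_nonnegD.
  by move=> x; rewrite mul1e.
have c1 : (curve_integral c rg < +oo)%E by apply: part => // x; rewrite leeDl ?adde_ge0.
have c2 : (curve_integral c g < +oo)%E.
  by apply: part => // x; rewrite -[leLHS]add0e leeD// leeDl.
have c3 : (curve_integral c rN < +oo)%E.
  by apply: part => // x; rewrite -[leLHS]add0e leeD// leeDr.
have l0 := hc.1.
have incr := gradient_inequality_sub hc bg brg hg c1.
have [l00|l_gt0] := eqVneq c.1 0.
  apply/gradient_inequality_extended => //; rewrite l00 subrr normr0.
  exact: integral_ge0.
suff u0 t : 0 <= t -> t <= c.1 -> u (extended_curve c t) = 0.
  apply/gradient_inequality_extended => //; rewrite !u0// subrr normr0.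
  exact: integral_ge0.
move=> t0 tl.
  apply/eqP; rewrite -normr_le0; apply/ler_addgt0Pl => e e0; rewrite addr0.
  have mgc : measurable_fun setT (fun t => g (extended_curve c t)).
    exact: measurable_along.
  have gcfin : (\int[leb]_(t in `[0%R, c.1]%classic) g (extended_curve c t) < +oo)%E.
    by rewrite -curve_integralE.
  have [r r0 hr] := integral_small_sets mgc (fun t => g0 _) gcfin e0.
  have lp : 0 < c.1 by rewrite lt_neqAle eq_sym l_gt0.
  have [a [b [a0 at_ tb bl [abr ab0]]]] := short_interval lp t0 tl r0.
  have ab := ltW ab0.
  have [s sab Ns] : exists2 s, s \in `[a, b] & ~ N (extended_curve c s).
    apply: contrapT => /forall2NP nN.
    have [M [mM M0 hM]] := hN c hc c3.
    have abM : `[a, b]%classic `<=` M.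
      move=> s /= sab; apply: hM => /= /(_ _)/wrap[].
        move: sab; rewrite !in_itv/= => /andP[as_ sb].
        by rewrite (le_trans a0)//= (le_trans sb).
      by case: (nN s).
    have : (leb `[a, b]%classic <= leb M)%E by apply: le_measure; rewrite ?inE.
    by rewrite M0 lebesgue_measure_itv/= lte_fin ab0 -EFinD lee_fin leNgt subr_gt0 ab0.
  have us : u (extended_curve c s) = 0 by exact: uN.
  have small a' b' : a <= a' -> a' <= b' -> b' <= b ->
      `|u (extended_curve c b') - u (extended_curve c a')| <= e.
    move=> aa' a'b' b'b; rewrite -lee_fin.
    apply: (le_trans (incr a' b' (le_trans a0 aa') a'b' (le_trans b'b bl))).
    have := hr `[a', b']%classic; move=> /(_ _)/wrap[]; first exact: measurable_itv.
    move=> /(_ _)/wrap[].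
      rewrite lebesgue_measure_itv/=; case: ifP => _; last by rewrite lte_fin.
      by rewrite -EFinD lte_fin; lra.
    apply: le_trans; rewrite (_ : _ `&` _ = `[a', b']%classic)//.
    apply/setIidPr => z /=; rewrite !in_itv/= => /andP[z1 z2].
    by apply/andP; split; lra.
  move: sab; rewrite in_itv/= => /andP[as_ sb].
  have [ts|st] := leP t s.
    by have := small _ _ at_ ts sb; rewrite us sub0r normrN.
  by have := small _ _ as_ (ltW st) tb; rewrite us subr0.
Qed.

End weak_upper_gradients.

(** * Minimal weak upper gradients *)

Section minimal_weak_upper_gradients.
Context {R : realType} {X : completeMetricType R}.
Variable nu : {measure set (borel X) -> \bar R}.
Variable p : R.
Hypothesis p0 : 0 < p.
Implicit Types (u v : borel X -> R) (g h rho : borel X -> \bar R) (c : @curve R X).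
Local Notation leb := (@lebesgue_measure R).
Local Notation wug := (weak_upper_gradient nu p).
Local Notation pint := (p_integrable nu p).

(** Dominated convergence along the curves on which g 0 has a finite integral. *)
Lemma weak_upper_gradient_inf u (g : nat -> borel X -> \bar R) :
  (forall x, nonincreasing_seq (g ^~ x)) -> pint (g 0%N) ->
  (forall n, wug u (g n)) -> wug u (fun x => ereal_inf (range (g ^~ x))).
Proof.
move=> dg ig0 wg.
have bg n : borel_nonneg (g n) by case: (wg n).
pose gi : borel X -> \bar R := fun x => ereal_inf (range (g ^~ x)).
have binf : borel_nonneg gi.
  split; last by move=> x; apply: le_ereal_inf_tmp => _ [n _ <-]; case: (bg n).
  have -> : gi = (fun x => einfs (g ^~ x) 0%N).
    by apply/funext => x; rewrite /gi /einfs /sdrop; congr ereal_inf;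
      apply/seteqP; split => _ [n _ <-]; exists n.
  by apply: measurable_fun_einfs => n; case: (bg n).
apply/(weak_upper_gradientP _ p0); split => //.
have /choice[rho hrho] : forall n, exists rho, [/\ borel_nonneg rho, pint rho &
    forall c, is_curve c -> (curve_integral c rho < +oo)%E ->
      gradient_inequality u (g n) c].
  by move=> n; have /(weak_upper_gradientP _ p0)[] := wg n.
have [||sigma [bs is_ hs]] := @countable_majorant _ _ nu p p0 rho.
- by move=> n; case: (hrho n).
- by move=> n; case: (hrho n).
exists (fun x => sigma x + g 0%N x)%E; split.
- exact: borel_nonnegD.
- exact: p_integrableD.
move=> c hc cfin; have [[ms s0] [mg0 g00]] := (bs, bg 0%N).
have c1 : (curve_integral c sigma < +oo)%E.
  apply: (finite_along hc bs _ ltr01 _ cfin); first exact: borel_nonnegD.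
  by move=> x; rewrite mul1e leeDl.
have c2 : (curve_integral c (g 0%N) < +oo)%E.
  apply: (finite_along hc (bg 0%N) _ ltr01 _ cfin); first exact: borel_nonnegD.
  by move=> x; rewrite mul1e leeDr.
have ineq n : gradient_inequality u (g n) c.
  have [br _ h] := hrho n; apply: h => //; have [k k0 hk] := hs n.
  exact: (finite_along hc br bs k0 hk).
pose D := `[0%R, c.1]%classic : set (measurableTypeR R).
have mD : measurable D by exact: measurable_itv.
have mgc n : measurable_fun D (fun t => g n (extended_curve c t)).
  by apply: measurable_along => //; case: (bg n).
have : (\int[leb]_(t in D) g n (extended_curve c t))%E @[n --> \oo] -->
    (\int[leb]_(t in D) gi (extended_curve c t))%E.
  have mi : measurable_fun D (fun t => gi (extended_curve c t)).
    by apply: (measurable_along hc (g := gi)); case: binf.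
  have [] // := @dominated_convergence _ _ _ lebesgue_measure D mD
    (fun n t => g n (extended_curve c t)) _ (fun t => g 0%N (extended_curve c t)) mgc mi.
  - apply: aeW => t _; exact: (ereal_nonincreasing_cvgn (dg (extended_curve c t))).
  - apply/integrableP; split; first exact: mgc.
    under eq_integral do rewrite gee0_abs//.
    by rewrite -curve_integralE.
  - apply: aeW => t n _; rewrite gee0_abs; last by case: (bg n).
    exact: (dg (extended_curve c t)).
rewrite -curve_integralE// => cv; rewrite /gradient_inequality -(cvg_lim _ cv)//.
apply: lime_ge; first by apply/cvg_ex; eexists; exact: cv.
by apply: nearW => n; have := ineq n; rewrite /gradient_inequality curve_integralE.
Qed.

(** Running minima of a sequence which minimizes the p-energy decrease to a weak
    upper gradient of least p-energy; the minimum with any other one has the same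
    energy, hence is equal to it a.e. *)
Lemma minimal_weak_upper_gradient_exists u : (exists2 g, wug u g & pint g) ->
  exists g, minimal_weak_upper_gradient nu p u g.
Proof.
move=> [g1 wg1 ig1].
pose En g := (\int[nu]_x (g x `^ p))%E.
have En0 g : (0 <= En g)%E by apply: integral_ge0 => x _; exact: poweR_ge0.
pose B := [set En g | g in [set g | wug u g /\ pint g]].
pose m := ereal_inf B.
have m0 : (0 <= m)%E by apply: le_ereal_inf_tmp => _ [g _ <-].
have mB g : wug u g -> pint g -> (m <= En g)%E.
  by move=> wg ig; apply: ereal_inf_lbound; exists g.
have mfin : m \is a fin_num by rewrite ge0_fin_numE// (le_lt_trans (mB _ wg1 ig1)).
have /choice[f hf] : forall n : nat, exists g, [/\ wug u g, pint g &
    (En g < m + (n.+1%:R^-1)%:E)%E].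
  move=> n; have n0 : (0 : R) < n.+1%:R^-1 by [].
  by have [_ [g [wg ig] <-] h] := lb_ereal_inf_adherent n0 mfin; exists g.
pose G := fix G n := if n is n'.+1 then (fun x => Order.min (G n' x) (f n x)) else f 0%N.
have GP n : wug u (G n) /\ pint (G n).
  elim: n => [|n [wG iG]]; first by case: (hf 0%N).
  have [wf if_ _] := hf n.+1; split; first exact: weak_upper_gradient_min.
  apply: le_p_integrable iG => //=.
  - by apply: borel_nonneg_min; [case: wG|case: wf].
  - by case: wG.
  - by move=> x; rewrite ge_min lexx.
have dG x : nonincreasing_seq (G ^~ x).
  by apply/nonincreasing_seqP => n /=; rewrite ge_min lexx.
have Gf n x : (G n x <= f n x)%E by case: n => [//|n] /=; rewrite ge_min lexx orbT.
pose g x := ereal_inf (range (G ^~ x)).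
have wg : wug u g by apply: weak_upper_gradient_inf => //; [case: (GP 0%N)|move=> n; case: (GP n)].
have bg : borel_nonneg g by case: wg.
have gG n x : (g x <= G n x)%E by apply: ereal_inf_lbound; exists n.
have ig : pint g.
  have [wG0 iG0] := GP 0%N.
  by apply: (le_p_integrable p0 bg _ (gG 0%N)) => //; case: wG0.
have leEn h k : borel_nonneg h -> borel_nonneg k -> (forall x, h x <= k x)%E ->
    (En h <= En k)%E.
  move=> [mh h0] [mk k0] hk; apply: ge0_le_integral => //.
  - by move=> x _; exact: poweR_ge0.
  - exact: measurable_epow.
  - exact: measurable_epow.
  - by move=> x _; apply: lee_pow => //; exact: ltW.
have Engm : En g = m.
  apply/eqP; rewrite eq_le mB// andbT; apply/lee_addgt0Pr => e e0.
  have [n hn] := natSinv_lt e0; have [wf _ h] := hf n.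
  apply: (@le_trans _ _ (En (f n))).
    apply: leEn => //; first by case: wf.
    by move=> x; apply: le_trans (gG n x) (Gf n x).
  by apply: (le_trans (ltW h)); rewrite leeD2l// lee_fin ltW.
exists g; split => // h wh ih.
have wk := weak_upper_gradient_min p0 ig ih wg wh.
set k := (fun x => Order.min _ _) in wk.
have bk : borel_nonneg k by case: wk.
have kg x : (k x <= g x)%E by rewrite ge_min lexx.
have ik : pint k by apply: (le_p_integrable p0 bk bg).
have : \forall x \ae nu, (k x `^ p = g x `^ p)%E.
  have [[mk k0] [mg g0]] := (bk, bg).
  apply: ge0_le_integral_ae_eq => //.
  - exact: measurable_epow.
  - exact: measurable_epow.
  - by move=> x; exact: poweR_ge0.
  - by move=> x; apply: lee_pow => //; exact: ltW.
  - by rewrite -/(En g) Engm; exact: mB.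
apply: filterS => x kgx.
have gk : (g x <= k x)%E.
  apply: (lee_powK p0); [by case: bg|by case: bk|by rewrite kgx].
by apply: (le_trans gk); rewrite ge_min lexx orbT.
Qed.

Local Notation gn := (grad_norm nu p).

Lemma D1p_minimal u : D1p nu p u ->
  minimal_weak_upper_gradient nu p u
    (xget (cst 0%E) [set g | minimal_weak_upper_gradient nu p u g]).
Proof.
move=> [_ [g ug ig]]; case: xgetP => // h.
have [|k hk] := @minimal_weak_upper_gradient_exists u.
  by exists g => //; exact: upper_gradient_weak.
by have := h k.
Qed.

Lemma grad_norm_ge0 u x : 0 <= gn u x.
Proof.
rewrite /grad_norm; case: xgetP => [g _ [[[_ g0] _] _ _]|_] //=.
by rewrite fine_ge0.
Qed.

Lemma measurable_grad_norm u : measurable_fun setT (gn u).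
Proof.
rewrite /grad_norm; case: xgetP => [g _ [[[mg _] _] _ _]|_] //=.
exact: measurableT_comp.
Qed.

Lemma p_integrable_ae_fin g : borel_nonneg g -> pint g ->
  \forall x \ae nu, g x \is a fin_num.
Proof.
move=> [mg g0] ig.
have : nu.-integrable setT (fun x => g x `^ p)%E.
  apply/integrableP; split; first exact: measurable_epow.
  by under eq_integral do rewrite gee0_abs ?poweR_ge0//.
move/(integrable_ae measurableT); apply: filterS => x /(_ I).
have := g0 x; case: (g x) => // _.
by rewrite /= gt_eqF.
Qed.

Lemma grad_normP u : D1p nu p u -> [/\ wug u (EFin \o gn u), pint (EFin \o gn u) &
  forall h, wug u h -> pint h -> \forall x \ae nu, ((gn u x)%:E <= h x)%E].
Proof.
move=> /D1p_minimal; rewrite /grad_norm; set g := xget _ _ => -[wg ig gmin].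
have bg : borel_nonneg g by case: wg.
have gfin := p_integrable_ae_fin bg ig.
have bfg : borel_nonneg (EFin \o (fun x => fine (g x))).
  case: bg => mg g0; split.
    by apply/measurable_EFinP; exact: measurableT_comp.
  by move=> x /=; rewrite lee_fin fine_ge0.
split.
- apply: weak_upper_gradient_ae wg => //.
  by apply: filterS gfin => x gx /=; rewrite fineK.
- apply: (le_p_integrable p0 bfg bg) ig => x /=.
  by case: bg => _ /(_ x); case: (g x).
- move=> h wh ih; apply: filterS2 gfin (gmin h wh ih) => x gx.
  by rewrite fineK.
Qed.

Lemma grad_norm_le u h : D1p nu p u -> wug u h -> pint h ->
  \forall x \ae nu, ((gn u x)%:E <= h x)%E.
Proof. by move=> /grad_normP[_ _]; exact. Qed.

Lemma power_integral_grad_norm u : D1p nu p u ->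
  (power_integral nu p (gn u) < +oo)%E.
Proof.
move=> /grad_normP[_ h _].
have -> // : power_integral nu p (gn u) = (\int[nu]_x ((EFin \o gn u) x `^ p))%E.
by apply: eq_integral => x _ /=; rewrite ger0_norm// grad_norm_ge0.
Qed.

Lemma grad_norm_Lfun u : D1p nu p u -> gn u \in Lfun nu p%:E.
Proof.
move=> Du; apply/(Lfun_powerP _ _ p0); split; first exact: measurable_grad_norm.
exact: power_integral_grad_norm.
Qed.

Lemma D1pD u v : D1p nu p u -> D1p nu p v -> D1p nu p (u \+ v).
Proof.
move=> [mu [g [bg ug] ig]] [mv [h [bh uh] ih]]; split; first exact: measurable_funD.
exists (fun x => g x + h x)%E; last exact: p_integrableD.
split; first exact: borel_nonnegD.
by move=> c hc; apply: gradient_inequalityD => //; [exact: ug|exact: uh].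
Qed.

Lemma D1pZ (k : R) u : D1p nu p u -> D1p nu p (fun x => k * u x).
Proof.
move=> [mu [g [bg ug] ig]]; split; first exact: measurable_funM.
exists (fun x => `|k|%:E * g x)%E; last exact: p_integrable_scale.
split; first exact: borel_nonneg_scale.
by move=> c hc; apply: gradient_inequalityZ => //; exact: ug.
Qed.

Lemma D1p0 : D1p nu p (cst 0).
Proof.
split => //; exists (cst 0%E); last exact: p_integrable0.
split; first exact: borel_nonneg0.
move=> c hc; rewrite /gradient_inequality subrr normr0.
exact: integral_ge0.
Qed.

Lemma D1pB u v : D1p nu p u -> D1p nu p v -> D1p nu p (u \- v).
Proof.
move=> Du Dv; have := D1pD Du (D1pZ (-1) Dv).
by congr (D1p _ _ _); apply/funext => x /=; rewrite mulN1r.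
Qed.

Lemma grad_normD u v : D1p nu p u -> D1p nu p v ->
  \forall x \ae nu, gn (u \+ v) x <= gn u x + gn v x.
Proof.
move=> Du Dv; have [wu iu _] := grad_normP Du; have [wv iv _] := grad_normP Dv.
have [bu bv] : borel_nonneg (EFin \o gn u) /\ borel_nonneg (EFin \o gn v).
  by split; [case: wu|case: wv].
apply: (grad_norm_le (D1pD Du Dv) (weak_upper_gradientD p0 wu wv)).
exact: p_integrableD.
Qed.

Lemma grad_normZ_le (k : R) u : D1p nu p u ->
  \forall x \ae nu, gn (fun x => k * u x) x <= `|k| * gn u x.
Proof.
move=> Du; have [wu iu _] := grad_normP Du.
have bu : borel_nonneg (EFin \o gn u) by case: wu.
have := grad_norm_le (D1pZ k Du) (weak_upper_gradientZ p0 k wu)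
  (p_integrable_scale (normr_ge0 k) bu iu).
by apply: filterS => x /=; rewrite -EFinM lee_fin.
Qed.

Lemma grad_normZ (k : R) u : D1p nu p u ->
  \forall x \ae nu, gn (fun x => k * u x) x = `|k| * gn u x.
Proof.
move=> Du; have [->|k0] := eqVneq k 0.
  have := grad_normZ_le 0 Du; apply: filterS => x.
  rewrite normr0 mul0r => h; apply/eqP; rewrite eq_le h grad_norm_ge0//.
have := grad_normZ_le k^-1 (D1pZ k Du).
have -> : (fun x => k^-1 * (k * u x)) = u.
  by apply/funext => x; rewrite mulKf.
move=> h1; apply: filterS2 (grad_normZ_le k Du) h1 => x h2 h1.
apply/eqP; rewrite eq_le h2/= -ler_pdivlMl ?normr_gt0//.
by rewrite -normfV.
Qed.

Lemma grad_norm_null u : D1p nu p u -> (\forall x \ae nu, u x = 0) ->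
  \forall x \ae nu, gn u x = 0.
Proof.
move=> Du u0; have [wu iu _] := grad_normP Du.
have := grad_norm_le Du (weak_upper_gradient_null p0 iu wu u0) (p_integrable0 nu p0).
apply: filterS => x /=; rewrite lee_fin => h.
by apply/eqP; rewrite eq_le h grad_norm_ge0.
Qed.

(** The difference vanishes a.e., so its minimal weak upper gradient is 0. *)
Lemma grad_norm_ae_eq u v : D1p nu p u -> D1p nu p v ->
  (\forall x \ae nu, u x = v x) -> \forall x \ae nu, gn u x = gn v x.
Proof.
have half u' v' : D1p nu p u' -> D1p nu p v' -> (\forall x \ae nu, u' x = v' x) ->
    \forall x \ae nu, gn u' x <= gn v' x.
  move=> Du Dv uv; have Dw := D1pB Du Dv.
  have w0 : \forall x \ae nu, gn (u' \- v') x = 0.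
    by apply: grad_norm_null => //; apply: filterS uv => x /= ->; rewrite subrr.
  have := grad_normD Dv Dw.
  have -> : (v' \+ (u' \- v')) = u' by apply/funext => x /=; lra.
  by apply: filterS2 w0 => x ->; rewrite addr0.
move=> Du Dv uv; have vu : \forall x \ae nu, v x = u x by apply: filterS uv.
apply: filterS2 (half _ _ Du Dv uv) (half _ _ Dv Du vu) => x h1 h2.
by apply: le_anti; rewrite h1 h2.
Qed.

End minimal_weak_upper_gradients.

(** * Simple sections of the cotangent module *)

Section simple_sections.
Context {R : realType} {X : completeMetricType R}.
Variable nu : {measure set (borel X) -> \bar R}.
Variable p : R.
Hypothesis p1 : 1 <= p.
Let p0 : 0 < p. Proof. exact: lt_le_trans p1. Qed.
Implicit Types (u v : borel X -> R) (o : borel X -> borel X -> R) (w z : @precot R X).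
Local Notation gn := (grad_norm nu p).

(** A family {(f_i, A_i)} is encoded by the map sending a point x of A_i to the
    function f_i. Sums, differences and products by step functions of families
    become pointwise operations in the vector space of all such maps. *)
Definition section_of w : borel X -> borel X -> R := fun x => pc_fun w (pc_index w x).

Definition section_norm o (x : borel X) : R := gn (o x) x.

Definition countably_valued o := exists (f : nat -> borel X -> R) (k : borel X -> nat),
  [/\ forall i, D1p nu p (f i), forall i, measurable (k @^-1` [set i]) &
      forall x, o x = f (k x)].

Definition simple_section o :=
  countably_valued o /\ section_norm o \in Lfun nu p%:E.

Lemma countably_valuedW (I : countType) (f : I -> borel X -> R) (k : borel X -> I) o :
  (forall i, D1p nu p (f i)) -> (forall i, measurable (k @^-1` [set i])) ->
  (forall x, o x = f (k x)) -> countably_valued o.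
Proof.
move=> Df mk ok.
exists (fun n => if unpickle n is Some i then f i else cst 0), (fun x => pickle (k x)).
split.
- by move=> n; case: (@unpickle I _) => // ; exact: D1p0.
- move=> n; case E : (@unpickle I n) => [i|].
    have [En|En] := eqVneq (pickle i) n.
      have -> : (fun x => pickle (k x)) @^-1` [set n] = k @^-1` [set i]; last exact: mk.
      apply/seteqP; split => x /=; rewrite -En; last by move=> ->.
      by move/(congr1 (@unpickle I)); rewrite !pickleK => -[].
    have -> : (fun x => pickle (k x)) @^-1` [set n] = set0; last exact: measurable0.
    apply/seteqP; split => // x /= h; move: E; rewrite -h pickleK => -[ki].
    by move: En; rewrite -ki h eqxx.
  have -> : (fun x => pickle (k x)) @^-1` [set n] = set0; last exact: measurable0.
  by apply/seteqP; split => // x /= h; move: E; rewrite -h pickleK.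
- by move=> x; rewrite pickleK.
Qed.

Lemma countably_valued_cst u : D1p nu p u -> countably_valued (fun=> u).
Proof.
move=> Du; apply: (@countably_valuedW unit (fun=> u) (fun=> tt)) => //.
by move=> []; rewrite preimage_cst; case: ifP.
Qed.

Lemma countably_valued_map2 (op : (borel X -> R) -> (borel X -> R) -> borel X -> R) o1 o2 :
  (forall u v, D1p nu p u -> D1p nu p v -> D1p nu p (op u v)) ->
  countably_valued o1 -> countably_valued o2 -> countably_valued (fun x => op (o1 x) (o2 x)).
Proof.
move=> hop [f [k [Df mk ok]]] [g [l [Dg ml ol]]].
apply: (@countably_valuedW (nat * nat)%type (fun ij => op (f ij.1) (g ij.2))
  (fun x => (k x, l x))) => [ij|[i j]|x].
- exact: hop.
- have -> : (fun x => (k x, l x)) @^-1` [set (i, j)] = k @^-1` [set i] `&` l @^-1` [set j].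
    by apply/seteqP; split => x /=; [move=> [-> ->]|move=> [-> ->]].
  exact: measurableI.
- by rewrite /= ok ol.
Qed.

Lemma countably_valued_scale (I : countType) (c : I -> R) (j : borel X -> I) o :
  (forall i, measurable (j @^-1` [set i])) -> countably_valued o ->
  countably_valued (fun x y => c (j x) * o x y).
Proof.
move=> mj [f [k [Df mk ok]]].
apply: (@countably_valuedW (I * nat)%type (fun ij y => c ij.1 * f ij.2 y)
  (fun x => (j x, k x))) => [ij|[i l]|x].
- exact: D1pZ.
- have -> : (fun x => (j x, k x)) @^-1` [set (i, l)] = j @^-1` [set i] `&` k @^-1` [set l].
    by apply/seteqP; split => x /=; [move=> [-> ->]|move=> [-> ->]].
  exact: measurableI.
- by rewrite /= ok.
Qed.

Lemma countably_valued_ae o (Q : (borel X -> R) -> borel X -> Prop) :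
  countably_valued o -> (forall u, D1p nu p u -> \forall x \ae nu, Q u x) ->
  \forall x \ae nu, Q (o x) x.
Proof.
move=> [f [k [Df mk ok]]] hQ.
have : \forall x \ae nu, forall i, Q (f i) x by apply/ae_foralln => i; exact: hQ.
by apply: filterS => x h; rewrite ok.
Qed.

Lemma countably_valued_ae2 o1 o2 (Q : (borel X -> R) -> (borel X -> R) -> borel X -> Prop) :
  countably_valued o1 -> countably_valued o2 ->
  (forall u v, D1p nu p u -> D1p nu p v -> \forall x \ae nu, Q u v x) ->
  \forall x \ae nu, Q (o1 x) (o2 x) x.
Proof.
move=> co1 [f [k [Df mk ok]]] hQ.
have : \forall x \ae nu, forall i, Q (o1 x) (f i) x.
  apply/ae_foralln => i; apply: (@countably_valued_ae o1 (fun u => Q u (f i))) => // u Du.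
  exact: hQ.
by apply: filterS => x h; rewrite ok.
Qed.

Lemma measurable_section_norm o : countably_valued o -> measurable_fun setT (section_norm o).
Proof.
move=> [f [k [Df mk ok]]].
have -> : [set: borel X] = \bigcup_i (k @^-1` [set i]).
  by apply/seteqP; split => // x _; exists (k x).
apply/measurable_fun_bigcup => // i.
apply: (eq_measurable_fun (gn (f i))).
  by move=> x /[!inE] /= <-; rewrite /section_norm ok.
by apply: measurable_funTS; exact: measurable_grad_norm.
Qed.

Lemma section_norm_ge0 o x : 0 <= section_norm o x.
Proof. exact: grad_norm_ge0. Qed.

Lemma section_normD o1 o2 : countably_valued o1 -> countably_valued o2 ->
  \forall x \ae nu, section_norm (fun x => o1 x \+ o2 x) x <=
    section_norm o1 x + section_norm o2 x.
Proof.
move=> c1 c2.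
apply: (@countably_valued_ae2 o1 o2 (fun u v x => gn (u \+ v) x <= gn u x + gn v x)) => //.
by move=> u v Du Dv; exact: grad_normD.
Qed.

Lemma section_normZ (I : countType) (c : I -> R) (j : borel X -> I) o : countably_valued o ->
  \forall x \ae nu, section_norm (fun x y => c (j x) * o x y) x =
    `|c (j x)| * section_norm o x.
Proof.
move=> co.
have : \forall x \ae nu, forall n, if unpickle n is Some i then
    gn (fun y => c i * o x y) x = `|c i| * gn (o x) x else True.
  apply/ae_foralln => n; case: (@unpickle I _) => [i|]; last by apply: aeW.
  apply: (@countably_valued_ae o (fun u x => gn (fun y => c i * u y) x = `|c i| * gn u x)) => //.
  by move=> u Du; exact: grad_normZ.
by apply: filterS => x /(_ (pickle (j x))); rewrite pickleK.
Qed.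

Lemma countably_valuedD o1 o2 : countably_valued o1 -> countably_valued o2 ->
  countably_valued (fun x => o1 x \+ o2 x).
Proof. by apply: countably_valued_map2 => u v; exact: D1pD. Qed.

Lemma countably_valuedB o1 o2 : countably_valued o1 -> countably_valued o2 ->
  countably_valued (fun x => o1 x \- o2 x).
Proof. by apply: countably_valued_map2 => u v; exact: D1pB. Qed.

Lemma countably_valuedZ (a : R) o : countably_valued o -> countably_valued (fun x y => a * o x y).
Proof.
apply: (@countably_valued_scale unit (fun=> a) (fun=> tt)).
by move=> []; rewrite preimage_cst; case: ifP.
Qed.

Lemma section_normZc (a : R) o : countably_valued o ->
  \forall x \ae nu, section_norm (fun x y => a * o x y) x = `|a| * section_norm o x.
Proof. by apply: (@section_normZ unit (fun=> a) (fun=> tt)). Qed.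

Lemma section_normB o1 o2 : countably_valued o1 -> countably_valued o2 ->
  \forall x \ae nu, section_norm (fun x => o1 x \- o2 x) x <=
    section_norm o1 x + section_norm o2 x.
Proof.
move=> c1 c2; have h := section_normD c1 (countably_valuedZ (-1) c2).
apply: filterS2 h (section_normZc (-1) c2) => x.
have -> : section_norm (fun x => o1 x \+ (fun y => -1 * o2 x y)) x =
    section_norm (fun x => o1 x \- o2 x) x.
  by rewrite /section_norm; congr (gn _ _); apply/funext => y /=; rewrite mulN1r.
by move=> h1 h2; rewrite h2 normrN1 mul1r in h1.
Qed.

Lemma section_norm_dist o1 o2 : countably_valued o1 -> countably_valued o2 ->
  \forall x \ae nu, `|section_norm o1 x - section_norm o2 x| <=
    section_norm (fun x => o1 x \- o2 x) x.
Proof.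
have half o o' : countably_valued o -> countably_valued o' ->
    \forall x \ae nu, section_norm o x - section_norm o' x <=
      section_norm (fun x => o x \- o' x) x.
  move=> c c'; apply: filterS (section_normD (countably_valuedB c c') c') => x.
  rewrite lerBlDr; apply: le_trans; rewrite le_eqVlt; apply/orP; left; apply/eqP.
  by rewrite /section_norm; congr (gn _ _); apply/funext => y /=; lra.
move=> c1 c2.
have sw : \forall x \ae nu, section_norm (fun x => o2 x \- o1 x) x =
    section_norm (fun x => o1 x \- o2 x) x.
  apply: filterS (section_normZc (-1) (countably_valuedB c1 c2)) => x.
  rewrite normrN1 mul1r => <-.
  by rewrite /section_norm; congr (gn _ _); apply/funext => y /=; lra.
apply: filterS3 sw (half _ _ c1 c2) (half _ _ c2 c1) => x -> h1 h2.
by rewrite ler_norml h1 andbT lerNl opprB.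
Qed.

Lemma simple_sectionD o1 o2 : simple_section o1 -> simple_section o2 ->
  simple_section (fun x => o1 x \+ o2 x).
Proof.
move=> [c1 l1] [c2 l2]; have c12 := countably_valuedD c1 c2; split => //.
apply: (Lfun_le p0 _ (LfunD p1 l1 l2)); first exact: measurable_section_norm.
apply: filterS (section_normD c1 c2) => x h.
by rewrite !ger0_norm ?addr_ge0 ?section_norm_ge0.
Qed.

Lemma simple_sectionB o1 o2 : simple_section o1 -> simple_section o2 ->
  simple_section (fun x => o1 x \- o2 x).
Proof.
move=> [c1 l1] [c2 l2]; have c12 := countably_valuedB c1 c2; split => //.
apply: (Lfun_le p0 _ (LfunD p1 l1 l2)); first exact: measurable_section_norm.
apply: filterS (section_normB c1 c2) => x h.
by rewrite !ger0_norm ?addr_ge0 ?section_norm_ge0.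
Qed.

Lemma simple_section_scale (I : countType) (c : I -> R) (j : borel X -> I) (M : R) o :
  (forall i, measurable (j @^-1` [set i])) -> (\forall x \ae nu, `|c (j x)| <= M) ->
  simple_section o -> simple_section (fun x y => c (j x) * o x y).
Proof.
move=> mj cM [co lo]; have cz := countably_valued_scale c mj co; split => //.
apply: (Lfun_le p0 _ (Lfun_scale (`|M|) p1 lo)); first exact: measurable_section_norm.
apply: filterS2 cM (section_normZ c j co) => x h ->.
rewrite /= !normrM !normr_id [leRHS]mulrC ler_wpM2r//.
by rewrite (le_trans h)// ler_norm.
Qed.

Lemma simple_sectionZ (a : R) o : simple_section o -> simple_section (fun x y => a * o x y).
Proof.
apply: (@simple_section_scale unit (fun=> a) (fun=> tt) `|a|); last exact: aeW.
by move=> []; rewrite preimage_cst; case: ifP.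
Qed.

Lemma simple_section_cst u : D1p nu p u -> simple_section (fun=> u).
Proof. by move=> Du; split; [exact: countably_valued_cst|exact: grad_norm_Lfun]. Qed.

End simple_sections.

(** * Families (f_i, A_i) as sections *)

Section families.
Context {R : realType} {X : completeMetricType R}.
Variable nu : {measure set (borel X) -> \bar R}.
Variable p : R.
Hypothesis p1 : 1 <= p.
Let p0 : 0 < p. Proof. exact: lt_le_trans p1. Qed.
Implicit Types (u v h : borel X -> R) (o : borel X -> borel X -> R) (w z : @precot R X).
Local Notation gn := (grad_norm nu p).
Local Notation cval := (countably_valued nu p).
Local Notation snorm := (section_norm nu p).
Local Notation simple := (simple_section nu p).

Definition partitioned w := [/\ forall i, D1p nu p (pc_fun w i),
  forall i, measurable (pc_set w i), trivIset [set: nat] (pc_set w) &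
  \bigcup_i pc_set w i = [set: borel X]].

Lemma pc_index_eq w i x : trivIset [set: nat] (pc_set w) -> pc_set w i x -> pc_index w x = i.
Proof.
move=> tw wi; rewrite /pc_index; case: xgetP => [j _ wj|/(_ i)//].
by apply: (tw j i) => //; exists x.
Qed.

Lemma pc_index_mem w x : partitioned w -> pc_set w (pc_index w x) x.
Proof.
move=> [_ _ tw Uw]; have [i _ wi] : (\bigcup_i pc_set w i) x by rewrite Uw.
by rewrite (pc_index_eq tw wi).
Qed.

Lemma partitioned_countably_valued w : partitioned w -> cval (section_of w).
Proof.
move=> pw; have [Dw mw tw Uw] := pw.
exists (pc_fun w), (pc_index w); split => // i.
have -> : pc_index w @^-1` [set i] = pc_set w i; last exact: mw.
apply/seteqP; split => x /=; last exact: pc_index_eq.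
by move=> <-; exact: pc_index_mem.
Qed.

(** The summability condition on a family says that the pointwise norm of its
    section is in L^p. *)
Lemma family_energy w : partitioned w ->
  (\sum_(0 <= i <oo) \int[nu]_(x in pc_set w i) (gn (pc_fun w i) x `^ p)%:E =
   power_integral nu p (snorm (section_of w)))%E.
Proof.
move=> pw; have [Dw mw tw Uw] := pw; have cw := partitioned_countably_valued pw.
have ms : measurable_fun setT (fun x => (`|snorm (section_of w) x| `^ p)%:E).
  by apply: measurable_pow; exact: measurable_section_norm.
have hU := @ge0_integral_bigcup _ _ _ nu (pc_set w)
  (fun x => (`|snorm (section_of w) x| `^ p)%:E) mw.
rewrite Uw in hU; rewrite /power_integral hU; last 3 first.
- exact: ms.
- by move=> x _; rewrite lee_fin powR_ge0.
- exact: tw.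
apply: eq_eseriesr => i _; apply: eq_integral => x /[!inE] wx.
have -> : snorm (section_of w) x = gn (pc_fun w i) x.
  by rewrite /section_norm /section_of (pc_index_eq tw wx).
by rewrite (ger0_norm (grad_norm_ge0 _ _ _ _)).
Qed.

Lemma is_precotP w : is_precot nu p w <->
  partitioned w /\ snorm (section_of w) \in Lfun nu p%:E.
Proof.
split=> [[Dw mw tw Uw]|[pw /(Lfun_powerP _ _ p0)[_ fw]]].
  have pw : partitioned w by [].
  rewrite family_energy// => fw; split => //; apply/(Lfun_powerP _ _ p0); split => //.
  exact: (measurable_section_norm (partitioned_countably_valued pw)).
by have [Dw mw tw Uw] := pw; split => //; rewrite family_energy.
Qed.

Lemma is_precot_simple w : is_precot nu p w -> simple (section_of w).
Proof.
by move=> /is_precotP[pw lw]; split => //; exact: partitioned_countably_valued.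
Qed.

(** Families indexed by a countable type are reindexed by nat; this covers sums,
    differences and products at once. *)
Lemma pickled_partition (I : countType) (F : I -> borel X -> R) (A : I -> set (borel X)) :
  (forall i, D1p nu p (F i)) -> (forall i, measurable (A i)) -> trivIset setT A ->
  \bigcup_i A i = setT ->
  let w := Precot (fun n => if @pickle_inv I n is Some i then F i else cst 0)
                  (fun n => if @pickle_inv I n is Some i then A i else set0) in
  partitioned w /\ forall i x, A i x -> section_of w x = F i.
Proof.
move=> DF mA tA UA w.
have tw : trivIset [set: nat] (pc_set w).
  move=> m n _ _; rewrite /w /=.
  have := @pickle_invK I m; have := @pickle_invK I n.
  case: pickle_inv => [i|] /=; last by move=> _ _ [x []].
  case: pickle_inv => [j|] /=; last by move=> _ _ [x []].
  by move=> <- <- hx; congr pickle; exact: tA.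
split; first split.
- by move=> n; rewrite /=; case: pickle_inv => //; exact: D1p0.
- by move=> n; rewrite /=; case: pickle_inv.
- exact: tw.
- apply/seteqP; split => // x _; have [i _ Ai] : (\bigcup_i A i) x by rewrite UA.
  by exists (pickle i) => //=; rewrite pickleK_inv.
move=> i x Ai; rewrite /section_of (@pc_index_eq w (pickle i)) ?pickleK_inv//=.
  by rewrite pickleK_inv.
by rewrite pickleK_inv.
Qed.

Lemma partitioned_map2 (op : (borel X -> R) -> (borel X -> R) -> borel X -> R) w z :
  (forall u v, D1p nu p u -> D1p nu p v -> D1p nu p (op u v)) ->
  partitioned w -> partitioned z -> partitioned (pc_map2 op w z) /\
  section_of (pc_map2 op w z) = (fun x => op (section_of w x) (section_of z x)).
Proof.
move=> hop pw pz; have [[Dw mw tw Uw] [Dz mz tz Uz]] := (pw, pz).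
have [|||| h1 h2] := @pickled_partition (nat * nat)%type
    (fun ij => op (pc_fun w ij.1) (pc_fun z ij.2))
    (fun ij => pc_set w ij.1 `&` pc_set z ij.2).
- by move=> ij; exact: hop.
- by move=> ij; exact: measurableI.
- move=> [i j] [i' j'] _ _ [x [[/= wi zj] [/= wi' zj']]].
  by rewrite -(pc_index_eq tw wi) -(pc_index_eq tz zj) -(pc_index_eq tw wi') -(pc_index_eq tz zj').
- apply/seteqP; split => // x _; exists (pc_index w x, pc_index z x) => //=.
  by split; exact: pc_index_mem.
split => //; apply/funext => x.
by rewrite (h2 (pc_index w x, pc_index z x))//=; split; exact: pc_index_mem.
Qed.

(** The step function which replaces h in the product of a family by h. *)
Definition discretize (n : nat) h (x : borel X) : R :=
  (Num.floor (n.+1%:R * h x))%:~R / n.+1%:R.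

Lemma discretize_dist n h x : `|discretize n h x - h x| <= n.+1%:R^-1.
Proof.
have n0 : (0 : R) < n.+1%:R by [].
have := floor_itv (n.+1%:R * h x); rewrite /discretize intrD.
move: (Num.floor _)%:~R => k /andP[h1 h2].
have n1 : (n.+1%:R : R)^-1 * n.+1%:R = 1 by rewrite mulVf// gt_eqF.
have hk : k / n.+1%:R * n.+1%:R = k by rewrite divfK// gt_eqF.
by rewrite ler_norml; apply/andP; split; rewrite -(@ler_pM2r _ n.+1%:R)// mulrBl ?mulNr n1 hk; lra.
Qed.

Lemma measurable_floor_level n h (k : int) : measurable_fun setT h ->
  measurable [set x : borel X | Num.floor (n.+1%:R * h x) = k].
Proof.
move=> mh.
have -> : [set x : borel X | Num.floor (n.+1%:R * h x) = k] =
    ~` [set x | n.+1%:R * h x < k%:~R] `&` [set x | n.+1%:R * h x < (k + 1)%:~R].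
  apply/seteqP; split => x /=.
    move=> hk; have := floor_itv (n.+1%:R * h x); rewrite hk => /andP[h1 h2].
    by split => //; apply/negP; rewrite -leNgt.
  by move=> [/negP]; rewrite -leNgt => h1 h2; apply: floor_def; rewrite h1.
have mnh : measurable_fun setT (fun x => n.+1%:R * h x) by exact: measurable_funM.
apply: measurableI; [apply: measurableC|];
  by apply: (measurable_ltr_set mnh); exact: measurable_cst.
Qed.

Lemma partitioned_mul n h w : measurable_fun setT h -> partitioned w ->
  partitioned (pc_mul n h w) /\
  section_of (pc_mul n h w) = (fun x y => discretize n h x * section_of w x y).
Proof.
move=> mh pw; have [Dw mw tw Uw] := pw.
have [|||| h1 h2] := @pickled_partition (nat * int)%type
    (fun ik x => (ik.2 : int)%:~R / n.+1%:R * pc_fun w ik.1 x)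
    (fun ik => pc_set w ik.1 `&` [set x | Num.floor (n.+1%:R * h x) = ik.2]).
- by move=> ik; exact: D1pZ.
- by move=> ik; apply: measurableI => //; exact: measurable_floor_level.
- move=> [i j] [i' j'] _ _ [x [[/= wi zj] [/= wi' zj']]].
  by rewrite -(pc_index_eq tw wi) -(pc_index_eq tw wi') -zj -zj'.
- apply/seteqP; split => // x _.
  exists (pc_index w x, Num.floor (n.+1%:R * h x)) => //=.
  by split => //; exact: pc_index_mem.
split => //; apply/funext => x.
by rewrite (h2 (pc_index w x, Num.floor (n.+1%:R * h x)))//=; split => //; exact: pc_index_mem.
Qed.

Lemma partitioned_of u : D1p nu p u -> partitioned (pc_of u) /\ section_of (pc_of u) = fun=> u.
Proof.
move=> Du; have tu : trivIset [set: nat] (pc_set (pc_of u)).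
  by move=> i j _ _ /=; case: eqP => [->|_]; case: eqP => [->|_] // [x []].
split; last first.
  by apply/funext => x; rewrite /section_of (@pc_index_eq _ 0%N)//=.
split => //.
- by move=> i /=; case: ifP => // _; exact: D1p0.
- by move=> i /=; case: ifP.
- by apply/seteqP; split => // x _; exists 0%N.
Qed.

Lemma section_ofD w z : is_precot nu p w -> is_precot nu p z ->
  section_of (pc_add w z) = (fun x => section_of w x \+ section_of z x).
Proof.
move=> /is_precotP[pw _] /is_precotP[pz _].
by case: (partitioned_map2 (@D1pD _ _ nu p p0) pw pz).
Qed.

Lemma section_ofB w z : is_precot nu p w -> is_precot nu p z ->
  section_of (pc_sub w z) = (fun x => section_of w x \- section_of z x).
Proof.
move=> /is_precotP[pw _] /is_precotP[pz _].
by case: (partitioned_map2 (@D1pB _ _ nu p p0) pw pz).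
Qed.

Lemma section_ofM n h w : measurable_fun setT h -> is_precot nu p w ->
  section_of (pc_mul n h w) = (fun x y => discretize n h x * section_of w x y).
Proof. by move=> mh /is_precotP[pw _]; case: (partitioned_mul n mh pw). Qed.

Lemma Lfun_bounded h : h \in Lfun nu +oo%E -> exists M : R, \forall x \ae nu, `|h x| <= M.
Proof.
move=> /andP[_]; rewrite inE/= /finite_norm unlock; case: ifP => [nu0|nu0 _].
  exact: (@ess_sup_inf.ess_supr_bounded _ _ _ nu (fun x => `|h x|)).
have nuT : nu setT = 0%E by apply/eqP; rewrite eq_le measure_ge0 andbT leNgt nu0.
by exists 0; exists setT; split => //.
Qed.

Lemma bounded_Lfun h (M : R) : measurable_fun setT h -> (forall x, `|h x| <= M) ->
  h \in Lfun nu +oo%E.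
Proof.
move=> mh hM; apply/andP; rewrite !inE/=; split => //.
rewrite /finite_norm unlock; case: ifP => // _.
apply: (@le_lt_trans _ _ M%:E); last by rewrite ltry.
by apply/ess_sup_inf.ess_supP; apply: aeW => x /=; rewrite lee_fin.
Qed.

Lemma discretize_bounded n h M : (\forall x \ae nu, `|h x| <= M) ->
  \forall x \ae nu, `|discretize n h x| <= M + 1.
Proof.
apply: filterS => x hM; have := discretize_dist n h x => hd.
have -> : discretize n h x = h x + (discretize n h x - h x) by lra.
apply: (le_trans (ler_normD _ _)); apply: lerD => //.
by apply: (le_trans hd); rewrite invf_le1// ler1n.
Qed.

Lemma simple_discretize n h o : h \in Lfun nu +oo%E -> simple o ->
  simple (fun x y => discretize n h x * o x y).
Proof.
move=> hL; have [M hM] := Lfun_bounded hL; have mh := Lfun_measurable hL.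
apply: (@simple_section_scale _ _ nu p p1 int (fun k => k%:~R / n.+1%:R)
  (fun x => Num.floor (n.+1%:R * h x)) (M + 1)).
  by move=> k; exact: measurable_floor_level.
exact: discretize_bounded.
Qed.

Lemma section_norm_discretize n h o : measurable_fun setT h -> simple o ->
  \forall x \ae nu, snorm (fun x y => discretize n h x * o x y) x =
    `|discretize n h x| * snorm o x.
Proof.
move=> mh [co _].
exact: (section_normZ p1 (fun k : int => k%:~R / n.+1%:R) (fun x => Num.floor (n.+1%:R * h x)) co).
Qed.

Lemma is_precotM n h w : h \in Lfun nu +oo%E -> is_precot nu p w -> is_precot nu p (pc_mul n h w).
Proof.
move=> hL hw; have mh := Lfun_measurable hL.
have [pw _] := (is_precotP w).1 hw; have [h1 h2] := partitioned_mul n mh pw.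
apply/is_precotP; split => //; rewrite h2.
by case: (simple_discretize n hL (is_precot_simple hw)).
Qed.

Lemma is_precot_of u : D1p nu p u -> is_precot nu p (pc_of u).
Proof.
move=> Du; have [h1 h2] := partitioned_of Du.
by apply/is_precotP; split => //; rewrite h2; case: (simple_section_cst p1 Du).
Qed.

End families.

(** * Pointwise norms in the cotangent module *)

Section cotangent_limits.
Context {R : realType} {X : completeMetricType R}.
Variable nu : {measure set (borel X) -> \bar R}.
Variable p : R.
Hypothesis p1 : 1 <= p.
Let p0 : 0 < p. Proof. exact: lt_le_trans p1. Qed.
Implicit Types (f u v h : borel X -> R) (o : borel X -> borel X -> R) (w z : @precot R X).
Implicit Types (W Z : @cot R X).
Local Notation gn := (grad_norm nu p).
Local Notation cval := (countably_valued nu p).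
Local Notation snorm := (section_norm nu p).
Local Notation simple := (simple_section nu p).
Local Notation "'N_ p [ f ]" := (Lnorm nu p%:E (EFin \o f%R)).
Local Notation cvgLp := (Lp_cvg nu p).

Lemma Lnorm_scale (c : R) f : measurable_fun setT f ->
  (Lnorm nu p%:E (EFin \o (fun x => c * f x)%R) = `|c|%:E * 'N_p[f])%E.
Proof.
move=> mf; rewrite !LnormE /power_integral.
have -> : (\int[nu]_x (`|c * f x| `^ p)%:E = (`|c| `^ p)%:E * \int[nu]_x (`|f x| `^ p)%:E)%E.
  rewrite -ge0_integralZl//.
  - by apply: eq_integral => x _; rewrite normrM powRM// EFinM.
  - exact: measurable_pow.
have I0 : (0 <= \int[nu]_x (`|f x| `^ p)%:E)%E.
  by apply: integral_ge0 => x _; rewrite lee_fin powR_ge0.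
have c0 : (0 <= (`|c| `^ p)%:E)%E by rewrite lee_fin powR_ge0.
by rewrite (poweRM _ c0 I0) poweR_EFin powRK ?gt_eqF.
Qed.

Lemma cot_simple W n : is_cot nu p W -> simple (section_of (W n)).
Proof. by move=> [hW _]; exact: is_precot_simple. Qed.

Lemma section_of_map2_cval w z : is_precot nu p w -> is_precot nu p z ->
  cval (fun x => section_of w x \- section_of z x).
Proof.
by move=> /(is_precot_simple p1)[cw _] /(is_precot_simple p1)[cz _]; exact: countably_valuedB.
Qed.

Lemma cot_Cauchy W (e : R) : is_cot nu p W -> 0 < e ->
  exists N, forall m n, (N <= m)%N -> (N <= n)%N ->
    ('N_p[snorm (fun x => section_of (W m) x \- section_of (W n) x)] < e%:E)%E.
Proof.
move=> [hW hC] /hC[N hN]; exists N => m n Nm Nn.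
by rewrite -(section_ofB p1 (hW m) (hW n)); exact: hN.
Qed.

(** The pointwise norm is 1-Lipschitz, so the norms of a Cauchy sequence of families
    form a Cauchy sequence in L^p. *)
Lemma cot_ptnorm_cvg W : is_cot nu p W ->
  cvgLp (fun n => snorm (section_of (W n))) (cot_ptnorm nu p W).
Proof.
move=> hW; have [|//|f hf] := @Lp_complete _ _ _ nu p (fun n => snorm (section_of (W n))) p1.
- by move=> n; case: (cot_simple n hW).
- move=> e e0; have [N hN] := cot_Cauchy hW e0; exists N => m n Nm Nn.
  apply: le_lt_trans (hN _ _ Nm Nn).
  have [[cm lm] [cn ln]] := (cot_simple m hW, cot_simple n hW).
  apply: le_Lnorm => //.
  + exact: (measurable_funB (Lfun_measurable lm) (Lfun_measurable ln)).
  + exact: (measurable_section_norm (countably_valuedB p1 cm cn)).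
  + apply: filterS (section_norm_dist p1 cm cn) => x h /=.
    by rewrite [leRHS]ger0_norm// section_norm_ge0.
- by rewrite /cot_ptnorm; case: xgetP => [N _ //|/(_ f)].
Qed.

Lemma cot_ptnorm_unique W f : is_cot nu p W ->
  cvgLp (fun n => snorm (section_of (W n))) f ->
  \forall x \ae nu, cot_ptnorm nu p W x = f x.
Proof.
move=> hW hf; apply: (Lp_cvg_unique p1 _ (cot_ptnorm_cvg hW) hf) => n.
by have [_ l] := cot_simple n hW; exact: (Lfun_measurable l).
Qed.

Lemma cot_ptnorm_Lfun W : is_cot nu p W -> cot_ptnorm nu p W \in Lfun nu p%:E.
Proof. by move=> /cot_ptnorm_cvg[]. Qed.

Lemma Lnorm_ae0 f : measurable_fun setT f -> (\forall x \ae nu, f x = 0) -> 'N_p[f] = 0%E.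
Proof.
move=> mf f0; rewrite (eq_ae_Lnorm p0 mf (measurable_cst (0 : R)) f0).
have -> : EFin \o (fun=> 0) = cst 0%E :> (borel X -> \bar R) by [].
by rewrite Lnorm0// gt_eqF.
Qed.

Lemma is_cot_differential u : D1p nu p u -> is_cot nu p (differential u).
Proof.
move=> Du; have hp := is_precot_of p1 Du; split => // e e0; exists 0%N => m n _ _.
have -> : pc_norm nu p (pc_sub (differential u m) (differential u n)) =
    'N_p[snorm (section_of (pc_sub (pc_of u) (pc_of u)))] by [].
rewrite (section_ofB p1 hp hp) Lnorm_ae0 ?lte_fin//.
  exact: (measurable_section_norm (section_of_map2_cval hp hp)).
have [_ ->] := partitioned_of p1 Du; rewrite /section_norm.
have -> : (u \- u)%R = cst 0 by apply/funext => x /=; rewrite subrr.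
by apply: grad_norm_null => //; [exact: D1p0|exact: aeW].
Qed.

Lemma cot_ptnorm_differential u : D1p nu p u ->
  \forall x \ae nu, cot_ptnorm nu p (differential u) x = gn u x.
Proof.
move=> Du; apply: (cot_ptnorm_unique (is_cot_differential Du)).
have [_ E] := partitioned_of p1 Du.
have -> : (fun n => snorm (section_of (differential u n))) = fun=> gn u.
  by apply/funext => n; rewrite /differential E.
by apply: Lp_cvg_cst => //; exact: grad_norm_Lfun.
Qed.

End cotangent_limits.

Section cotangent_products.
Context {R : realType} {X : completeMetricType R}.
Variable nu : {measure set (borel X) -> \bar R}.
Variable p : R.
Hypothesis p1 : 1 <= p.
Let p0 : 0 < p. Proof. exact: lt_le_trans p1. Qed.
Implicit Types (f u v h : borel X -> R).
Local Notation gn := (grad_norm nu p).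
Local Notation snorm := (section_norm nu p).
Local Notation "'N_ p [ f ]" := (Lnorm nu p%:E (EFin \o f%R)).

Lemma Lnorm_le_scale (c : R) f u : 0 <= c -> measurable_fun setT f -> measurable_fun setT u ->
  (\forall x \ae nu, `|f x| <= c * `|u x|) -> ('N_p[f] <= c%:E * 'N_p[u])%E.
Proof.
move=> c0 mf mu fu; rewrite -[c in leRHS]ger0_norm// -Lnorm_scale//.
apply: le_Lnorm => //; first exact: measurable_funM.
by apply: filterS fu => x; rewrite normrM (ger0_norm c0).
Qed.

Lemma discretize_section_dist m n h u : measurable_fun setT h -> D1p nu p u ->
  \forall x \ae nu, snorm (fun x => (fun y => discretize m h x * u y) \-
      (fun y => discretize n h x * u y)) x <= (m.+1%:R^-1 + n.+1%:R^-1) * gn u x.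
Proof.
move=> mh Du.
pose c (k : int * int) : R := k.1%:~R / m.+1%:R - k.2%:~R / n.+1%:R.
pose j (x : borel X) := (Num.floor (m.+1%:R * h x), Num.floor (n.+1%:R * h x)).
have := section_normZ p1 c j (countably_valued_cst p1 Du).
have -> : (fun x y => c (j x) * u y) = (fun x => (fun y => discretize m h x * u y) \-
      (fun y => discretize n h x * u y)).
  by apply/funext => x; apply/funext => y; rewrite /c /j /discretize /= mulrBl.
apply: filterS => x ->; rewrite /section_norm ler_wpM2r ?grad_norm_ge0//.
have -> : c (j x) = (discretize m h x - h x) - (discretize n h x - h x).
  by rewrite opprB addrA subrK.
by apply: (le_trans (ler_normB _ _)); apply: lerD; exact: discretize_dist.
Qed.

Lemma discretized_differential h u n : measurable_fun setT h -> D1p nu p u ->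
  section_of (cot_mul h (differential u) n) = (fun x y => discretize n h x * u y).
Proof.
move=> mh Du; rewrite (section_ofM p1 _ mh (is_precot_of p1 Du)).
by have [_ ->] := partitioned_of p1 Du.
Qed.

Lemma is_cot_mul_differential h u : h \in Lfun nu +oo%E -> D1p nu p u ->
  is_cot nu p (cot_mul h (differential u)).
Proof.
move=> hL Du; have mh := Lfun_measurable hL.
have pn n : is_precot nu p (cot_mul h (differential u) n).
  by apply: is_precotM => //; exact: is_precot_of.
split => // e e0; have /Lfun_lty := grad_norm_Lfun p0 Du.
have := Lnorm_ge0 nu p%:E (EFin \o gn u); case E : 'N_p[gn u] => [K| |] // K0 _.
rewrite lee_fin in K0; have e' : 0 < e / (2 * (K + 1)).
  by rewrite divr_gt0// mulr_gt0// ltr_wpDl.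
have [N hN] := natSinv_lt e'; exists N => m n Nm Nn.
have -> : pc_norm nu p (pc_sub (cot_mul h (differential u) m) (cot_mul h (differential u) n)) =
    'N_p[snorm (section_of (pc_sub (cot_mul h (differential u) m)
      (cot_mul h (differential u) n)))] by [].
have cmn := section_of_map2_cval p1 (pn m) (pn n).
rewrite (section_ofB p1 (pn m) (pn n)).
have dist := discretize_section_dist m n mh Du.
have k0 : 0 <= (m.+1%:R^-1 + n.+1%:R^-1 : R) by rewrite addr_ge0.
apply: (@le_lt_trans _ _ ((m.+1%:R^-1 + n.+1%:R^-1 : R)%:E * 'N_p[gn u])%E).
  apply: Lnorm_le_scale => //.
  - exact: (measurable_section_norm cmn).
  - exact: measurable_grad_norm.
  - rewrite !discretized_differential//; apply: filterS dist => x.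
    by rewrite !ger0_norm ?section_norm_ge0 ?grad_norm_ge0.
rewrite E -EFinM lte_fin.
have S k : (N <= k)%N -> (k.+1%:R^-1 : R) <= N.+1%:R^-1.
  by move=> Nk; rewrite lef_pV2 ?posrE// ler_nat.
have h2 : (m.+1%:R^-1 + n.+1%:R^-1 : R) <= 2 * N.+1%:R^-1.
  by rewrite mulr_natl mulr2n; exact: lerD (S _ Nm) (S _ Nn).
apply: (@le_lt_trans _ _ ((2 * N.+1%:R^-1) * (K + 1))).
  by apply: ler_pM => //; rewrite lerDl.
rewrite ltr_pdivlMr ?mulr_gt0 ?ltr_wpDl// in hN.
by move: hN; rewrite mulrA; congr (_ < _); rewrite [N.+1%:R^-1 * 2]mulrC.
Qed.

(** The discretized factors are uniformly close to h, so the pointwise norms of the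
    products converge to |h| |du| in L^p. *)
Lemma cot_ptnorm_mul_differential h u : h \in Lfun nu +oo%E -> D1p nu p u ->
  \forall x \ae nu, cot_ptnorm nu p (cot_mul h (differential u)) x = `|h x| * gn u x.
Proof.
move=> hL Du; have mh := Lfun_measurable hL; have [M hM] := Lfun_bounded hL.
have gL := grad_norm_Lfun p0 Du; have mg := Lfun_measurable gL.
have mah : measurable_fun setT (fun x => `|h x|) by exact: measurableT_comp.
have hg : (fun x => `|h x| * gn u x) \in Lfun nu p%:E.
  apply: (Lfun_le p0 _ (Lfun_scale M p1 gL)); first exact: measurable_funM.
  apply: filterS hM => x hx /=; rewrite !normrM normr_id mulrC ler_wpM2l//.
  by rewrite (le_trans hx)// ler_norm.
have hC := is_cot_mul_differential hL Du.
have sE n : snorm (section_of (cot_mul h (differential u) n)) =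
    snorm (fun x y => discretize n h x * u y) by rewrite discretized_differential.
have ms n : measurable_fun setT (snorm (section_of (cot_mul h (differential u) n))).
  by have [_ l] := cot_simple p1 n hC; exact: (Lfun_measurable l).
apply: (cot_ptnorm_unique p1 hC).
have gfin : 'N_p[gn u] \is a fin_num by rewrite ge0_fin_numE ?Lnorm_ge0// Lfun_lty.
have r0 : (fun n => (fine 'N_p[gn u])%:E * (n.+1%:R^-1 : R)%:E)%E @ \oo --> 0%E.
  exact: cvge0_scale cvge_harmonic.
split; first exact: hg.
apply: squeeze_cvge0 r0 => n; rewrite Lnorm_ge0/= (fineK gfin) muleC.
apply: Lnorm_le_scale => //; first exact: (measurable_funB (ms n) (measurable_funM mah mg)).
have := section_norm_discretize p1 n mh (simple_section_cst p1 Du).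
apply: filterS => x; rewrite /= sE => ->.
have -> : snorm (fun=> u) x = gn u x by [].
rewrite -mulrBl normrM; apply: ler_wpM2r => //.
by apply: le_trans (discretize_dist n h x); exact: ler_dist_dist.
Qed.

End cotangent_products.

(** * Real-valued integrals of integrable functions *)

Section integrable_functions.
Context d (T : measurableType d) (R : realType).
Variable mu : {measure set T -> \bar R}.
Implicit Types (f g : T -> R) (A B : set T).

Lemma Lfun1_int A f : f \in Lfun mu 1 -> measurable A -> mu.-integrable A (EFin \o f).
Proof. by move=> /Lfun1_integrable hf mA; apply: integrableS hf. Qed.

Lemma Lfun1_Rint A f : f \in Lfun mu 1 -> measurable A ->
  ((\int[mu]_(x in A) f x)%:E = \int[mu]_(x in A) (f x)%:E)%E.
Proof. by move=> hf mA; rewrite fineK//; exact: integrable_fin_num (Lfun1_int hf mA). Qed.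

Lemma eq_ae_Rint A f g : measurable A -> measurable_fun setT f -> measurable_fun setT g ->
  (\forall x \ae mu, f x = g x) -> \int[mu]_(x in A) f x = \int[mu]_(x in A) g x.
Proof.
move=> mA mf mg fg; rewrite /Rintegral; congr fine; apply: ae_eq_integral => //.
- by apply/measurable_EFinP; exact: measurable_funTS.
- by apply/measurable_EFinP; exact: measurable_funTS.
- by apply: filterS fg => x -> _.
Qed.

(** The integrand g is replaced by max (f, g), which is above f everywhere. *)
Lemma le_ae_Rint A f g : measurable A -> f \in Lfun mu 1 -> g \in Lfun mu 1 ->
  (\forall x \ae mu, f x <= g x) -> \int[mu]_(x in A) f x <= \int[mu]_(x in A) g x.
Proof.
move=> mA hf hg fg; have [mf mg] := (Lfun_measurable hf, Lfun_measurable hg).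
pose k x := Num.max (f x) (g x).
have mk : measurable_fun setT k by exact: measurable_maxr.
have gk : \forall x \ae mu, g x = k x by apply: filterS fg => x h; rewrite /k max_r.
have hk : k \in Lfun mu 1.
  by apply: (Lfun_le ltr01 mk hg); apply: filterS gk => x ->.
rewrite (eq_ae_Rint mA mg mk gk); apply: le_Rintegral => //; try exact: Lfun1_int.
by move=> x _; rewrite /k le_max lexx.
Qed.

Lemma Lfun1Z (c : R) f : f \in Lfun mu 1 -> (fun x => c * f x) \in Lfun mu 1.
Proof. exact: LfunZ. Qed.

Lemma Lfun1D f g : f \in Lfun mu 1 -> g \in Lfun mu 1 -> (f \+ g)%R \in Lfun mu 1.
Proof. exact: LfunD. Qed.

Lemma Rint_indic A B f : measurable A ->
  \int[mu]_(x in A) (\1_B x * f x) = \int[mu]_(x in A `&` B) f x.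
Proof.
move=> mA; rewrite Rintegral_mkcondr; apply: eq_Rintegral => x _.
by rewrite patch_indic mulrC.
Qed.

Lemma Lfun1_indic A f : measurable A -> f \in Lfun mu 1 -> (fun x => \1_A x * f x) \in Lfun mu 1.
Proof.
move=> mA hf; apply: (Lfun_le ltr01 _ hf).
  by apply: measurable_funM; [exact: measurable_indic|exact: Lfun_measurable hf].
apply: aeW => x; rewrite indicE; case: (_ \in _); rewrite ?mul1r// mul0r normr0//.
Qed.

Lemma le_ae_of_integrals f g : f \in Lfun mu 1 -> g \in Lfun mu 1 ->
  (forall A, measurable A -> \int[mu]_(x in A) f x <= \int[mu]_(x in A) g x) ->
  \forall x \ae mu, f x <= g x.
Proof.
move=> hf hg h; apply: le_integral_ae.
- exact: Lfun1_int.
- exact: Lfun1_int.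
- by move=> A mA; rewrite -!Lfun1_Rint// lee_fin; exact: h.
Qed.

Lemma eq_ae_of_integrals f g : f \in Lfun mu 1 -> g \in Lfun mu 1 ->
  (forall A, measurable A -> \int[mu]_(x in A) f x = \int[mu]_(x in A) g x) ->
  \forall x \ae mu, f x = g x.
Proof.
move=> hf hg h; have h1 := @le_ae_of_integrals f g hf hg.
have h2 := @le_ae_of_integrals g f hg hf.
have {}h1 : \forall x \ae mu, f x <= g x by apply: h1 => A mA; rewrite h.
have {}h2 : \forall x \ae mu, g x <= f x by apply: h2 => A mA; rewrite h.
by apply: filterS2 h1 h2 => x fg gf; apply: le_anti; rewrite fg gf.
Qed.

End integrable_functions.

Section sigma_finite_density.
Context d (T : measurableType d) (R : realType).
Variable mu : {measure set T -> \bar R}.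
Hypothesis sf : sigma_finite setT mu.

(** A copy of mu carrying the structure of a sigma-finite measure. *)
Definition sigma_finite_copy : set T -> \bar R := mu.
HB.instance Definition _ := Measure.copy sigma_finite_copy mu.
HB.instance Definition _ := Measure_isSigmaFinite.Build d T R sigma_finite_copy sf.

Lemma density_exists_sigma_finite (b : T -> R) (m : set T -> R) :
  b \in Lfun mu 1 -> (forall x, 0 <= b x) ->
  (forall A B, measurable A -> measurable B -> A `&` B = set0 -> m (A `|` B) = m A + m B) ->
  (forall A, measurable A -> `|m A| <= \int[mu]_(x in A) b x) ->
  exists2 f : T -> R, f \in Lfun mu 1 &
    forall A, measurable A -> m A = \int[mu]_(x in A) f x.
Proof.
move=> hb b0 mD mb.
have [|A mA|f hf fE] := @density_exists _ _ _ sigma_finite_copy b m _ b0 mD.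
- exact: (Lfun1_int hb measurableT).
- by rewrite -[X in (_ <= X)%E](Lfun1_Rint hb mA) lee_fin; exact: mb.
have hf1 : f \in Lfun mu 1 by apply/Lfun1_integrable.
exists f => // A mA; apply: EFin_inj; rewrite (Lfun1_Rint hf1 mA); exact: fE.
Qed.
End sigma_finite_density.

Lemma Lfun1_RintZ d (T : measurableType d) (R : realType) (mu : {measure set T -> \bar R})
  (c : R) (f : T -> R) : f \in Lfun mu 1 -> \int[mu]_x (c * f x) = c * \int[mu]_x f x.
Proof. by move=> hf; apply: RintegralZl => //; exact: Lfun1_int. Qed.

Lemma Lfun1_RintD d (T : measurableType d) (R : realType) (mu : {measure set T -> \bar R})
  (f g : T -> R) : f \in Lfun mu 1 -> g \in Lfun mu 1 ->
  \int[mu]_x (f x + g x) = \int[mu]_x f x + \int[mu]_x g x.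
Proof. by move=> hf hg; apply: RintegralD => //; exact: Lfun1_int. Qed.

Lemma Lfun1_RintB d (T : measurableType d) (R : realType) (mu : {measure set T -> \bar R})
  (f g : T -> R) : f \in Lfun mu 1 -> g \in Lfun mu 1 ->
  \int[mu]_x (f x - g x) = \int[mu]_x f x - \int[mu]_x g x.
Proof. by move=> hf hg; apply: RintegralB => //; exact: Lfun1_int. Qed.

(** * Densities of functionals on simple sections *)

Section densities.
Context {R : realType} {X : completeMetricType R}.
Variable nu : {measure set (borel X) -> \bar R}.
Variables p q : R.
Hypothesis p1 : 1 <= p.
Hypothesis q0 : 0 < q.
Hypothesis pq : p^-1 + q^-1 = 1.
Hypothesis sf : sigma_finite setT nu.
Variable a : borel X -> R.
Hypothesis ha : a \in Lfun nu q%:E.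
Hypothesis a0 : forall x, 0 <= a x.
Let p0 : 0 < p. Proof. exact: lt_le_trans p1. Qed.
Implicit Types (f u v h : borel X -> R) (o : borel X -> borel X -> R) (A B : set (borel X)).
Local Notation snorm := (section_norm nu p).
Local Notation simple := (simple_section nu p).

Variable L : (borel X -> borel X -> R) -> R.
Hypothesis LD : forall o1 o2, simple o1 -> simple o2 ->
  L (fun x => o1 x \+ o2 x) = L o1 + L o2.
Hypothesis LZ : forall (c : R) o, simple o -> L (fun x y => c * o x y) = c * L o.
Hypothesis L_le : forall o, simple o -> L o <= \int[nu]_x (a x * snorm o x).

Lemma weighted_norm_Lfun o : simple o -> (fun x => a x * snorm o x) \in Lfun nu 1.
Proof.
move=> [_ lo]; have -> : (fun x => a x * snorm o x) = (snorm o \* a)%R.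
  by apply/funext => x /=; rewrite mulrC.
exact: (Lfun_mul p0 q0 pq lo ha).
Qed.

Definition cutoff A o : borel X -> borel X -> R := fun x y => \1_A x * o x y.

Lemma measurable_mem A (b : bool) : measurable A ->
  measurable ((fun x : borel X => x \in A) @^-1` [set b]).
Proof.
move=> mA; have -> : (fun x : borel X => x \in A) @^-1` [set b] = if b then A else ~` A.
  apply/seteqP; split => x; rewrite /preimage /=.
    by case: b => [/set_mem//|h Ax]; move: h; rewrite mem_set.
  by case: b => [/mem_set//|h]; apply/negbTE/negP => /set_mem.
by case: b => //; exact: measurableC.
Qed.

Lemma simple_cutoff A o : measurable A -> simple o -> simple (cutoff A o).
Proof.
move=> mA so.
apply: (@simple_section_scale _ _ nu p p1 _ (fun b : bool => b%:R) (fun x => x \in A) 1) => //.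
- by move=> b; exact: measurable_mem.
- by apply: aeW => x; case: (x \in A); rewrite ?normr1 ?normr0.
Qed.

Lemma section_norm_cutoff A o : simple o ->
  \forall x \ae nu, snorm (cutoff A o) x = \1_A x * snorm o x.
Proof.
move=> [co _]; have := section_normZ p1 (fun b : bool => b%:R) (fun x => x \in A) co.
by apply: filterS => x ->; rewrite ger0_norm.
Qed.

Lemma measurable_weighted_norm o : simple o -> measurable_fun setT (fun x => a x * snorm o x).
Proof. by move=> so; exact: Lfun_measurable (weighted_norm_Lfun so). Qed.

Lemma L_cutoff_le A o : measurable A -> simple o ->
  L (cutoff A o) <= \int[nu]_(x in A) (a x * snorm o x).
Proof.
move=> mA so; have sA := simple_cutoff mA so; apply: (le_trans (L_le sA)).
rewrite -[X in _ <= \int[nu]_(x in X) _]setTI -Rint_indic//.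
rewrite le_eqVlt; apply/orP; left; apply/eqP; apply: eq_ae_Rint => //.
- exact: measurable_weighted_norm.
- by apply: measurable_funM; [exact: measurable_indic|exact: measurable_weighted_norm].
- by apply: filterS (section_norm_cutoff A so) => x ->; rewrite mulrCA.
Qed.

Lemma LN o : simple o -> L (fun x y => -1 * o x y) = - L o.
Proof. by move=> so; rewrite LZ// mulN1r. Qed.

Lemma L_cutoff_abs_le A o : measurable A -> simple o ->
  `|L (cutoff A o)| <= \int[nu]_(x in A) (a x * snorm o x).
Proof.
move=> mA so; rewrite ler_norml L_cutoff_le// andbT lerNl -LN; last exact: simple_cutoff.
have sN := simple_sectionZ p1 (-1) so.
have -> : (fun x y => -1 * cutoff A o x y) = cutoff A (fun x y => -1 * o x y).
  by apply/funext => x; apply/funext => y; rewrite /cutoff mulrCA.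
apply: (le_trans (L_cutoff_le mA sN)).
rewrite le_eqVlt; apply/orP; left; apply/eqP; apply: eq_ae_Rint => //.
- exact: measurable_weighted_norm.
- exact: measurable_weighted_norm.
- have [co _] := so.
  by apply: filterS (section_normZc p1 (-1) co) => x ->; rewrite normrN1 mul1r.
Qed.

Definition is_density o f :=
  f \in Lfun nu 1 /\ forall A, measurable A -> L (cutoff A o) = \int[nu]_(x in A) f x.

(** A |-> L (1_A o) is finitely additive and dominated by the integral of a |o|. *)
Lemma section_density_exists o : simple o -> exists f, is_density o f.
Proof.
move=> so.
have [| |A B mA mB AB|A mA|f hf fE] := @density_exists_sigma_finite _ _ _ nu sf
    (fun x => a x * snorm o x) (fun A => L (cutoff A o)).
- exact: weighted_norm_Lfun.
- by move=> x; rewrite mulr_ge0// section_norm_ge0.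
- rewrite -LD; [|exact: simple_cutoff..]; congr L; apply/funext => x; apply/funext => y.
  rewrite /cutoff /= -mulrDl; congr (_ * _); rewrite !indicE.
  have := in_setU x A B; have : (x \in A) && (x \in B) = false.
    by apply/negbTE; rewrite -in_setI AB in_set0.
  by case: (x \in A) => //=; case: (x \in B) => //= _ ->; rewrite ?addr0 ?add0r.
- exact: L_cutoff_abs_le.
- by exists f.
Qed.

Definition density o : borel X -> R := xget (cst 0) [set f | is_density o f].

Lemma densityP o : simple o -> is_density o (density o).
Proof.
by move=> /section_density_exists[f hf]; rewrite /density; case: xgetP => [g _ //|/(_ f)].
Qed.

Lemma measurable_density o : measurable_fun setT (density o).
Proof.
rewrite /density; case: xgetP => [g _ [hg _]|_]; first exact: Lfun_measurable hg.
exact: measurable_cst.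
Qed.

Lemma density_unique o f : simple o -> is_density o f -> \forall x \ae nu, density o x = f x.
Proof.
move=> so [hf fE]; have [hg gE] := densityP so.
by apply: eq_ae_of_integrals => // A mA; rewrite -gE// fE.
Qed.

Lemma density_abs_le o : simple o -> \forall x \ae nu, `|density o x| <= a x * snorm o x.
Proof.
move=> so; have [hf fE] := densityP so; have hw := weighted_norm_Lfun so.
have h1 : \forall x \ae nu, density o x <= a x * snorm o x.
  apply: le_ae_of_integrals => // A mA; rewrite -fE//; exact: L_cutoff_le.
have h2 : \forall x \ae nu, -1 * density o x <= a x * snorm o x.
  apply: le_ae_of_integrals => //; first exact: Lfun1Z.
  move=> A mA; rewrite RintegralZl//; last exact: Lfun1_int.
  rewrite -fE// mulN1r; apply: le_trans (L_cutoff_abs_le mA so).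
  by rewrite -normrN ler_norm.
by apply: filterS2 h1 h2 => x h1 h2; rewrite ler_norml h1 andbT; lra.
Qed.

Lemma densityD o1 o2 : simple o1 -> simple o2 ->
  \forall x \ae nu, density (fun x => o1 x \+ o2 x) x = density o1 x + density o2 x.
Proof.
move=> s1 s2; have [[h1 e1] [h2 e2]] := (densityP s1, densityP s2).
apply: density_unique; first exact: simple_sectionD.
split => [|A mA]; first exact: Lfun1D.
rewrite RintegralD//; [|exact: Lfun1_int..]; rewrite -e1// -e2// -LD; [|exact: simple_cutoff..].
by congr L; apply/funext => x; apply/funext => y; rewrite /cutoff /= mulrDr.
Qed.

Lemma densityZ (c : R) o : simple o ->
  \forall x \ae nu, density (fun x y => c * o x y) x = c * density o x.
Proof.
move=> so; have [h e] := densityP so.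
apply: density_unique; first exact: simple_sectionZ.
split => [|A mA]; first exact: Lfun1Z.
rewrite RintegralZl//; last exact: Lfun1_int.
rewrite -e// -LZ; last exact: simple_cutoff.
by congr L; apply/funext => x; apply/funext => y; rewrite /cutoff mulrCA.
Qed.

Lemma densityB o1 o2 : simple o1 -> simple o2 ->
  \forall x \ae nu, density (fun x => o1 x \- o2 x) x = density o1 x - density o2 x.
Proof.
move=> s1 s2; have sN := simple_sectionZ p1 (-1) s2.
have := densityD s1 sN.
have -> : (fun x => o1 x \+ (fun y => -1 * o2 x y)) = (fun x => o1 x \- o2 x).
  by apply/funext => x; apply/funext => y /=; rewrite mulN1r.
by apply: filterS2 (densityZ (-1) s2) => x -> ->; rewrite mulN1r.
Qed.

Lemma density_cutoff A o : measurable A -> simple o ->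
  \forall x \ae nu, density (cutoff A o) x = \1_A x * density o x.
Proof.
move=> mA so; have [h e] := densityP so.
apply: density_unique; first exact: simple_cutoff.
split => [|B mB]; first exact: Lfun1_indic.
rewrite Rint_indic// -e; last exact: measurableI.
by congr L; apply/funext => x; apply/funext => y; rewrite /cutoff mulrA indicI.
Qed.

(** On the set where the factor c has a given value, the product agrees with a
    multiple of o, and the density of a section on a set only depends on the
    restriction of the section to that set. *)
Lemma density_scale (I : countType) (c : I -> R) (j : borel X -> I) (M : R) o :
  (forall i, measurable (j @^-1` [set i])) -> (\forall x \ae nu, `|c (j x)| <= M) ->
  simple o ->
  \forall x \ae nu, density (fun x y => c (j x) * o x y) x = c (j x) * density o x.
Proof.
move=> mj cM so; have sc := simple_section_scale p1 mj cM so.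
have : \forall x \ae nu, forall n, if unpickle n is Some i then
    \1_(j @^-1` [set i]) x * density (fun x y => c (j x) * o x y) x =
    c i * (\1_(j @^-1` [set i]) x * density o x) else True.
  apply/ae_foralln => n; case: (@unpickle I n) => [i|]; last exact: aeW.
  have := densityZ (c i) (simple_cutoff (mj i) so).
  have -> : (fun x y => c i * cutoff (j @^-1` [set i]) o x y) =
      cutoff (j @^-1` [set i]) (fun x y => c (j x) * o x y).
    apply/funext => x; apply/funext => y; rewrite /cutoff indicE.
    case: (boolP (x \in _)) => [|_]; last by rewrite !mul0r mulr0.
    by rewrite inE /= => <-; rewrite !mul1r.
  by apply: filterS3 (density_cutoff (mj i) sc) (density_cutoff (mj i) so) => x -> ->.
apply: filterS => x /(_ (pickle (j x))); rewrite pickleK indicE mem_set//= => h.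
by move: h; rewrite !mul1r.
Qed.

Lemma integral_density o : simple o -> \int[nu]_x density o x = L o.
Proof.
move=> so; have [_ /(_ _ measurableT) <-] := densityP so.
by congr L; apply/funext => x; apply/funext => y; rewrite /cutoff indicT mul1r.
Qed.

End densities.

(** * Extension from simple sections to the cotangent module *)

Section extension_to_cotangent_module.
Context {R : realType} {X : completeMetricType R}.
Variable nu : {measure set (borel X) -> \bar R}.
Variables p q : R.
Hypothesis p1 : 1 <= p.
Hypothesis q0 : 0 < q.
Hypothesis pq : p^-1 + q^-1 = 1.
Variable a : borel X -> R.
Hypothesis ha : a \in Lfun nu q%:E.
Hypothesis a0 : forall x, 0 <= a x.
Let p0 : 0 < p. Proof. exact: lt_le_trans p1. Qed.
Implicit Types (f u v h : borel X -> R) (o : borel X -> borel X -> R) (w z : @cot R X).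
Local Notation snorm := (section_norm nu p).
Local Notation simple := (simple_section nu p).

Variable D : (borel X -> borel X -> R) -> borel X -> R.
Hypothesis mD : forall o, measurable_fun setT (D o).
Hypothesis D_le : forall o, simple o -> \forall x \ae nu, `|D o x| <= a x * snorm o x.
Hypothesis D_add : forall o1 o2, simple o1 -> simple o2 ->
  \forall x \ae nu, D (fun x => o1 x \+ o2 x) x = D o1 x + D o2 x.
Hypothesis D_sub : forall o1 o2, simple o1 -> simple o2 ->
  \forall x \ae nu, D (fun x => o1 x \- o2 x) x = D o1 x - D o2 x.
Hypothesis D_discretize : forall n h o, h \in Lfun nu +oo%E -> simple o ->
  \forall x \ae nu, D (fun x y => discretize n h x * o x y) x = discretize n h x * D o x.

Local Notation "'N_ p [ f ]" := (Lnorm nu p%:E (EFin \o f%R)).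

Lemma Lp_cvg_close (u v : nat -> borel X -> R) f : (forall n, measurable_fun setT (u n)) ->
  (forall n, measurable_fun setT (v n)) -> ('N_1[v n \- u n] @[n --> \oo] --> 0)%E ->
  Lp_cvg nu 1 u f -> Lp_cvg nu 1 v f.
Proof.
move=> mu_ mv vu [hf uf]; split => //; have mf := Lfun_measurable hf.
apply: squeeze_cvge0 (cvge0D vu uf) => n; rewrite Lnorm_ge0/=.
apply: Lnorm_triangle => //.
- exact: (measurable_funB (mv n) mf).
- exact: (measurable_funB (mv n) (mu_ n)).
- exact: (measurable_funB (mu_ n) mf).
apply: aeW => x /=; apply: le_trans (ler_normD _ _).
by rewrite addrA subrK.
Qed.

Lemma weighted_Lnorm_le o : simple o ->
  (Lnorm nu 1%:E (EFin \o (fun x => a x * snorm o x)%R) <= 'N_q[a] * 'N_p[snorm o])%E.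
Proof.
move=> [co lo]; have -> : (fun x => a x * snorm o x) = (snorm o \* a)%R.
  by apply/funext => x /=; rewrite mulrC.
rewrite muleC; apply: hoelder => //; last exact: Lfun_measurable ha.
exact: Lfun_measurable lo.
Qed.

Lemma D_Lnorm_le o : simple o -> ('N_1[D o] <= 'N_q[a] * 'N_p[snorm o])%E.
Proof.
move=> so; apply: le_trans (weighted_Lnorm_le so).
have mw := Lfun_measurable (weighted_norm_Lfun p1 q0 pq ha so).
apply: le_Lnorm => //; apply: filterS (D_le so) => x h.
by rewrite [leRHS]ger0_norm// mulr_ge0// section_norm_ge0.
Qed.

Lemma D_Lfun o : simple o -> D o \in Lfun nu 1.
Proof.
move=> so; apply: (Lfun_le ltr01 (mD o) (weighted_norm_Lfun p1 q0 pq ha so)).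
apply: filterS (D_le so) => x h.
by rewrite [leRHS]ger0_norm// mulr_ge0// section_norm_ge0.
Qed.

Let K := fine 'N_q[a].

Let KE : 'N_q[a] = K%:E.
Proof. by rewrite fineK// ge0_fin_numE ?Lnorm_ge0// (Lfun_lty ha). Qed.

Let K0 : 0 <= K. Proof. by rewrite -lee_fin -KE Lnorm_ge0. Qed.

Lemma D_sub_Lnorm o1 o2 : simple o1 -> simple o2 ->
  ('N_1[D o1 \- D o2] <= K%:E * 'N_p[snorm (fun x => o1 x \- o2 x)])%E.
Proof.
move=> s1 s2; rewrite -KE; apply: le_trans (D_Lnorm_le (simple_sectionB p1 s1 s2)).
apply: le_Lnorm => //; first exact: measurable_funB.
by apply: filterS (D_sub s1 s2) => x ->.
Qed.

(** By D_sub_Lnorm, D is Lipschitz from the norm of the cotangent module to L^1, so it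
    maps Cauchy sequences of families to convergent sequences. *)
Definition extension w : borel X -> R :=
  xget (cst 0) [set f | Lp_cvg nu 1 (fun n => D (section_of (w n))) f].

Lemma extension_cvg w : is_cot nu p w ->
  Lp_cvg nu 1 (fun n => D (section_of (w n))) (extension w).
Proof.
move=> hw; have [|e e0|f hf] := @Lp_complete _ _ _ nu 1 (fun n => D (section_of (w n))) (lexx 1).
- by move=> n; apply: D_Lfun; exact: cot_simple hw.
- have e' : 0 < e / (K + 1) by rewrite divr_gt0// ltr_wpDl.
  have [N hN] := cot_Cauchy p1 hw e'; exists N => m n Nm Nn.
  apply: le_lt_trans (D_sub_Lnorm (cot_simple p1 m hw) (cot_simple p1 n hw)) _.
  have := hN _ _ Nm Nn; move: (Lnorm_ge0 nu p%:E (EFin \o snorm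
     (fun x => section_of (w m) x \- section_of (w n) x))).
  case: ('N_p[_]) => [r| |]//; rewrite lee_fin !lte_fin => r0 hr.
  rewrite ltr_pdivlMr ?ltr_wpDl// in hr; apply: le_lt_trans hr.
  by rewrite mulrC ler_wpM2l// lerDl.
- by rewrite /extension; case: xgetP => [g _ //|/(_ f)].
Qed.

Lemma extension_unique w f : Lp_cvg nu 1 (fun n => D (section_of (w n))) f ->
  \forall x \ae nu, extension w x = f x.
Proof.
move=> hf; rewrite /extension; case: xgetP => [g _ hg|/(_ f)//].
by apply: (Lp_cvg_unique (lexx 1) _ hg hf).
Qed.

Lemma extension_le w : is_cot nu p w ->
  \forall x \ae nu, `|extension w x| <= a x * cot_ptnorm nu p w x.
Proof.
move=> hw; have hD := extension_cvg hw.
have hS n := cot_simple p1 n hw.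
have ms n : measurable_fun setT (snorm (section_of (w n))).
  by have [_ l] := hS n; exact: Lfun_measurable l.
have ma := Lfun_measurable ha.
have hN := Lp_cvg_mul p1 q0 pq ms ha (cot_ptnorm_cvg p1 hw).
have h1 : \forall x \ae nu, extension w x <= cot_ptnorm nu p w x * a x.
  apply: (Lp_cvg_le (lexx 1) _ _ _ hD hN) => n //; first exact: measurable_funM.
  apply: filterS (D_le (hS n)) => x h.
  by rewrite /= mulrC; apply: le_trans h; exact: ler_norm.
have h2 : \forall x \ae nu, (cst 0 : borel X -> R) x <= extension w x + cot_ptnorm nu p w x * a x.
  have msa n := measurable_funM (ms n) ma.
  have hc : Lp_cvg nu 1 (fun=> cst 0) (cst 0 : borel X -> R).
    by apply: Lp_cvg_cst => //; exact: Lfun0.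
  have hs := Lp_cvgD (lexx 1) (fun n => mD _) msa hD hN.
  apply: (Lp_cvg_le (lexx 1) _ _ _ hc hs) => n.
  - exact: measurable_cst.
  - exact: (measurable_funD (mD _) (msa n)).
  - apply: filterS (D_le (hS n)) => x; rewrite ler_norml => /andP[h _].
    by rewrite /= mulrC; lra.
by apply: filterS2 h1 h2 => x /= h1 h2; rewrite ler_norml; apply/andP; split; lra.
Qed.

Lemma extension_Lfun w : is_cot nu p w -> extension w \in Lfun nu 1.
Proof. by move=> /extension_cvg[]. Qed.

Lemma extension_eq w z : is_cot nu p w -> is_cot nu p z -> cot_eq nu p w z ->
  \forall x \ae nu, extension w x = extension z x.
Proof.
move=> hw hz wz; apply: extension_unique.
apply: (@Lp_cvg_close (fun n => D (section_of (z n)))) => //; last exact: extension_cvg.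
apply: squeeze_cvge0 (cvge0_scale K wz) => n; rewrite Lnorm_ge0/=.
apply: le_trans (D_sub_Lnorm (cot_simple p1 n hw) (cot_simple p1 n hz)) _.
by rewrite -(section_ofB p1 (hw.1 n) (hz.1 n)).
Qed.

Lemma extensionD w z : is_cot nu p w -> is_cot nu p z ->
  \forall x \ae nu, extension (cot_add w z) x = extension w x + extension z x.
Proof.
move=> hw hz; apply: (@extension_unique _ (extension w \+ extension z)).
apply: (@Lp_cvg_ae _ _ _ nu 1 (fun n => D (section_of (w n)) \+ D (section_of (z n)))%R) => //.
- by move=> n; exact: measurable_funD.
- move=> n; rewrite (section_ofD p1 (hw.1 n) (hz.1 n)).
  by apply: filterS (D_add (cot_simple p1 n hw) (cot_simple p1 n hz)) => x ->.
- by apply: Lp_cvgD => //; exact: extension_cvg.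
Qed.

Lemma measurable_discretize n h : measurable_fun setT h -> measurable_fun setT (discretize n h).
Proof.
move=> mh; apply: measurable_funM => //.
have mf : measurable_fun setT (fun x : R => (Num.floor x)%:~R : R).
  by apply: nondecreasing_measurable => // x y xy; rewrite ler_int; exact: le_floor.
by apply: (measurableT_comp mf); exact: measurable_funM.
Qed.

(** The discretized factors converge to h uniformly and are uniformly bounded. *)
Lemma extensionM h w : h \in Lfun nu +oo%E -> is_cot nu p w ->
  \forall x \ae nu, extension (cot_mul h w) x = h x * extension w x.
Proof.
move=> hL hw; have mh := Lfun_measurable hL; have [M hM] := Lfun_bounded hL.
have [eL ecv] := extension_cvg hw; have me := Lfun_measurable eL.
have heL : (fun x => h x * extension w x) \in Lfun nu 1.
  apply: (Lfun_le ltr01 _ (Lfun1Z M eL)); first exact: measurable_funM.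
  apply: filterS hM => x hx; rewrite !normrM ler_wpM2r//.
  by apply: (le_trans hx); exact: ler_norm.
apply: extension_unique; split => //.
have r0 : (fun n => (`|M| + 1)%:E * 'N_1[D (section_of (w n)) \- extension w] +
    (fine 'N_1[extension w])%:E * (n.+1%:R^-1 : R)%:E)%E @ \oo --> 0%E.
  by apply: cvge0D; apply: cvge0_scale => //; exact: cvge_harmonic.
apply: squeeze_cvge0 r0 => n; rewrite Lnorm_ge0/=.
have M0 : 0 <= `|M| + 1 by rewrite addr_ge0.
have md := measurable_discretize n mh.
have mDn := mD (section_of (w n)).
have mdD := measurable_funB mDn me.
rewrite fineK; last by rewrite ge0_fin_numE ?Lnorm_ge0// (Lfun_lty eL).
rewrite [X in (_ + X)%E]muleC -[`|M| + 1]ger0_norm// -Lnorm_scale//.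
rewrite -[n.+1%:R^-1]ger0_norm// -Lnorm_scale//.
rewrite (section_ofM p1 n mh (hw.1 n)).
apply: Lnorm_triangle => //.
- by apply: measurable_funB => //; exact: measurable_funM.
- exact: measurable_funM.
- exact: measurable_funM.
apply: filterS3 (D_discretize n hL (cot_simple p1 n hw)) hM
  (discretize_bounded n hM) => x /= -> hx dx.
move: (discretize_dist n h x) dx; move: (discretize n h x) => t th dx.
have -> : t * D (section_of (w n)) x - h x * extension w x =
  t * (D (section_of (w n)) x - extension w x) + (t - h x) * extension w x by lra.
apply: (le_trans (ler_normD _ _)); rewrite !normrM; apply: lerD; apply: ler_wpM2r => //.
  by apply: (le_trans dx); rewrite [leRHS]ger0_norm// lerD2r ler_norm.
by rewrite [leRHS]ger0_norm.
Qed.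

Lemma extension_vector_field : vector_field nu p extension.
Proof.
split.
- exact: extension_Lfun.
- by move=> w z hw hz wz; apply/ae_eqW; exact: extension_eq.
- by move=> w z hw hz; apply/ae_eqW; exact: extensionD.
- by move=> h w hL hw; apply/ae_eqW; exact: extensionM.
- exists K => w hw; have [cL _] := cot_ptnorm_cvg p1 hw.
  have mc := Lfun_measurable cL; have me := Lfun_measurable (extension_Lfun hw).
  rewrite /cot_norm -KE muleC.
  apply: le_trans (hoelder nu mc (Lfun_measurable ha) p0 q0 pq).
  apply: le_Lnorm => //; first exact: (measurable_funM mc (Lfun_measurable ha)).
  apply: filterS (extension_le hw) => x h /=; rewrite mulrC; apply: (le_trans h).
  exact: ler_norm.
Qed.

Lemma extension_differential u : D1p nu p u ->
  \forall x \ae nu, extension (differential u) x = D (fun=> u) x.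
Proof.
move=> Du; apply: extension_unique; have [_ E] := partitioned_of p1 Du.
have -> : (fun n => D (section_of (differential u n))) = fun=> D (fun=> u).
  by apply/funext => n; rewrite /differential E.
by apply: Lp_cvg_cst => //; apply: D_Lfun; exact: simple_section_cst.
Qed.

End extension_to_cotangent_module.

(** * Vector fields from functionals on functions *)

Section vector_field_of_functional.
Context {R : realType} {X : completeMetricType R}.
Variable nu : {measure set (borel X) -> \bar R}.
Variables p q : R.
Hypothesis p1 : 1 <= p.
Hypothesis q0 : 0 < q.
Hypothesis pq : p^-1 + q^-1 = 1.
Hypothesis sf : sigma_finite setT nu.
Let p0 : 0 < p. Proof. exact: lt_le_trans p1. Qed.
Local Notation snorm := (section_norm nu p).
Local Notation simple := (simple_section nu p).

(** The functional l on functions, seen as constant sections, extends by the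
    Hahn-Banach theorem to all simple sections, below the weighted norm
    o |-> int a |o|. The extension is the integral of a density D o with
    |D o| <= a |o|, which depends on o locally; D then extends to the cotangent
    module. *)
Theorem vector_field_of_functional (a : borel X -> R) (M0 : set (borel X -> R))
    (l : (borel X -> R) -> R) : a \in Lfun nu q%:E -> (forall x, 0 <= a x) ->
  M0 (fun=> 0) ->
  (forall (c : R) u v, M0 u -> M0 v -> M0 (fun x => c * u x + v x)) ->
  (forall u, M0 u -> D1p nu p u) ->
  (forall (c : R) u v, M0 u -> M0 v -> l (fun x => c * u x + v x) = c * l u + l v) ->
  (forall u, M0 u -> l u <= \int[nu]_x (a x * grad_norm nu p u x)) ->
  exists Y, [/\ vector_field nu p Y,
    forall w, is_cot nu p w -> \forall x \ae nu, `|Y w x| <= a x * cot_ptnorm nu p w x &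
    forall u, M0 u -> \int[nu]_x Y (differential u) x = l u].
Proof.
move=> ha a0 M00 M0l M0D ll lle.
pose V := borel X -> borel X -> R^o.
pose S : set V := [set o | simple o].
pose M : set V := [set o | exists2 u, M0 u & o = fun=> u].
(* l' is only used on constant sections, so the evaluation point is immaterial *)
pose l' (o : V) : R := l (o (point : X)).
pose N (o : V) : R := \int[nu]_x (a x * snorm o x).
have wL o : simple o -> (fun x => a x * snorm o x) \in Lfun nu 1.
  exact: (weighted_norm_Lfun p1 q0 pq ha).
have wI o : simple o -> nu.-integrable setT (EFin \o (fun x => a x * snorm o x)).
  by move=> so; exact: Lfun1_int (wL _ so) measurableT.
have subM : is_subspace M.
  split; first by exists (fun=> 0).
  by move=> c _ _ [u Mu ->] [v Mv ->]; exists (fun x => c * u x + v x) => //; exact: M0l.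
have subS : is_subspace S.
  split; first exact: (simple_section_cst p1 (D1p0 nu p0)).
  by move=> c o1 o2 s1 s2; exact: (simple_sectionD p1 (simple_sectionZ p1 c s1) s2).
have MS : M `<=` S.
  by move=> _ [u Mu ->]; apply: (simple_section_cst p1); exact: M0D.
have subN : sublinear_on S N.
  split; [move=> o1 o2 s1 s2|move=> c o c0 so].
    have s12 := simple_sectionD p1 s1 s2.
    rewrite /N -RintegralD//; [|exact: wI..].
    apply: le_ae_Rint => //; [exact: wL|by apply: Lfun1D; exact: wL|].
    apply: filterS (section_normD p1 s1.1 s2.1) => x h.
    by rewrite -mulrDr ler_wpM2l.
  rewrite /N -RintegralZl//; last exact: wI.
  have sc := simple_sectionZ p1 c so.
  apply: eq_ae_Rint => //.
  - exact: Lfun_measurable (wL _ sc).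
  - by apply: measurable_funM => //; exact: Lfun_measurable (wL _ so).
  - apply: filterS (section_normZc p1 c so.1) => x h.
    have -> : snorm (c *: o) x = c * snorm o x by rewrite [LHS]h ger0_norm.
    by rewrite mulrCA.
have lM : linear_on M l'.
  by move=> c _ _ [u Mu ->] [v Mv ->]; rewrite /l' -ll.
have lN o : M o -> l' o <= N o by move=> [u Mu ->]; exact: lle.
have [L [Llin LM LN]] := Hahn_Banach subM subS MS subN lM lN.
have LD o1 o2 : simple o1 -> simple o2 -> L (fun x => o1 x \+ o2 x) = L o1 + L o2.
  move=> s1 s2; have := Llin 1 o1 o2 s1 s2; rewrite mul1r => <-; congr L.
  by rewrite scale1r.
have S0 : simple (0 : V) by exact: subS.1.
have L0 : L (0 : V) = 0.
  have := Llin 1 0 0 S0 S0; rewrite mul1r scale1r addr0 => h.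
  by apply: (addrI (L 0)); rewrite addr0 -h.
have LZ (c : R) o : simple o -> L (fun x y => c * o x y) = c * L o.
  by move=> so; have := Llin c o 0 so S0; rewrite L0 !addr0.
have dens := densityP p1 q0 pq sf ha a0 LD LZ LN.
pose D := density nu L.
have D_discretize n (h : borel X -> R) o : h \in Lfun nu +oo%E -> simple o ->
    \forall x \ae nu, D (fun x y => discretize n h x * o x y) x = discretize n h x * D o x.
  move=> hL so; have [m hm] := Lfun_bounded hL; have mh := Lfun_measurable hL.
  apply: (density_scale p1 q0 pq sf ha a0 LD LZ LN (c := fun k : int => k%:~R / n.+1%:R)
    (j := fun x => Num.floor (n.+1%:R * h x)) (M := m + 1)) => //.
  - by move=> k; exact: measurable_floor_level.
  - exact: discretize_bounded.
have D_le := density_abs_le p1 q0 pq sf ha a0 LD LZ LN.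
have D_add := densityD p1 q0 pq sf ha a0 LD LZ LN.
have D_sub := densityB p1 q0 pq sf ha a0 LD LZ LN.
have mD := @measurable_density _ _ nu L.
exists (extension nu D); split.
- exact: (extension_vector_field p1 q0 pq ha a0 mD D_le D_add D_sub D_discretize).
- move=> w; exact: (extension_le p1 q0 pq ha a0 mD D_le D_sub).
- move=> u Mu; have Du := M0D u Mu; have so := simple_section_cst p1 Du.
  have eD := extension_differential p1 q0 pq ha a0 mD D_le Du.
  have eL := extension_Lfun p1 q0 pq ha a0 mD D_le D_sub (is_cot_differential p1 Du).
  rewrite (eq_ae_Rint measurableT (Lfun_measurable eL) (mD _) eD).
  rewrite (integral_density p1 q0 pq sf ha a0 LD LZ LN so) LM//.
  by exists u.
Qed.

End vector_field_of_functional.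

(** * The Cheeger energy *)

Section energy.
Context {R : realType} {X : completeMetricType R}.
Variable nu : {measure set (borel X) -> \bar R}.
Variables p q : R.
Hypothesis p1 : 1 < p.
Hypothesis pq : p^-1 + q^-1 = 1.
Let p1' : 1 <= p. Proof. exact: ltW. Qed.
Let p0 : 0 < p. Proof. exact: lt_le_trans p1'. Qed.
Implicit Types (f g u v w : borel X -> R).
Local Notation gn := (grad_norm nu p).

Lemma conjugate_gt0 : 0 < q.
Proof.
rewrite -invr_gt0; have -> : q^-1 = 1 - p^-1 by rewrite -pq addrC addKr.
by rewrite subr_gt0 invf_lt1.
Qed.
Let q0 := conjugate_gt0.

Lemma conjugate_mul : (p - 1) * q = p.
Proof.
have pn : p != 0 by rewrite gt_eqF.
have qn : q != 0 by rewrite gt_eqF.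
have : p * q * (p^-1 + q^-1) = p * q by rewrite pq mulr1.
rewrite mulrDr -!mulrA divff// mulr1 [p * (q / p)]mulrCA divff// mulr1 => h.
by rewrite mulrBl mul1r -h addrC addKr.
Qed.

Lemma powR_conjugate (s : R) : 0 <= s -> (s `^ (p - 1)) `^ q = s `^ p.
Proof. by move=> s0; rewrite -powRrM conjugate_mul. Qed.

Lemma powR_split (s : R) : 0 <= s -> s `^ (p - 1) * s = s `^ p.
Proof.
move=> s0; have [->|sn] := eqVneq s 0; first by rewrite mulr0 powR0 ?gt_eqF.
by rewrite -{2}[s]powRr1// -powRD ?subrK// sn implybT.
Qed.

(** Young's inequality, read as: the graph of t |-> t ^ p / p lies above its tangent
    at s. *)
Lemma powR_tangent (s t : R) : 0 <= s -> 0 <= t ->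
  s `^ (p - 1) * t <= p^-1 * t `^ p + (1 - p^-1) * s `^ p.
Proof.
move=> s0 t0; have := conjugate_powR t0 (powR_ge0 s (p - 1)) p0 q0 pq.
rewrite powR_conjugate// mulrC; have -> : 1 - p^-1 = q^-1 by rewrite -pq addrC addKr.
by rewrite ![_ / _]mulrC.
Qed.

Lemma Lfun_ae (r : R) f g : 0 < r -> measurable_fun setT f -> g \in Lfun nu r%:E ->
  (\forall x \ae nu, f x = g x) -> f \in Lfun nu r%:E.
Proof. by move=> r0 mf hg fg; apply: (Lfun_le r0 mf hg); apply: filterS fg => x ->. Qed.

Lemma pow_Lfun u : (forall x, 0 <= u x) -> u \in Lfun nu p%:E -> (fun x => u x `^ p) \in Lfun nu 1.
Proof.
move=> u0 hu; apply/Lfun1_integrable; have := Lfun_integrable p1' hu.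
have -> // : (fun x => (`|u x| `^ p)%:E) = EFin \o (fun x => u x `^ p).
by apply/funext => x /=; rewrite ger0_norm.
Qed.

Lemma powB1_Lfun u : (forall x, 0 <= u x) -> u \in Lfun nu p%:E ->
  (fun x => u x `^ (p - 1)) \in Lfun nu q%:E.
Proof.
move=> u0 hu; apply/(Lfun_powerP _ _ q0); split.
  by apply: (measurableT_comp (measurable_powR (p - 1))); exact: Lfun_measurable hu.
rewrite /power_integral; have -> : (\int[nu]_x (`|u x `^ (p - 1)| `^ q)%:E =
    \int[nu]_x (u x `^ p)%:E)%E.
  by apply: eq_integral => x _; rewrite ger0_norm ?powR_ge0// powR_conjugate.
by rewrite -(Lfun1_Rint (pow_Lfun u0 hu) measurableT) ltry.
Qed.

Lemma grad_norm_pow_Lfun u : D1p nu p u -> (fun x => gn u x `^ p) \in Lfun nu 1.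
Proof. by move=> Du; apply: pow_Lfun (grad_norm_Lfun p0 Du) => x; exact: grad_norm_ge0. Qed.

Lemma grad_norm_powB1_Lfun u : D1p nu p u -> (fun x => gn u x `^ (p - 1)) \in Lfun nu q%:E.
Proof. by move=> Du; apply: powB1_Lfun (grad_norm_Lfun p0 Du) => x; exact: grad_norm_ge0. Qed.

Definition energy u : R := \int[nu]_x (gn u x `^ p).

Lemma energy_ge0 u : 0 <= energy u.
Proof. by apply: Rintegral_ge0 => x _; exact: powR_ge0. Qed.

Lemma energy_ae u v : D1p nu p u -> D1p nu p v -> (\forall x \ae nu, u x = v x) ->
  energy u = energy v.
Proof.
move=> Du Dv uv; apply: eq_ae_Rint => //.
- exact: Lfun_measurable (grad_norm_pow_Lfun Du).
- exact: Lfun_measurable (grad_norm_pow_Lfun Dv).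
- by apply: filterS (grad_norm_ae_eq p0 Du Dv uv) => x ->.
Qed.

Lemma W1p_reprP f : class_W1p nu p f ->
  (\forall x \ae nu, W1p_repr nu p f x = f x) /\ W1p nu p (W1p_repr nu p f).
Proof.
move=> [g gf Wg]; rewrite /W1p_repr; case: xgetP => [h _ [hf Wh]|/(_ g)/(_ (conj gf Wg))//].
by split => //; exact/ae_eqW.
Qed.

Lemma cheegerE f g : W1p nu p g -> (\forall x \ae nu, g x = f x) ->
  cheeger nu p f = (p^-1 * energy g)%:E.
Proof.
move=> Wg gf; have cf : class_W1p nu p f by exists g => //; exact/ae_eqW.
have [rf [Dr _]] := W1p_reprP cf; rewrite /cheeger asboolT//.
rewrite -(Lfun1_Rint (grad_norm_pow_Lfun Dr) measurableT) -EFinM -/(energy _).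
rewrite (@energy_ae _ g) => //; first by case: Wg.
by apply: filterS2 rf gf => x -> ->.
Qed.

Lemma cheeger_lty f : (cheeger nu p f < +oo)%E -> class_W1p nu p f.
Proof. by rewrite /cheeger; case: asboolP. Qed.

Lemma W1p_lin (c : R) u v : W1p nu p u -> W1p nu p v -> W1p nu p (fun x => c * u x + v x).
Proof.
move=> [Du Lu] [Dv Lv]; split; first exact: (D1pD p0 (D1pZ c Du) Dv).
apply: (LfunD p1' (f := fun x => c * u x) _ Lv).
exact: LfunZ.
Qed.

Lemma d_ptnormE f : class_W1p nu p f ->
  \forall x \ae nu, d_ptnorm nu p f x = gn (W1p_repr nu p f) x.
Proof. by move=> /W1p_reprP[_ [Dr _]]; exact: (cot_ptnorm_differential p1' Dr). Qed.

Lemma energy_d_ptnorm f : class_W1p nu p f ->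
  \int[nu]_x (d_ptnorm nu p f x `^ p) = energy (W1p_repr nu p f).
Proof.
move=> cf; have [_ [Dr _]] := W1p_reprP cf; apply: eq_ae_Rint => //.
- apply: (measurableT_comp (measurable_powR p)).
  exact: Lfun_measurable (cot_ptnorm_Lfun p1' (is_cot_differential p1' Dr)).
- exact: Lfun_measurable (grad_norm_pow_Lfun Dr).
- by apply: filterS (d_ptnormE cf) => x ->.
Qed.

End energy.

(** * First variation of the Cheeger energy *)

Section first_variation.
Context {R : realType} {X : completeMetricType R}.
Variable nu : {measure set (borel X) -> \bar R}.
Variables p q : R.
Hypothesis p1 : 1 < p.
Hypothesis pq : p^-1 + q^-1 = 1.
Let p1' : 1 <= p. Proof. exact: ltW. Qed.
Let p0 : 0 < p. Proof. exact: lt_le_trans p1'. Qed.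
Let q0 : 0 < q. Proof. exact: (conjugate_gt0 p1 pq). Qed.
Implicit Types (f g u v w : borel X -> R).
Local Notation gn := (grad_norm nu p).
Local Notation energy := (energy nu p).

Lemma eq_le_eq (x x' y y' : R) : x = x' -> x' <= y' -> y' = y -> x <= y.
Proof. by move=> -> h <-. Qed.

Lemma difference_quotient_le (x y i j e : R) : 0 < e ->
  x <= y + e * j -> y - e * i <= x -> - i <= j.
Proof. by move=> e0 h1 h2; rewrite -(ler_pM2l e0) mulrN; lra. Qed.

Lemma scaling_le (s a E i c : R) : 0 < s -> 0 <= E ->
  a <= c + (1 - c) * (a * (1 - s)) -> c * E - - s * i <= c * (a * (1 - s) * E) -> a * E <= - i.
Proof.
move=> s0 E0 h1 h2; rewrite -(ler_pM2l s0).
by have := ler_wpM2r E0 h1; lra.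
Qed.

Lemma L2_mul u v : u \in Lfun nu 2%:E -> v \in Lfun nu 2%:E -> (fun x => u x * v x) \in Lfun nu 1.
Proof. by apply: (@Lfun_mul _ _ _ nu 2 2) => //; lra. Qed.

Lemma L2Z (c : R) u : u \in Lfun nu 2%:E -> (fun x => c * u x) \in Lfun nu 2%:E.
Proof. by apply: LfunZ; lra. Qed.

(** The tangent inequality at the point s = A + e B, of slope s ^ (p - 1). *)
Lemma powR_difference (A B e : R) : 0 <= A -> 0 <= B -> 0 <= e ->
  p^-1 * (A + e * B) `^ p <= p^-1 * A `^ p + e * (B * (A + e * B) `^ (p - 1)).
Proof.
move=> A0 B0 e0; have s0 : 0 <= A + e * B by rewrite addr_ge0// mulr_ge0.
have := powR_tangent p1 pq s0 A0; rewrite -(powR_split p1 s0).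
by move: (_ `^ (p - 1)) => t; lra.
Qed.

(** Dominated convergence, with the majorant B (A + B) ^ (p - 1). *)
Lemma slope_cvg (A B : borel X -> R) : (forall x, 0 <= A x) -> (forall x, 0 <= B x) ->
  A \in Lfun nu p%:E -> B \in Lfun nu p%:E ->
  (\int[nu]_x (B x * (A x + n.+1%:R^-1 * B x) `^ (p - 1))%:E)%E @[n --> \oo] -->
    (\int[nu]_x (B x * A x `^ (p - 1))%:E)%E.
Proof.
move=> A0 B0 hA hB; have [mA mB] := (Lfun_measurable hA, Lfun_measurable hB).
have mpow f : measurable_fun setT f -> measurable_fun setT (fun x => f x `^ (p - 1)).
  by move=> mf; apply: (measurableT_comp (measurable_powR (p - 1))).
have hAB : (fun x => B x * (A x + B x) `^ (p - 1)) \in Lfun nu 1.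
  apply: (Lfun_mul p0 q0 pq hB); apply: (powB1_Lfun p1 pq (u := A \+ B)) => [x|].
    by rewrite addr_ge0.
  exact: LfunD.
have [] // := @dominated_convergence _ _ _ nu setT measurableT
  (fun n x => (B x * (A x + n.+1%:R^-1 * B x) `^ (p - 1))%:E)
  (fun x => (B x * A x `^ (p - 1))%:E) (fun x => (B x * (A x + B x) `^ (p - 1))%:E).
- move=> n; apply/measurable_EFinP; apply: measurable_funM => //; apply: mpow.
  by apply: measurable_funD => //; exact: measurable_funM.
- by apply/measurable_EFinP; apply: measurable_funM => //; exact: mpow.
- apply: aeW => x _; apply: cvg_EFin; first exact: nearW.
  apply: cvgM; first exact: cvg_cst.
  apply: cvg_powR; first by rewrite subr_gt0.
    by move=> n; rewrite addr_ge0// mulr_ge0.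
  rewrite -[X in _ --> X]addr0; apply: cvgD; first exact: cvg_cst.
  rewrite -(mul0r (B x)); apply: cvgM; [exact: cvg_harmonic|exact: cvg_cst].
- exact: (Lfun1_int hAB measurableT).
- apply: aeW => x n _; rewrite lee_fin ger0_norm ?mulr_ge0 ?powR_ge0//.
  apply: ler_wpM2l => //; apply: ler_pow; first by rewrite subr_ge0.
    by rewrite addr_ge0// mulr_ge0.
  by rewrite lerD2l ler_piMl// invf_le1// ler1n.
Qed.

Variables f v : borel X -> R.
Hypothesis Wf : W1p nu p f.
Hypothesis L2f : f \in Lfun nu 2%:E.
Hypothesis L2v : v \in Lfun nu 2%:E.
Hypothesis minimal : forall g, W1p nu p g -> g \in Lfun nu 2%:E ->
  p^-1 * energy f - \int[nu]_x (v x * g x) <= p^-1 * energy (fun x => f x + g x).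

Let Df : D1p nu p f := Wf.1.

(** The energies of f and f + w / (n + 1) are compared, and the difference is divided
    by 1 / (n + 1). *)
Lemma first_variation_le w : W1p nu p w -> w \in Lfun nu 2%:E ->
  - (\int[nu]_x (v x * w x)) <= \int[nu]_x (gn f x `^ (p - 1) * gn w x).
Proof.
move=> Ww L2w; have Dw := Ww.1.
have gf0 x : 0 <= gn f x := grad_norm_ge0 nu p f x.
have gw0 x : 0 <= gn w x := grad_norm_ge0 nu p w x.
have [hA hB] := (grad_norm_Lfun p0 Df, grad_norm_Lfun p0 Dw).
have lim := slope_cvg gf0 gw0 hA hB.
have hE n : (fun x => gn w x * (gn f x + n.+1%:R^-1 * gn w x) `^ (p - 1)) \in Lfun nu 1.
  apply: (Lfun_mul p0 q0 pq hB).
  apply: (powB1_Lfun p1 pq (u := fun x => gn f x + n.+1%:R^-1 * gn w x)) => [x|].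
    by rewrite addr_ge0// mulr_ge0.
  exact: (LfunD p1' hA (LfunZ n.+1%:R^-1 p1' hB)).
have hl : (fun x => gn w x * gn f x `^ (p - 1)) \in Lfun nu 1.
  exact: (Lfun_mul p0 q0 pq hB (grad_norm_powB1_Lfun p1 pq Df)).
have step n : - (\int[nu]_x (v x * w x)) <=
    \int[nu]_x (gn w x * (gn f x + n.+1%:R^-1 * gn w x) `^ (p - 1)).
  set e : R := n.+1%:R^-1; have e0 : 0 < e by rewrite /e.
  have Wew : W1p nu p (fun x => e * w x) by split; [exact: D1pZ|exact: LfunZ Ww.2].
  have := minimal Wew (L2Z e L2w).
  have -> : \int[nu]_x (v x * (e * w x)) = e * \int[nu]_x (v x * w x).
    rewrite -(Lfun1_RintZ e (L2_mul L2v L2w)).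
    by apply: eq_Rintegral => x _; rewrite mulrCA.
  have Df' : D1p nu p (fun x => f x + e * w x) := D1pD p0 Df Wew.1.
  have hs : (fun x => p^-1 * gn f x `^ p) \in Lfun nu 1 := Lfun1Z p^-1 (grad_norm_pow_Lfun p1 Df).
  have hs' := Lfun1Z e (hE n).
  have : p^-1 * energy (fun x => f x + e * w x) <= p^-1 * energy f +
      e * \int[nu]_x (gn w x * (gn f x + e * gn w x) `^ (p - 1)).
    have eL := Lfun1_RintZ p^-1 (grad_norm_pow_Lfun p1 Df').
    have eR := etrans (Lfun1_RintD hs hs') (congr2 +%R
      (Lfun1_RintZ p^-1 (grad_norm_pow_Lfun p1 Df)) (Lfun1_RintZ e (hE n))).
    apply: (eq_le_eq (esym eL) _ eR).
    apply: (le_ae_Rint measurableT (Lfun1Z p^-1 (grad_norm_pow_Lfun p1 Df')) (Lfun1D hs hs')).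
    apply: filterS2 (grad_normD p0 Df Wew.1) (grad_normZ p0 e Dw) => x h1 h2.
    have h3 : gn (f \+ (fun x => e * w x)) x <= gn f x + e * gn w x.
      by apply: (le_trans h1); rewrite h2 (ger0_norm (ltW e0)).
    apply: le_trans (powR_difference (gf0 x) (gw0 x) (ltW e0)).
    rewrite ler_pM2l ?invr_gt0//; apply: (ler_pow (ltW p0) _ h3).
    exact: grad_norm_ge0.
  exact: difference_quotient_le e0.
have -> : \int[nu]_x (gn f x `^ (p - 1) * gn w x) = \int[nu]_x (gn w x * gn f x `^ (p - 1)).
  by apply: eq_Rintegral => x _; rewrite mulrC.
rewrite -lee_fin (Lfun1_Rint hl measurableT) -(cvg_lim _ lim)//.
apply: lime_ge; first by apply/cvg_ex; eexists; exact: lim.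
by apply: nearW => n; rewrite -(Lfun1_Rint (hE n) measurableT) lee_fin.
Qed.

(** The energies of f and of its multiples t f, with t = 1 - 1 / (n + 1), are compared. *)
Lemma first_variation_self : energy f <= - \int[nu]_x (v x * f x).
Proof.
pose t n : R := 1 - harmonic n.
have t0 n : 0 <= t n by rewrite subr_ge0 /= invf_le1// ler1n.
have t1 n : 0 < harmonic n :> R by exact: harmonic_gt0.
have hvf := L2_mul L2v L2f.
have step n : t n `^ (p - 1) * energy f <= - \int[nu]_x (v x * f x).
  have Wtf : W1p nu p (fun x => - harmonic n * f x).
    by split; [exact: D1pZ|exact: LfunZ Wf.2].
  have := minimal Wtf (L2Z _ L2f).
  have -> : \int[nu]_x (v x * (- harmonic n * f x)) = - harmonic n * \int[nu]_x (v x * f x).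
    rewrite -(Lfun1_RintZ _ hvf).
    by apply: eq_Rintegral => x _; rewrite mulrCA.
  have -> : energy (fun x => f x + - harmonic n * f x) = t n `^ p * energy f.
    have -> : (fun x => f x + - harmonic n * f x) = (fun x => t n * f x).
      by apply/funext => x; rewrite /t mulrBl mul1r mulNr.
    have hP := grad_norm_pow_Lfun p1 Df.
    rewrite /energy -(Lfun1_RintZ _ hP).
    apply: eq_ae_Rint => //.
    - exact: Lfun_measurable (grad_norm_pow_Lfun p1 (D1pZ (t n) Df)).
    - exact: Lfun_measurable (Lfun1Z _ hP).
    - apply: filterS (grad_normZ p0 (t n) Df) => x ->.
      by rewrite (ger0_norm (t0 n)) powRM// grad_norm_ge0.
  have tan := powR_tangent p1 pq (t0 n) ler01; rewrite powR1 !mulr1 in tan.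
  rewrite -(powR_split p1 (t0 n)) in tan *.
  exact: (scaling_le (t1 n) (energy_ge0 nu p f) tan).
have tl : t n `^ (p - 1) * energy f @[n --> \oo] --> 1 * energy f.
  apply: cvgM; last exact: cvg_cst.
  have pm : 0 < p - 1 by rewrite subr_gt0.
  suff : t n @[n --> \oo] --> (1 : R) by move/(cvg_powR pm t0); rewrite powR1.
  rewrite -[X in _ --> X]subr0; apply: cvgB; first exact: cvg_cst.
  exact: cvg_harmonic.
rewrite -[energy f]mul1r -(cvg_lim (@Rhausdorff R) tl).
apply: limr_le; first by apply/cvg_ex; eexists; exact: tl.
by apply: nearW => n; exact: step.
Qed.

End first_variation.

(** * Pointwise norm of vector fields *)

(** The balls with a common centre and integer radii exhaust the space. *)
Lemma finite_on_bounded_sigma_finite (R : realType) (X : completeMetricType R)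
    (nu : {measure set (borel X) -> \bar R}) :
  finite_on_bounded nu -> sigma_finite setT nu.
Proof.
move=> hb; pose B n : set (borel X) := interior (ball (point : X) n%:R).
have mB n : measurable (B n) by apply: sub_sigma_algebra; exact: open_interior.
exists B => [|n].
  apply/seteqP; split => // x _.
  have [N hN] : exists N, (mdist (point : X) x < N%:R).
    by exists (Num.truncn (mdist (point : X) x)).+1; exact: truncnS_gt.
  exists N.+1 => //; rewrite /B /interior /=; apply/nbhs_ballP; exists 1 => //= y xy.
  rewrite -natr1; apply: ball_triangle xy.
  by rewrite ballEmdist.
by split => //; apply: hb => //; exists point, n%:R; exact: interior_subset.
Qed.

Section pointwise_norm_of_vector_fields.
Context {R : realType} {X : completeMetricType R}.
Variable nu : {measure set (borel X) -> \bar R}.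
Variable p : R.
Hypothesis p1 : 1 <= p.
Hypothesis sf : sigma_finite setT nu.
Let p0 : 0 < p. Proof. exact: lt_le_trans p1. Qed.
Implicit Types (f u v h : borel X -> R) (w : @cot R X) (Y : @cot R X -> borel X -> R).
Local Notation gn := (grad_norm nu p).

Lemma vector_field_null Y w : vector_field nu p Y -> is_cot nu p w ->
  (\forall x \ae nu, cot_ptnorm nu p w x = 0) -> \forall x \ae nu, Y w x = 0.
Proof.
move=> [YL _ _ _ [C hC]] hw w0; have := hC w hw; rewrite /cot_norm Lnorm_ae0//; last first.
  exact: Lfun_measurable (cot_ptnorm_Lfun p1 hw).
rewrite mule0 => h; have N0 : Lnorm nu 1 (EFin \o Y w) = 0%E.
  by apply: le_anti; rewrite h Lnorm_ge0.
have mY : measurable_fun setT (EFin \o Y w).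
  by apply/measurable_EFinP; exact: Lfun_measurable (YL w hw).
have := Lnorm_eq0_eq0 mY lte01 N0.
by apply: filterS => x /(_ I) /= [].
Qed.

Lemma is_cot0 : is_cot nu p (differential (cst 0)).
Proof. by apply: (is_cot_differential p1); exact: D1p0. Qed.

Lemma cot_ptnorm0 : \forall x \ae nu, cot_ptnorm nu p (differential (cst 0)) x = 0.
Proof.
have D0 := @D1p0 _ _ nu p p0.
apply: filterS2 (cot_ptnorm_differential p1 D0) (grad_norm_null p0 D0 (aeW _ _)) => //.
by move=> x ->.
Qed.

(** The supremum of the countable subfamily given by ae_sup_countable. *)
Lemma ess_sup_exists (F : set (borel X -> R)) : F !=set0 ->
  (forall f, F f -> measurable_fun setT f) -> exists N, is_ess_sup nu F N.
Proof.
move=> F0 mF; have [s [sF hs]] := ae_sup_countable sf F0 mF.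
exists (fun x => ereal_sup (range (fun k => (s k x)%:E))); split.
  split => //; have -> : (fun x => ereal_sup (range (fun k => (s k x)%:E))) =
      (fun x => esups (fun k => (s k x)%:E) 0%N).
    apply/funext => x; congr ereal_sup.
    by apply/seteqP; split => y [k _ <-]; exists k.
  apply: (@measurable_fun_esups _ _ _ setT (fun k x => (s k x)%:E)) => k.
  by apply/measurable_EFinP; exact: mF (sF k).
move=> M [mM hM].
have : \forall x \ae nu, forall k, ((s k x)%:E <= M x)%E.
  by apply/ae_foralln => k; exact: hM.
by apply: filterS => x h; apply: ge_ereal_sup => _ [k _ <-].
Qed.

(** The existence of the essential supremum ensures that vf_ptnorm is one. *)
Lemma vf_ptnorm_dominates Y w : vector_field nu p Y -> is_cot nu p w ->
  (\forall x \ae nu, cot_ptnorm nu p w x <= 1) ->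
  \forall x \ae nu, ((Y w x)%:E <= vf_ptnorm nu p Y x)%E.
Proof.
move=> hY hw w1; pose F := [set Y w | w in [set w | is_cot nu p w /\
  \forall x \ae nu, cot_ptnorm nu p w x <= 1]].
have [||N hN] := @ess_sup_exists F.
- by exists (Y w), w.
- by move=> _ [z [hz _] <-]; case: hY => YL _ _ _ _; exact: Lfun_measurable (YL z hz).
have hE : is_ess_sup nu F (vf_ptnorm nu p Y).
  by rewrite /vf_ptnorm; case: xgetP => [M _ //|/(_ N)].
by case: hE => -[_ h] _; apply: h; exists w.
Qed.

Lemma vf_ptnorm_ge0 Y : vector_field nu p Y -> \forall x \ae nu, (0 <= vf_ptnorm nu p Y x)%E.
Proof.
move=> hY; have h0 := vector_field_null hY is_cot0 cot_ptnorm0.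
have h1 : \forall x \ae nu, cot_ptnorm nu p (differential (cst 0)) x <= 1.
  by apply: filterS cot_ptnorm0 => x ->.
by apply: filterS2 h0 (vf_ptnorm_dominates hY is_cot0 h1) => x ->.
Qed.

(** Where |df| > 1 / (k + 1), the covector df / |df| has norm at most 1; where
    df vanishes, so does Y (df). *)
Lemma vector_field_le Y (a : borel X -> R) u : vector_field nu p Y ->
  (\forall x \ae nu, (vf_ptnorm nu p Y x <= (a x)%:E)%E) -> D1p nu p u ->
  \forall x \ae nu, Y (differential u) x <= a x * gn u x.
Proof.
move=> hY hYa Du; have [YL _ _ YM _] := hY; have mg := @measurable_grad_norm _ _ nu p u.
have cu := is_cot_differential p1 Du.
have small k : \forall x \ae nu, k.+1%:R^-1 < gn u x -> Y (differential u) x <= a x * gn u x.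
  pose A := [set x | k.+1%:R^-1 < gn u x].
  have mA : measurable A by apply: measurable_ltr_set => //; exact: measurable_cst.
  pose h x := \1_A x * (gn u x)^-1.
  have mh : measurable_fun setT h.
    apply: measurable_funM; first exact: measurable_indic.
    have -> : (fun x => (gn u x)^-1) = (fun x => gn u x `^ (-1)).
      by apply/funext => x; rewrite powR_inv1// grad_norm_ge0.
    exact: (measurableT_comp (measurable_powR (-1)) mg).
  have hb x : `|h x| <= k.+1%:R.
    rewrite /h indicE; case: (boolP (x \in A)) => [|_]; last by rewrite mul0r normr0.
    rewrite inE /A /= => kx; have g0 : 0 < gn u x by apply: lt_trans kx.
    by rewrite mul1r ger0_norm ?invr_ge0 ?(ltW g0)// invf_ple ?posrE// ltW.
  have hL := bounded_Lfun nu mh hb.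
  have ch := is_cot_mul_differential p1 hL Du.
  have c1 : \forall x \ae nu, cot_ptnorm nu p (cot_mul h (differential u)) x <= 1.
    apply: filterS (cot_ptnorm_mul_differential p1 hL Du) => x ->.
    rewrite /h indicE; case: (boolP (x \in A)) => [|_]; last by rewrite mul0r normr0 mul0r.
    rewrite inE /A /= => kx; have g0 : 0 < gn u x by apply: lt_trans kx.
    by rewrite mul1r ger0_norm ?invr_ge0 ?(ltW g0)// mulVf// gt_eqF.
  have /ae_eqW e1 := YM h (differential u) hL cu.
  apply: filterS3 e1 hYa (vf_ptnorm_dominates hY ch c1) => x -> h1 h2 kx.
  have := le_trans h2 h1; have g0 : 0 < gn u x by apply: lt_trans kx.
  by rewrite lee_fin /h /= indicE mem_set//= mul1r mulrC ler_pdivrMr.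
have zero : \forall x \ae nu, gn u x = 0 -> Y (differential u) x = 0.
  pose A := [set x | gn u x = 0]; pose h : borel X -> R := \1_A.
  have mA : measurable A.
    have -> : A = gn u @^-1` [set 0] by [].
    by rewrite -[X in measurable X]setTI; apply: mg => //; exact: measurable_set1.
  have mh : measurable_fun setT h by exact: measurable_indic.
  have hb x : `|h x| <= 1 by rewrite /h indicE; case: (x \in A); rewrite ?normr1 ?normr0.
  have hL := bounded_Lfun nu mh hb.
  have ch := is_cot_mul_differential p1 hL Du.
  have c0 : \forall x \ae nu, cot_ptnorm nu p (cot_mul h (differential u)) x = 0.
    apply: filterS (cot_ptnorm_mul_differential p1 hL Du) => x ->.
    rewrite /h indicE; case: (boolP (x \in A)) => [|_]; last by rewrite normr0 mul0r.
    by rewrite inE /A /= => ->; rewrite mulr0.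
  have /ae_eqW e1 := YM h (differential u) hL cu.
  apply: filterS2 e1 (vector_field_null hY ch c0) => x -> + gx.
  by rewrite /h /= indicE mem_set//= mul1r.
have sall : \forall x \ae nu, forall k : nat,
    k.+1%:R^-1 < gn u x -> Y (differential u) x <= a x * gn u x by exact/ae_foralln.
apply: filterS2 sall zero => x h1 h2.
have := grad_norm_ge0 nu p u x; rewrite le_eqVlt => /predU1P[g0|g0].
  by rewrite -g0 mulr0 h2.
by have [k hk] := natSinv_lt g0; exact: (h1 k).
Qed.

End pointwise_norm_of_vector_fields.

(** * The equation at a fixed time *)

Section stationary_equivalence.
Context {R : realType} {X : completeMetricType R}.
Variable nu : {measure set (borel X) -> \bar R}.
Variables p q : R.
Hypothesis p1 : 1 < p.
Hypothesis pq : p^-1 + q^-1 = 1.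
Hypothesis sf : sigma_finite setT nu.
Let p1' : 1 <= p. Proof. exact: ltW. Qed.
Let p0 : 0 < p. Proof. exact: lt_le_trans p1'. Qed.
Let q0 : 0 < q. Proof. exact: (conjugate_gt0 p1 pq). Qed.
Implicit Types (f g u v w : borel X -> R) (rel : R -> R -> Prop) (Y : @cot R X -> borel X -> R).
Local Notation gn := (grad_norm nu p).
Local Notation energy := (energy nu p).
Local Notation repr := (W1p_repr nu p).

(** The conditions which link u(t), u_t(t) and X(t), with rel either <= or =. *)
Definition calibrated rel u v := class_W1p nu p u /\
  exists Y : @cot R X -> borel X -> R,
    [/\ D_q2 nu p Y,
        \forall x \ae nu, (vf_ptnorm nu p Y x `^ q <= (d_ptnorm nu p u x `^ p)%:E)%E,
        is_divergence nu p Y v &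
        forall w, w \in Lfun nu 2%:E -> W1p nu p w ->
          rel (\int[nu]_x (v x * (u x - w x)))
              (\int[nu]_x (Y (differential w) x) - \int[nu]_x (d_ptnorm nu p u x `^ p))].

Lemma repr_L2 u : u \in Lfun nu 2%:E -> class_W1p nu p u -> repr u \in Lfun nu 2%:E.
Proof.
move=> hu /W1p_reprP[ru [[mr _] _]]; apply: (Lfun_ae _ mr hu ru); lra.
Qed.

Lemma integral_mulB u v w : u \in Lfun nu 2%:E -> class_W1p nu p u -> v \in Lfun nu 2%:E ->
  w \in Lfun nu 2%:E ->
  \int[nu]_x (v x * (u x - w x)) = \int[nu]_x (v x * repr u x) - \int[nu]_x (v x * w x).
Proof.
move=> hu cu hv hw; have hr := repr_L2 hu cu; have [ru _] := W1p_reprP cu.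
rewrite -(Lfun1_RintB (L2_mul hv hr) (L2_mul hv hw)).
have [mu_ [mv [mw mr]]] := (Lfun_measurable hu, (Lfun_measurable hv,
  (Lfun_measurable hw, Lfun_measurable hr))).
apply: eq_ae_Rint => //.
- by apply: measurable_funM => //; exact: measurable_funB.
- by apply: measurable_funB; exact: measurable_funM.
- by apply: filterS ru => x ->; rewrite mulrBr.
Qed.

Lemma energy_split f : \int[nu]_x (gn f x `^ (p - 1) * gn f x) = energy f.
Proof. by apply: eq_Rintegral => x _; rewrite (powR_split p1)// grad_norm_ge0. Qed.

Lemma slope_Lfun f w : D1p nu p f -> D1p nu p w ->
  (fun x => gn f x `^ (p - 1) * gn w x) \in Lfun nu 1.
Proof.
move=> Df Dw; apply: (Lfun_mul q0 p0 _ (grad_norm_powB1_Lfun p1 pq Df) (grad_norm_Lfun p0 Dw)).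
by rewrite addrC.
Qed.

Section laplacian_calibrated.
Variables u v : borel X -> R.
Hypothesis hlap : p_laplacian nu p u v.
Let f := repr u.
Let cu : class_W1p nu p u. Proof. by have [_ _ /cheeger_lty] := hlap. Qed.
Let hu : u \in Lfun nu 2%:E. Proof. by have [] := hlap. Qed.
Let hv : v \in Lfun nu 2%:E.
Proof.
have [_ /LfunN h _ _] := hlap.
by have <- : (\- (\- v))%R = v by apply/funext => x /=; rewrite opprK.
Qed.
Let fu : \forall x \ae nu, f x = u x. Proof. by have [] := W1p_reprP cu. Qed.
Let Wf : W1p nu p f. Proof. by have [] := W1p_reprP cu. Qed.
Let hf : f \in Lfun nu 2%:E. Proof. exact: repr_L2. Qed.

(** The subdifferential inequality for competitors of the form f + g. *)
Lemma laplacian_minimal g : W1p nu p g -> g \in Lfun nu 2%:E ->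
  p^-1 * energy f - \int[nu]_x (v x * g x) <= p^-1 * energy (fun x => f x + g x).
Proof.
move=> Wg hg; have [_ _ _ hmin] := hlap.
have L2fg : (fun x => f x + g x) \in Lfun nu 2%:E by apply: (LfunD _ hf hg); lra.
have Wfg : W1p nu p (fun x => f x + g x).
  have := W1p_lin p1 1 Wf Wg; have -> // : (fun x => 1 * f x + g x) = (fun x => f x + g x).
  by apply/funext => x; rewrite mul1r.
have := hmin _ L2fg.
rewrite (cheegerE p1 Wf fu) (cheegerE p1 Wfg (aeW _ (fun=> erefl))) -EFinD lee_fin.
suff -> : \int[nu]_x ((\- v)%R x * (f x + g x - u x)) = - (\int[nu]_x (v x * g x)) by [].
have hvg := L2_mul hv hg; rewrite -mulN1r -(Lfun1_RintZ (-1) hvg).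
have [mu_ [mv [mg mf]]] := (Lfun_measurable hu, (Lfun_measurable hv,
  (Lfun_measurable hg, Lfun_measurable hf))).
apply: eq_ae_Rint => //.
- apply: measurable_funM; first exact: measurableT_comp.
  by apply: measurable_funB => //; exact: measurable_funD.
- by apply: measurable_funM => //; exact: measurable_funM.
- by apply: filterS fu => x ->; rewrite /= [_ + g x]addrC addrK mulN1r mulNr.
Qed.

(** By the first variation the functional w |-> - int v w is bounded by
    int |Df| ^ (p - 1) |Dw|, whence a vector field Y with |Y| <= |Df| ^ (p - 1) and
    divergence v; testing with f itself gives - int v f = int |Df| ^ p. *)
Lemma laplacian_calibrated : calibrated eq u v.
Proof.
have Df : D1p nu p f := Wf.1.
have gf0 x : 0 <= gn f x := grad_norm_ge0 nu p f x.
pose M0 : set (borel X -> R) := [set w | W1p nu p w /\ w \in Lfun nu 2%:E].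
have M0W : M0 f by split.
pose l w := - (\int[nu]_x (v x * w x)).
pose a x := gn f x `^ (p - 1).
have ha : a \in Lfun nu q%:E := grad_norm_powB1_Lfun p1 pq Df.
have lle w : M0 w -> l w <= \int[nu]_x (a x * gn w x).
  by move=> [Ww hw]; exact: (first_variation_le p1 pq Wf hv laplacian_minimal Ww hw).
have a0 x : 0 <= a x by exact: powR_ge0.
have M00 : M0 (fun=> 0).
  split; last by apply: Lfun0; lra.
  by split; [exact: D1p0|exact: Lfun0].
have M0l (c : R) w z : M0 w -> M0 z -> M0 (fun x => c * w x + z x).
  move=> [Ww hw] [Wz hz]; split; first exact: W1p_lin.
  by apply: (LfunD _ (L2Z c hw) hz); lra.
have M0D w : M0 w -> D1p nu p w by move=> [[]].
have ll (c : R) w z : M0 w -> M0 z -> l (fun x => c * w x + z x) = c * l w + l z.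
  move=> [Ww hw] [Wz hz]; rewrite /l.
  have -> : \int[nu]_x (v x * (c * w x + z x)) =
      c * \int[nu]_x (v x * w x) + \int[nu]_x (v x * z x).
    rewrite -(Lfun1_RintZ c (L2_mul hv hw)).
    rewrite -(Lfun1_RintD (Lfun1Z c (L2_mul hv hw)) (L2_mul hv hz)).
    by apply: eq_Rintegral => x _; rewrite mulrDr mulrCA.
  by rewrite opprD mulrN.
have [Y [hY Yle Yint]] := vector_field_of_functional p1' q0 pq sf ha a0 M00 M0l M0D ll lle.
have hdiv : is_divergence nu p Y v.
  by split => // g Wg hg; rewrite Yint// opprK.
split => //; exists Y; split => //; first by split => //; exists v.
- have Na : \forall x \ae nu, (vf_ptnorm nu p Y x <= (a x)%:E)%E.
    rewrite /vf_ptnorm; case: xgetP => [N _ [_ Nmin]|_]; last by apply: aeW => x; rewrite lee_fin.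
    apply: (Nmin (EFin \o a)); split.
      by apply/measurable_EFinP; exact: Lfun_measurable ha.
    move=> _ [w [hw w1] <-]; apply: filterS2 (Yle w hw) w1 => x h1 h2.
    rewrite lee_fin; apply: le_trans (ler_norm _) _; apply: (le_trans h1).
    by rewrite ler_piMr.
  apply: filterS3 (d_ptnormE p1 cu) Na (vf_ptnorm_ge0 p1' sf hY) => x -> h1 h2.
  have := lee_pow (ltW q0) h2 h1; rewrite poweR_EFin /a.
  by rewrite (powR_conjugate p1 pq (gf0 x)).
- move=> w hw Ww; rewrite (integral_mulB hu cu hv hw) Yint// (energy_d_ptnorm p1 cu) -/f.
  have h1 := first_variation_self p1 pq Wf hf hv laplacian_minimal.
  have h2 := first_variation_le p1 pq Wf hv laplacian_minimal Wf hf.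
  rewrite energy_split in h2; rewrite /l; move: h1 h2.
  move: (energy f) (\int[nu]_x (v x * f x)) (\int[nu]_x (v x * w x)) => E i j h1 h2; lra.
Qed.

End laplacian_calibrated.

Lemma divergence_L2 Y v : is_divergence nu p Y v -> v \in Lfun nu 2%:E.
Proof. by case. Qed.

(** The bound on |Y| reads |Y| <= |du| ^ (p - 1), and Y (dw) <= |Y| |dw|. *)
Lemma calibrated_bound u Y : class_W1p nu p u -> vector_field nu p Y ->
  (\forall x \ae nu, (vf_ptnorm nu p Y x `^ q <= (d_ptnorm nu p u x `^ p)%:E)%E) ->
  forall w, D1p nu p w ->
    \int[nu]_x Y (differential w) x <= \int[nu]_x (gn (repr u) x `^ (p - 1) * gn w x).
Proof.
move=> cu hY bY w Dw; have [_ [Df _]] := W1p_reprP cu.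
have hle : \forall x \ae nu, (vf_ptnorm nu p Y x <= (gn (repr u) x `^ (p - 1))%:E)%E.
  apply: filterS3 bY (d_ptnormE p1 cu) (vf_ptnorm_ge0 p1' sf hY) => x h1 h2 h3.
  apply: (lee_powK q0 h3); first by rewrite lee_fin powR_ge0.
  rewrite poweR_EFin (powR_conjugate p1 pq); last exact: grad_norm_ge0.
  by rewrite -h2.
have [YL _ _ _ _] := hY; have YLw := YL _ (is_cot_differential p1' Dw).
apply: (le_ae_Rint measurableT YLw (slope_Lfun Df Dw)).
exact: (vector_field_le p1' sf hY hle Dw).
Qed.

(** The inequality for w = 0 gives int Y(du) >= int |du| ^ p, the bound on Y the
    converse. *)
Lemma calibrated_le_eq u v : u \in Lfun nu 2%:E ->
  calibrated (fun a b => a <= b) u v -> calibrated eq u v.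
Proof.
move=> hu [cu [Y [hD bY hdiv hle]]]; split => //; exists Y; split => // w hw Ww.
have hv := divergence_L2 hdiv; have hf := repr_L2 hu cu.
have [hY _] := hD; have [_ divE] := hdiv; have [_ Wf] := W1p_reprP cu.
have W0 : W1p nu p (fun=> 0).
  by split; [exact: D1p0|exact: Lfun0].
have h0 : (fun=> 0) \in Lfun nu 2%:E.
  by apply: Lfun0; lra.
have k0 := hle _ h0 W0.
rewrite (integral_mulB hu cu hv h0) (energy_d_ptnorm p1 cu) in k0.
have k1 := calibrated_bound cu hY bY Wf.1; rewrite energy_split in k1.
rewrite (integral_mulB hu cu hv hw) (energy_d_ptnorm p1 cu).
have d0 := divE _ W0 h0; have df := divE _ Wf hf; have dw := divE _ Ww hw.
move: k0 k1 d0 df dw.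
move: (energy (repr u)) (\int[nu]_x (v x * repr u x)) (\int[nu]_x (v x * w x))
  (\int[nu]_x (v x * 0)) (\int[nu]_x Y (differential (fun=> 0)) x)
  (\int[nu]_x Y (differential (repr u)) x) (\int[nu]_x Y (differential w) x).
by move=> E i j k a b c h1 h2 h3 h4 h5; lra.
Qed.

(** Young's inequality |du| ^ (p - 1) |dw| <= |dw| ^ p / p + |du| ^ p / q. *)
Lemma calibrated_laplacian u v : u \in Lfun nu 2%:E -> calibrated eq u v -> p_laplacian nu p u v.
Proof.
move=> hu [cu [Y [[hY _] bY hdiv heq]]]; have hv := divergence_L2 hdiv.
have [ru Wf] := W1p_reprP cu; have cE := cheegerE p1 Wf ru.
split => //; [exact: LfunN|by rewrite cE ltry|].
move=> w hw; have [cw|ncw] := pselect (class_W1p nu p w); last first.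
  by rewrite {2}/cheeger asboolF// leey.
have [rw Wg] := W1p_reprP cw; have hg := repr_L2 hw cw.
rewrite cE (cheegerE p1 Wg rw) -EFinD lee_fin.
have -> : \int[nu]_x ((\- v)%R x * (w x - u x)) = \int[nu]_x (v x * (u x - repr w x)).
  have [mu_ [mv [mw mg]]] := (Lfun_measurable hu, (Lfun_measurable hv,
    (Lfun_measurable hw, Lfun_measurable hg))).
  apply: eq_ae_Rint => //.
  - apply: measurable_funM; first exact: measurableT_comp.
    exact: measurable_funB.
  - by apply: measurable_funM => //; exact: measurable_funB.
  - by apply: filterS rw => x ->; rewrite /= mulNr -mulrN opprB.
rewrite (heq _ hg Wg) (energy_d_ptnorm p1 cu).
have k1 := calibrated_bound cu hY bY Wg.1.
have k2 : \int[nu]_x (gn (repr u) x `^ (p - 1) * gn (repr w) x) <=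
    p^-1 * energy (repr w) + (1 - p^-1) * energy (repr u).
  have [hw1 hu1] := (grad_norm_pow_Lfun p1 Wg.1, grad_norm_pow_Lfun p1 Wf.1).
  have eR := etrans (Lfun1_RintD (Lfun1Z p^-1 hw1) (Lfun1Z (1 - p^-1) hu1))
    (congr2 +%R (Lfun1_RintZ p^-1 hw1) (Lfun1_RintZ (1 - p^-1) hu1)).
  apply: (eq_le_eq erefl _ eR).
  apply: (le_ae_Rint measurableT (slope_Lfun Wf.1 Wg.1)
    (Lfun1D (Lfun1Z p^-1 hw1) (Lfun1Z (1 - p^-1) hu1))).
  by apply: aeW => x; apply: (powR_tangent p1 pq); exact: grad_norm_ge0.
move: k1 k2; move: (energy (repr u)) (energy (repr w)) (\int[nu]_x _) (\int[nu]_x _).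
by move=> E F i j h1 h2; lra.
Qed.

End stationary_equivalence.

(** * The Cauchy problem *)

(** The endpoints form a null set. *)
Lemma ae_closed_interval (R : realType) (T : R) (P : R -> Prop) :
  (\forall t \ae (@lebesgue_measure R), t \in `]0, T[ -> P t) ->
  \forall t \ae (@lebesgue_measure R), t \in `[0, T] -> P t.
Proof.
move=> [M [mM M0 hM]]; exists (M `|` ([set 0] `|` [set T])).
have m1 (r : R) : measurable [set r] := measurable_set1 r.
have s1 (r : R) : lebesgue_measure [set r] = 0%E := lebesgue_measure_set1 r.
have E0 : lebesgue_measure ([set 0] `|` [set T] : set R) = 0%E.
  exact: (etrans (@measureU0 _ _ _ (@lebesgue_measure R) _ _ (m1 0) (m1 T) (s1 T)) (s1 0)).
have mE := measurableU _ _ (m1 0) (m1 T).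
split.
- exact: measurableU.
- exact: (etrans (@measureU0 _ _ _ (@lebesgue_measure R) _ _ mM mE E0) M0).
- move=> t /=; have [->|t0] := eqVneq t 0; first by move=> _; right; left.
  have [->|tT] := eqVneq t T; first by move=> _; right; right.
  move=> nP; left; apply: hM => /= h; apply: nP; rewrite in_itv/= => /andP[h0 hT].
  by apply: h; rewrite in_itv/= !lt_neqAle h0 hT tT eq_sym t0.
Qed.

Theorem corollary3p10 (R : realType) (X : completeMetricType R)
    (nu : {measure set (borel X) -> \bar R}) (p q T : R)
    (u0 : borel X -> R) (u : R -> borel X -> R)
    (hp : 1 < p) (hpq : p^-1 + q^-1 = 1)
    (hX : separable X) (hnu : radon nu) (hb : finite_on_bounded nu)
    (hT : 0 < T) (hu0 : u0 \in Lfun nu 2%:E) :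
  [<-> weak_solution nu p T u0 u ;
       variational_solution nu p q T u0 (fun a b => a <= b) u ;
       variational_solution nu p q T u0 (fun a b => a = b) u].
Proof.
have sf := finite_on_bounded_sigma_finite hb.
have uL v t : cauchy_regularity nu T u0 u v -> t \in `[0, T] -> u t \in Lfun nu 2%:E.
  by move=> [[h _] _ _]; exact: h.
tfae.
- move=> [v hv hlap]; exists v => //; apply: ae_closed_interval.
  apply: ae_lebesgue_imply hlap => t h /h /(laplacian_calibrated hp hpq sf).
  move=> [cu [Y [hD bY hdiv heq]]]; split => //; exists Y; split => // w hw Ww.
  by rewrite (heq w hw Ww).
- move=> [v hv hle]; exists v => //; apply: ae_lebesgue_imply hle => t h tT.
  exact: (calibrated_le_eq hp hpq sf (uL v t hv tT) (h tT)).
- move=> [v hv heq]; exists v => //; apply: ae_lebesgue_imply heq => t h tT.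
  have {}tT := subset_itv_oo_cc tT.
  exact: (calibrated_laplacian hp hpq sf (uL v t hv tT) (h tT)).
Qed.
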